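(* There is an algorithm which, given a spider $G$ on $n$ vertices and two independent sets $I, J$ of $G$ with $|I| = |J|$ such that $I$ is reconfigurable to $J$ by sliding tokens (i.e., a $\mathsf{TS}$-sequence between $I$ and $J$ exists), constructs a $\mathsf{TS}$-sequence between $I$ and $J$ of minimum length in $O(n^2)$ time.
   Context: A spider is a tree having exactly one vertex (its body) of degree at least $3$. A $\mathsf{TS}$-sequence in a graph $G$ between independent sets $I$ and $J$ with $|I|=|J|$ is a sequence $\langle I_1, \dots, I_\ell\rangle$ of independent sets of $G$ with $I_1 = I$, $I_\ell = J$, $|I_i| = |I|$ for all $i$, and such that for each $2 \le i \le \ell$ there is an edge $xy \in E(G)$ with $I_{i-1}\setminus I_i = \{x\}$ and $I_i \setminus I_{i-1} = \{y\}$ (one token slides along an edge). Its length is $\ell - 1$, the number of token-slides. $I$ is reconfigurable to $J$ if such a sequence exists. *)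

(* Defs.v *)
From mathcomp Require Import all_boot.

Set Implicit Arguments.
Unset Strict Implicit.
Unset Printing Implicit Defensive.

(** * Spiders and token sliding *)

Section Graphs.
Variables (T : finType) (e : rel T).

Definition simple_graph : Prop := symmetric e /\ irreflexive e.

Definition degree (x : T) : nat := #|[set y | e x y]|.

(* A closed walk x - y - x along one edge satisfies [ucycle e [:: x; y]], so
   the cycles of a simple graph are the [ucycle]s of size at least 3. *)
Definition is_tree : Prop :=
  [/\ simple_graph,
      0 < #|T|,
      forall x y, connect e x y
    & forall c : seq T, ucycle e c -> size c < 3].

Definition is_spider : Prop :=
  is_tree /\ exists! b : T, 3 <= degree b.

Definition independent (I : {set T}) : Prop :=
  {in I &, forall x y, ~~ e x y}.

Definition slide (A B : {set T}) (x y : T) : Prop :=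
  [/\ e x y, A :\: B = [set x] & B :\: A = [set y]].

(* The sequence <I_1, ..., I_l> is S, with I_(i+1) = nth set0 S i. *)
Definition TS_sequence (I J : {set T}) (S : seq {set T}) : Prop :=
  [/\ 0 < size S,
      nth set0 S 0 = I /\ nth set0 S (size S).-1 = J,
      forall A, A \in S -> independent A,
      forall A, A \in S -> #|A| = #|I|
    & forall i, i.+1 < size S ->
        exists x y, slide (nth set0 S i) (nth set0 S i.+1) x y].

Definition TS_length (S : seq {set T}) : nat := (size S).-1.

Definition reconfigurable (I J : {set T}) : Prop :=
  exists S, TS_sequence I J S.

Definition shortest_TS_sequence (I J : {set T}) (S : seq {set T}) : Prop :=
  TS_sequence I J S /\
  forall S', TS_sequence I J S' -> TS_length S <= TS_length S'.

(* ms lists, in order, the slides (x, y) performed by S. *)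
Definition slides_of (S : seq {set T}) (ms : seq (T * T)) : Prop :=
  size ms = TS_length S /\
  forall i (m0 : T * T), i < size ms ->
    slide (nth set0 S i) (nth set0 S i.+1) (nth m0 ms i).1 (nth m0 ms i).2.

End Graphs.

(** * Word RAM programs with unit-cost instructions *)

(* Scalar variables and arrays are named by numbers. A program is a finite
   term, so it only uses a fixed number of them. *)
Inductive cmd : Type :=
| Skip
| Const of nat & nat               (* x := c *)
| Copy of nat & nat                (* x := y *)
| Add of nat & nat & nat           (* x := y + z *)
| Sub of nat & nat & nat           (* x := y - z *)
| Read of nat & nat & nat          (* x := a[y] *)
| Write of nat & nat & nat         (* a[x] := y *)
| Emit of nat                     (* append x to the output *)
| Seq of cmd & cmd
| If of nat & cmd & cmd            (* if x <> 0 then _ else _ *)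
| While of nat & cmd.              (* while x <> 0 do _ *)

Record state : Type := State {
  vars : nat -> nat;
  arrs : nat -> nat -> nat;
  out : seq nat
}.

Definition upd (V : Type) (f : nat -> V) (x : nat) (v : V) : nat -> V :=
  fun y => if y == x then v else f y.

Definition set_var (s : state) (x v : nat) : state :=
  State (upd (vars s) x v) (arrs s) (out s).

Definition set_arr (s : state) (a i v : nat) : state :=
  State (vars s) (upd (arrs s) a (upd (arrs s a) i v)) (out s).

Definition put (s : state) (v : nat) : state :=
  State (vars s) (arrs s) (rcons (out s) v).

(* [exec W p s t s']: started in s, the program p halts in s' after t steps.
   Only addition can create a value larger than the input and the constants of
   p, and it is taken modulo W. *)
Inductive exec (W : nat) : cmd -> state -> nat -> state -> Prop :=
| ESkip s : exec W Skip s 1 s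
| EConst s x c : exec W (Const x c) s 1 (set_var s x c)
| ECopy s x y : exec W (Copy x y) s 1 (set_var s x (vars s y))
| EAdd s x y z :
    exec W (Add x y z) s 1 (set_var s x ((vars s y + vars s z) %% W))
| ESub s x y z : exec W (Sub x y z) s 1 (set_var s x (vars s y - vars s z))
| ERead s x a y : exec W (Read x a y) s 1 (set_var s x (arrs s a (vars s y)))
| EWrite s a x y :
    exec W (Write a x y) s 1 (set_arr s a (vars s x) (vars s y))
| EEmit s x : exec W (Emit x) s 1 (put s (vars s x))
| ESeq p q s s' s'' t t' :
    exec W p s t s' -> exec W q s' t' s'' -> exec W (Seq p q) s (t + t') s''
| EIfT x p q s s' t :
    vars s x != 0 -> exec W p s t s' -> exec W (If x p q) s t.+1 s'
| EIfF x p q s s' t :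
    vars s x = 0 -> exec W q s t s' -> exec W (If x p q) s t.+1 s'
| EWhileT x p s s' s'' t t' :
    vars s x != 0 -> exec W p s t s' -> exec W (While x p) s' t' s'' ->
    exec W (While x p) s (t + t').+1 s''
| EWhileF x p s : vars s x = 0 -> exec W (While x p) s 1 s.

Lemma exec_det W p s t1 s1 t2 s2 :
  exec W p s t1 s1 -> exec W p s t2 s2 -> t1 = t2 /\ s1 = s2.
Proof.
move=> H; elim: H t2 s2 => {p s t1 s1}.
1-8: by move=> > H; inversion H.
- move=> p q s s' s'' t t' _ IH1 _ IH2 t2 s2 H; inversion H; subst.
  match goal with h : exec _ p _ _ _ |- _ => have [? ?] := IH1 _ _ h end; subst.
  by match goal with h : exec _ q _ _ _ |- _ => have [? ?] := IH2 _ _ h end; subst.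
- move=> x p q s s' t nz _ IH t2 s2 H; inversion H; subst.
    by match goal with h : exec _ p _ _ _ |- _ => have [? ?] := IH _ _ h end; subst.
  by match goal with h : vars s x = 0 |- _ => rewrite h in nz end.
- move=> x p q s s' t z _ IH t2 s2 H; inversion H; subst.
    by match goal with h : is_true (vars s x != 0) |- _ => rewrite z in h end.
  by match goal with h : exec _ q _ _ _ |- _ => have [? ?] := IH _ _ h end; subst.
- move=> x p s s' s'' t t' nz _ IH1 _ IH2 t2 s2 H; inversion H; subst.
    match goal with h : exec _ p _ _ _ |- _ => have [? ?] := IH1 _ _ h end; subst.
    by match goal with h : exec _ (While _ _) _ _ _ |- _ =>
         have [? ?] := IH2 _ _ h end; subst.
  by match goal with h : vars _ x = 0 |- _ => rewrite h in nz end.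
- move=> x p s z t2 s2 H; inversion H; subst => //.
  by match goal with h : is_true (vars _ x != 0) |- _ => rewrite z in h end.
Qed.

(** * Input and output conventions *)

Section Encoding.
Variables (n : nat).

(* The row-major adjacency matrix of e: entry x * n + y is 1 iff e x y. *)
Definition adj_array (e : rel 'I_n) (k : nat) : nat :=
  [exists x : 'I_n, exists y : 'I_n, (k == x * n + y) && e x y].

Definition set_array (I : {set 'I_n}) (k : nat) : nat :=
  [exists x : 'I_n, (k == x) && (x \in I)].

(* Variable 0 holds n; arrays 0, 1, 2 hold the graph, I and J; all other
   variables and array cells are 0. *)
Definition input_state (e : rel 'I_n) (I J : {set 'I_n}) : state :=
  State (fun x => if x == 0 then n else 0)
        (fun a => match a with
                  | 0 => adj_array e
                  | 1 => set_array I
                  | 2 => set_array J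
                  | _ => fun _ => 0
                  end)
        [::].

Definition moves_output (ms : seq ('I_n * 'I_n)) : seq nat :=
  flatten [seq [:: val m.1; val m.2] | m <- ms].

End Encoding.

(* Words of O(log n) bits: k * log2 (n + 2) of them. *)
Definition word_bound (k n : nat) : nat := (n + 2) ^ k.

(* Main.v *)
Require Import Defs.
From mathcomp Require Import all_boot zify.

Set Implicit Arguments.
Unset Strict Implicit.
Unset Printing Implicit Defensive.

(** Describe a configuration X by the numbers of its tokens that lie in leg k at
    distance at least p from the body. A slide changes exactly one of these
    numbers, by one, so the l1-distance of two configurations bounds the number
    of slides between them from below.

    The bound is attained between two configurations with a token on the body:
    in each leg let tokens that have to go outwards do so, farthest first; then
    let tokens go inwards, nearest first, and whenever the first token of a leg
    has to reach the occupied body, first push the token on the body into a leg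
    that still lacks tokens.

    A sequence that never uses the body preserves the number of tokens in every
    leg, and then the distance itself is attained. Otherwise let a token of leg i
    be the first to enter the body. At that moment the neighbours of the body are
    free, so in every other leg the tokens packed at positions 1, 3, 5, ... have
    moved outwards by at least one; hence the configuration P_i obtained from I
    by just these moves lies on a geodesic to the first configuration with a
    token on the body. Reading the sequence backwards gives a leg j and Q_j for
    J, so that the optimum is the least value of d(I, P_i) + d(P_i, Q_j) +
    d(Q_j, J). Each leg contributes to this sum independently of the others,
    apart from whether it is leg i or leg j, and all pairs (i, j) can be compared
    in quadratic time. *)

(** * Coordinates of a spider and token counts *)

(** A shortest transport may never undo a slide. Within a leg this is a matter of order: a token
    that blocks another one either still has to move the same way, and is then treated earlier, or
    the target would violate independence. The obstacle is the body. It has to be free before the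
    first token of a leg reaches the head, and all other heads have to be free when that token
    enters. A target with a token on the body leaves all heads empty, so once the outward slides are
    done, an occupied head signals a leg with too many tokens. The inward sweep keeps the invariant
    that an occupied head excludes a surplus in every other leg. If the body is empty at the start,
    this asks for a surplus in one leg only, and P_i indeed takes a token from leg i alone.

    Such a transport aims at a target with a token on the body, which J need not have. The last part
    of the route is therefore computed from J to Q_j, and its log is printed backwards with the ends
    of each slide exchanged. The counts ignore the body, but with the number of tokens they
    determine the configuration, so the runs from I and from J end in the same set. *)

Definition absd (x y : nat) := (x - y) + (y - x).

Section Coordinates.
Variables (T : finType) (e : rel T) (b : T).
Variables (par : T -> T) (pos : T -> nat) (leg : T -> T).

(** A leg is named by its head, the neighbour of the body, and the body is a leg of its own.
    [child_uniq] says that legs do not branch. *)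
Record spider_coords : Prop := SpiderCoords {
  pos_body : pos b = 0;
  pos_par : forall v, v != b -> pos v = (pos (par v)).+1;
  edgeE : forall x y,
    e x y = (x != b) && (par x == y) || (y != b) && (par y == x);
  leg_body : leg b = b;
  leg_head : forall v, v != b -> par v = b -> leg v = v;
  leg_par : forall v, v != b -> par v != b -> leg v = leg (par v);
  child_uniq : forall x y,
    x != b -> y != b -> par x = par y -> par x != b -> x = y }.

Definition beyond (X : {set T}) (k : T) (p : nat) :=
  #|[set u in X | (leg u == k) && (p <= pos u)]|.

Definition leg_size (k : T) := #|[set u | leg u == k]|.

(** The count at the coordinates of v is the number of tokens that the edge from [par v] to v
    separates from the body. The sum is thus an earth mover's distance: the net flow across each
    edge, added over all edges. *)
Definition profile_dist (f g : T -> nat -> nat) :=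
  \sum_(v | v != b) absd (f (leg v) (pos v)) (g (leg v) (pos v)).

(** What the counts of an independent set satisfy; [prof_two] says that two adjacent positions hold
    at most one token. Targets are such functions and not sets: that an exit profile comes from an
    independent set is only learnt when the transport arrives there. *)
Record profile (f : T -> nat -> nat) : Prop := Profile {
  prof_mono : forall k p, 0 < p -> f k p.+1 <= f k p;
  prof_two : forall k p, 0 < p -> f k p <= (f k p.+2).+1;
  prof_van : forall k p, 0 < p -> 0 < f k p ->
    exists v, [/\ v != b, leg v = k & pos v = p] }.

Definition move (X : {set T}) (x y : T) := y |: X :\ x.

Inductive moves (X0 : {set T}) : seq (T * T) -> {set T} -> Prop :=
| moves_nil : moves X0 [::] X0
| moves_rcons ms X x y :
    moves X0 ms X -> e x y -> x \in X -> y \notin X ->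
    independent e (move X x y) -> moves X0 (rcons ms (x, y)) (move X x y).

Hypothesis C : spider_coords.

Lemma pos_eq0 v : (pos v == 0) = (v == b).
Proof.
case: (eqVneq v b) => [->|nvb]; first by rewrite (pos_body C).
by rewrite (pos_par C nvb).
Qed.

Lemma pos_gt0 v : v != b -> 0 < pos v.
Proof. by rewrite lt0n pos_eq0. Qed.

Lemma par_body v : v != b -> pos v = 1 -> par v = b.
Proof. by move=> nvb; rewrite (pos_par C nvb) => -[/eqP]; rewrite pos_eq0 => /eqP. Qed.

Lemma leg_pos1 v : pos v = 1 -> leg v = v.
Proof.
move=> p1; have nvb : v != b by rewrite -pos_eq0 p1.
by apply: (leg_head C) => //; apply: par_body.
Qed.

Lemma leg_nbody v : v != b -> [/\ leg v != b, pos (leg v) = 1 & leg (leg v) = leg v].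
Proof.
have [n] := ubnP (pos v); elim: n v => // n IH v le_n nvb.
case: (eqVneq (par v) b) => [pb|npb].
  have p1 : pos v = 1 by rewrite (pos_par C nvb) pb (pos_body C).
  by rewrite (leg_pos1 p1) (leg_pos1 p1).
rewrite (leg_par C nvb npb); apply: IH => //.
by move: le_n; rewrite (pos_par C nvb); lia.
Qed.

Lemma leg_idem v : leg (leg v) = leg v.
Proof.
case: (eqVneq v b) => [->|nvb]; first by rewrite !(leg_body C).
by case: (leg_nbody nvb).
Qed.

Lemma coord_inj x y : leg x = leg y -> pos x = pos y -> x = y.
Proof.
have [n le_n] := ubnP (pos x); elim: n x y le_n => // n IH x y le_n el ep.
case: (eqVneq x b) => [xb|nxb].
  by apply/eqP; rewrite xb eq_sym -pos_eq0 -ep xb (pos_body C).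
have nyb : y != b by rewrite -pos_eq0 -ep pos_eq0.
move: (ep); rewrite (pos_par C nxb) (pos_par C nyb) => -[ep'].
case: (eqVneq (par x) b) => [pxb|npxb].
  have pyb : par y = b by apply/eqP; rewrite -pos_eq0 -ep' pxb (pos_body C).
  by move: el; rewrite (leg_head C nxb pxb) (leg_head C nyb pyb).
have npyb : par y != b by rewrite -pos_eq0 -ep' pos_eq0.
apply: (child_uniq C) => //; apply: IH => //.
  by move: le_n; rewrite (pos_par C nxb); lia.
by rewrite -(leg_par C nxb npxb) -(leg_par C nyb npyb).
Qed.

Lemma coord_down v p : 0 < p <= pos v ->
  exists u, [/\ u != b, leg u = leg v & pos u = p].
Proof.
move=> /andP [p0]; rewrite leq_eqVlt => /orP [/eqP ep|].
  by exists v; split => //; rewrite -pos_eq0 -ep; lia.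
have [n le_n] := ubnP (pos v); elim: n v le_n => // n IH v le_n lt_p.
have nvb : v != b by rewrite -pos_eq0; lia.
move: (pos_par C nvb) => pv.
have npb : par v != b by rewrite -pos_eq0; lia.
rewrite (leg_par C nvb npb).
case: (ltngtP p (pos (par v))) => [lt|gt|eq]; last 1 first.
- by exists (par v); split.
- by apply: IH => //; lia.
- by lia.
Qed.

Lemma par_coord w : w != b -> pos w != 1 ->
  [/\ par w != b, leg (par w) = leg w & (pos (par w)).+1 = pos w].
Proof.
move=> nwb; rewrite (pos_par C nwb) eqSS pos_eq0 => npb.
by rewrite (leg_par C nwb npb).
Qed.

Lemma par_of_coord u w : w != b -> u != b -> leg u = leg w -> pos w = (pos u).+1 ->
  par w = u.
Proof.
move=> nwb nub el ep.
have [] := @par_coord w nwb; first by have := pos_gt0 nub; lia.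
by move=> _ el' ep'; apply: coord_inj; [rewrite el' el | lia].
Qed.

Lemma edge_par w : w != b -> e (par w) w.
Proof. by move=> nwb; rewrite (edgeE C) nwb eqxx orbT. Qed.

Lemma edge_sym x y : e x y = e y x.
Proof. by rewrite !(edgeE C) orbC. Qed.

(** The positions in a leg form an initial segment by [coord_down] and do not repeat by [coord_inj],
    so they run exactly up to the size of the leg. *)
Lemma leg_size_coord k p : k != b ->
  reflect (exists v, [/\ v != b, leg v = k & pos v = p]) (0 < p <= leg_size k).
Proof.
move=> nkb.
have pos_legk v : leg v = k -> 0 < pos v.
  move=> lv; apply: pos_gt0; apply: contraNneq nkb => vb.
  by rewrite -lv vb (leg_body C).
have inj : {in [set u | leg u == k] &, injective pos}.
  by move=> u v; rewrite !inE => /eqP lu /eqP lv; apply: coord_inj; rewrite lu.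
apply: (iffP idP) => [/andP [p0 ple]|[v [nvb lv pv]]].
- case: (pickP [pred v | (leg v == k) && (p <= pos v)]) => [v /andP [/eqP lv pv]|nov].
    have [|u [nub lu pu]] := @coord_down v p; first by rewrite p0.
    by exists u; rewrite lu.
  suff : leg_size k < p by lia.
  have sub : {subset [seq pos u | u in [set u | leg u == k]] <= iota 1 p.-1}.
    move=> q /imageP [u]; rewrite inE => /eqP lu ->; rewrite mem_iota.
    by move: (nov u) (pos_legk u lu) => /=; rewrite lu eqxx /=; lia.
  have /= := uniq_leq_size _ sub; rewrite size_iota size_map -cardE => H.
  have {}H : leg_size k <= p.-1.
    by apply: H; apply/dinjectiveP.
  by lia.
- have p0 : 0 < p by rewrite -pv; apply: pos_legk.
  rewrite p0 /=.
  have sub : {subset iota 1 p <= [seq pos u | u in [set u | leg u == k]]}.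
    move=> q; rewrite mem_iota => /andP [q0 qp].
    have [|u [nub lu pu]] := @coord_down v q; first by rewrite q0 pv; lia.
    by apply/imageP; exists u; rewrite ?inE ?lu ?lv.
  by have := uniq_leq_size (iota_uniq 1 p) sub; rewrite size_iota size_map -cardE.
Qed.

Lemma beyondE X k p :
  beyond X k p = \sum_(u in X) ((leg u == k) && (p <= pos u)).
Proof.
rewrite /beyond -sum1_card big_mkcond [RHS]big_mkcond /=; apply: eq_bigr => u _.
by rewrite inE; case: (u \in X) => //=; case: (_ && _).
Qed.

Lemma beyondS X k p : beyond X k p =
  beyond X k p.+1 + [exists u in X, (leg u == k) && (pos u == p)].
Proof.
have -> : beyond X k p = beyond X k p.+1 +
    #|[set u in X | (leg u == k) && (pos u == p)]|.
  rewrite /beyond -(cardsID [set u | p < pos u]); congr (_ + _).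
    apply: eq_card => u; rewrite !inE.
    by case: (u \in X); case: (leg u == k) => //=; lia.
  apply: eq_card => u; rewrite !inE.
  by case: (u \in X); case: (leg u == k) => //=; lia.
congr (_ + _); case: existsP => [[u /andP [uX /andP [/eqP lu /eqP pu]]]|no] /=.
  apply/eqP/cards1P; exists u; apply/setP => v; rewrite !inE.
  apply/idP/eqP => [/andP [_ /andP [/eqP lv /eqP pv]]|->].
    by apply: coord_inj; rewrite ?lu ?pu.
  by rewrite uX lu pu !eqxx.
apply/eqP; rewrite cards_eq0; apply/eqP/setP => v; rewrite !inE.
by apply/negP => H; apply: no; exists v.
Qed.

(** The drop of the count at a vertex shows whether it is occupied, which turns questions about
    tokens into arithmetic on counts. *)
Lemma beyond_mem X v :
  beyond X (leg v) (pos v) = beyond X (leg v) (pos v).+1 + (v \in X).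
Proof.
rewrite beyondS; congr (_ + nat_of_bool _); apply/existsP/idP => [|vX].
  by move=> [u /andP [uX /andP [/eqP lu /eqP pu]]]; rewrite -(coord_inj lu pu).
by exists v; rewrite vX !eqxx.
Qed.

Lemma beyond_mono X k p : beyond X k p.+1 <= beyond X k p.
Proof. by rewrite [leqRHS]beyondS leq_addr. Qed.

Lemma beyond_van X k p : 0 < p -> 0 < beyond X k p ->
  exists v, [/\ v != b, leg v = k & pos v = p].
Proof.
move=> p0; rewrite card_gt0 => /set0Pn [u]; rewrite !inE => /andP [_ /andP [/eqP lu pu]].
by rewrite -lu; apply: coord_down; rewrite p0.
Qed.

Lemma beyond_body X p : 0 < p -> beyond X b p = 0.
Proof.
move=> p0; apply/eqP; rewrite -leqn0 leqNgt; apply/negP => /(beyond_van p0).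
by move=> [v [nvb lv _]]; have [] := leg_nbody nvb; rewrite lv eqxx.
Qed.

Lemma beyond_body0 X : beyond X b 0 = (b \in X).
Proof.
have := beyond_mem X b.
by rewrite (leg_body C) (pos_body C) [X in _ = X + _]beyond_body.
Qed.

Lemma beyond0 X k : k != b -> beyond X k 0 = beyond X k 1.
Proof.
move=> nkb; rewrite beyondS; case: existsP => [[u]|_] /=; last by rewrite addn0.
rewrite pos_eq0 => /andP [_ /andP [/eqP lu /eqP ub]].
by move: nkb; rewrite -lu ub (leg_body C) eqxx.
Qed.

Lemma beyond_two X k p : independent e X -> 0 < p ->
  beyond X k p <= (beyond X k p.+2).+1.
Proof.
move=> iX p0; rewrite beyondS [X in X + _]beyondS.
case: existsP => [[w /andP [wX /andP [/eqP lw /eqP pw]]]|] /=; last by lia.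
case: existsP => [[u /andP [uX /andP [/eqP lu /eqP pu]]]|] /=; last by lia.
have nwb : w != b by rewrite -pos_eq0 pw.
have nub : u != b by rewrite -pos_eq0 pu -lt0n.
have pwu : par w = u by apply: par_of_coord; rewrite // ?lu ?pw ?pu.
by move: (iX _ _ uX wX); rewrite -pwu edge_par.
Qed.

Lemma beyond_profile X : independent e X -> profile (beyond X).
Proof.
move=> iX; split=> [k p _|k p p0|k p p0]; first exact: beyond_mono.
  exact: beyond_two.
exact: beyond_van.
Qed.

Lemma head_free X k : independent e X -> b \in X -> beyond X k 1 = beyond X k 2.
Proof.
move=> iX bX; rewrite beyondS; case: existsP => [[w]|_] /=; last by rewrite addn0.
move=> /andP [wX /andP [_ /eqP pw]].
have nwb : w != b by rewrite -pos_eq0 pw.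
by move: (iX _ _ bX wX); rewrite -(par_body nwb pw) edge_par.
Qed.

Lemma head_memE (X : {set T}) w : w != b -> par w = b ->
  (w \in X) = (beyond X (leg w) 2 < beyond X (leg w) 1).
Proof.
move=> nwb pb; have pw : pos w = 1 by rewrite (pos_par C nwb) pb (pos_body C).
by rewrite -pw [X in _ < X]beyond_mem; case: (w \in X) => //=; lia.
Qed.

Lemma card_beyond (X : {set T}) : #|X| = (b \in X) + \sum_k beyond X k 1.
Proof.
have -> : \sum_k beyond X k 1 = \sum_(u in X) (u != b).
  under eq_bigr do rewrite beyondE.
  rewrite exchange_big /=; apply: eq_bigr => u _.
  rewrite (bigD1 (leg u)) //= eqxx lt0n pos_eq0 big1 ?addn0 // => k.
  by rewrite eq_sym => /negPf ->.
rewrite -sum1_card; case: (boolP (b \in X)) => bX.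
  rewrite (bigD1 b) //= [X in _ = _ + X](bigD1 b) //= eqxx add0n; congr (_ + _).
  by apply: eq_bigr => u /andP [_ ->].
by apply: eq_bigr => u uX; case: eqVneq bX => // <-; rewrite uX.
Qed.

Lemma beyond_out (X : {set T}) x y k p :
  y != b -> par y = x -> x \in X -> y \notin X -> 0 < p ->
  beyond (move X x y) k p = beyond X k p + ((k == leg y) && (p == pos y)).
Proof.
move=> nyb pyx xX yX p0; rewrite !beyondE /move.
rewrite big_setU1 /=; last by rewrite !inE (negPf yX) andbF.
rewrite [in RHS](big_setD1 x) //= [RHS]addnAC; congr (_ + _).
rewrite (pos_par C nyb) pyx eq_sym.
case: (eqVneq x b) => [xb|nxb].
  rewrite xb (pos_body C) eq_sym [leg y == k]eq_sym.
  by case: (k == leg y) => //=; lia.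
rewrite (leg_par C nyb) pyx // [leg x == k]eq_sym.
by case: (k == leg x) => //=; lia.
Qed.

Lemma beyond_in (X : {set T}) x k p :
  x != b -> x \in X -> par x \notin X -> 0 < p ->
  beyond X k p = beyond (move X x (par x)) k p + ((k == leg x) && (p == pos x)).
Proof.
move=> nxb xX pX p0.
have nxp : x != par x by apply: contraNneq pX => <-.
rewrite -(@beyond_out (move X x (par x)) (par x) x) //.
- congr beyond; apply/setP => u; rewrite !inE.
  case: (eqVneq u x) => [->|nux] //=; case: (eqVneq u (par x)) => [->|_] //=.
  exact: negPf.
- by rewrite !inE eqxx.
- by rewrite !inE eqxx orbF.
Qed.

(** The counts away from the body do not see a token on it; the cardinality supplies this last
    bit. *)
Lemma set_of_beyond (X Y : {set T}) :
  (forall v, v != b -> beyond X (leg v) (pos v) = beyond Y (leg v) (pos v)) ->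
  #|X| = #|Y| -> X = Y.
Proof.
move=> eqB cXY.
have eqB' k p : 0 < p -> beyond X k p = beyond Y k p.
  move=> p0.
  case: (posnP (beyond X k p)) => [x0|/(beyond_van p0) [v [nvb <- <-]]]; last exact: eqB.
  case: (posnP (beyond Y k p)) => [y0|/(beyond_van p0) [v [nvb <- <-]]]; last exact: eqB.
  by rewrite x0 y0.
apply/setP => v; case: (eqVneq v b) => [->|nvb].
  move: cXY; rewrite !card_beyond.
  under eq_bigr do rewrite eqB' //.
  by move=> /eqP; rewrite eqn_add2r; case: (b \in X); case: (b \in Y).
have := beyond_mem X v; rewrite (eqB' _ _ (pos_gt0 nvb)) beyond_mem eqB' //.
by case: (v \in X); case: (v \in Y) => //; lia.
Qed.

Lemma card_move (X : {set T}) x y : x \in X -> y \notin X -> #|move X x y| = #|X|.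
Proof.
move=> xX yX; rewrite /move cardsU1 !inE (negPf yX) andbF /= add1n.
by rewrite (cardsD1 x X) xX.
Qed.

Lemma card_moves X0 ms X : moves X0 ms X -> #|X| = #|X0|.
Proof. by elim=> // {}ms {}X x y _ IH _ xX yX _; rewrite card_move. Qed.

Lemma moves_indep X0 ms X : independent e X0 -> moves X0 ms X -> independent e X.
Proof. by move=> i0; case. Qed.

Lemma absdC x y : absd x y = absd y x.
Proof. by rewrite /absd addnC. Qed.

Lemma profile_distC f g : profile_dist f g = profile_dist g f.
Proof. by apply: eq_bigr => v _; rewrite absdC. Qed.

Lemma profile_dist_triangle f g h :
  profile_dist f h <= profile_dist f g + profile_dist g h.
Proof. by rewrite -big_split; apply: leq_sum => v _ /=; rewrite /absd; lia. Qed.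

Lemma profile_dist_eq f g :
  (forall v, v != b -> f (leg v) (pos v) = g (leg v) (pos v)) -> profile_dist f g = 0.
Proof. by move=> H; rewrite /profile_dist big1 // => v /H ->; rewrite /absd subnn. Qed.

Lemma profile_dist_congr f g h :
  (forall v, v != b -> f (leg v) (pos v) = g (leg v) (pos v)) ->
  profile_dist f h = profile_dist g h.
Proof. by move=> H; apply: eq_bigr => v /H ->. Qed.

(* Both kinds of slides change [beyond] by one in a single coordinate. *)
Lemma profile_dist_step f g y w :
  w != b -> (forall k p, 0 < p -> g k p = f k p + ((k == leg w) && (p == pos w))) ->
  absd (f (leg w) (pos w)) (y (leg w) (pos w)) + profile_dist g y =
  absd (g (leg w) (pos w)) (y (leg w) (pos w)) + profile_dist f y.
Proof.
move=> nwb gE; rewrite /profile_dist (bigD1 w) //= [in RHS](bigD1 w) //= addnCA.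
congr (_ + (_ + _)); apply: eq_bigr => v /andP [nvb nvw].
rewrite gE ?pos_gt0 //; case: eqP => [el|_]; last by rewrite addn0.
case: eqP => [ep|_]; last by rewrite addn0.
by move: nvw; rewrite (coord_inj el ep) eqxx.
Qed.

End Coordinates.

(** * Transport lemmas and the lower bound *)

Section Transport.
Variables (T : finType) (e : rel T) (b : T).
Variables (par : T -> T) (pos : T -> nat) (leg : T -> T).
Hypothesis C : spider_coords e b par pos leg.
Local Notation beyond := (beyond pos leg).
Local Notation profile := (profile b pos leg).
Local Notation profile_dist := (profile_dist b pos leg).

Lemma indep_move (X : {set T}) x y : independent e X ->
  {in X, forall z, z != x -> ~~ e z y} -> independent e (move X x y).
Proof.
move=> iX ny u v; rewrite !inE.
have nyy : ~~ e y y.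
  rewrite (edgeE C) orbb; apply/negP => /andP [nyb /eqP pyy].
  by have := pos_par C nyb; rewrite pyy; lia.
case/orP => [/eqP ->|/andP [nux uX]]; case/orP => [/eqP ->|/andP [nvx vX]] //.
- by rewrite (edge_sym C); apply: ny.
- exact: ny.
- exact: iX.
Qed.

(* A token two steps ahead that needs no outward move would force the target to
   hold fewer tokens beyond w than are already there. *)
Lemma slide_out_indep (X : {set T}) y w :
  independent e X -> profile y -> w != b -> par w \in X ->
  beyond X (leg w) (pos w) < y (leg w) (pos w) ->
  (forall z, z \in X -> z != b -> par z = w ->
     y (leg z) (pos z).+1 <= beyond X (leg z) (pos z).+1) ->
  w \notin X /\ independent e (move X (par w) w).
Proof.
move=> iX py nwb pX lt done.
have wX : w \notin X by apply/negP => wX; move: (iX _ _ pX wX); rewrite (edge_par C nwb).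
split=> //; apply: indep_move => // z zX nzp; apply/negP.
rewrite (edgeE C) => /orP [/andP [nzb /eqP pzw]|/andP [_ /eqP pwz]]; last first.
  by move: nzp; rewrite pwz eqxx.
have npz : par z != b by rewrite pzw.
have lz : leg z = leg w by rewrite (leg_par C nzb npz) pzw.
have pz : pos z = (pos w).+1 by rewrite (pos_par C nzb) pzw.
have := done _ zX nzb pzw; rewrite lz pz.
have := beyond_mem C X w; rewrite (negPf wX).
have := beyond_mem C X z; rewrite zX lz pz.
have := prof_two py (leg w) (pos_gt0 C nwb).
by lia.
Qed.

(** A token on [par (par x)] within the leg would have nothing to deliver inwards by [done], and
    then [prof_two] leaves no surplus at x. On the body it is excluded by [body], since positions 1
    and 2 then have equal counts in X as well as in [y]. A token on another child of [par x] is
    possible only if [par x] is the body, and [heads] excludes it. *)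
Lemma slide_in_indep (X : {set T}) y x :
  independent e X -> profile y -> x != b -> x \in X ->
  y (leg x) (pos x) < beyond X (leg x) (pos x) ->
  (forall z, z \in X -> z != b -> leg z = leg x -> pos z < pos x ->
     beyond X (leg z) (pos z) <= y (leg z) (pos z)) ->
  (b \in X -> y (leg x) 1 = y (leg x) 2 /\ beyond X (leg x) 1 <= y (leg x) 1) ->
  (pos x = 1 -> forall z, z \in X -> z != b -> pos z = 1 -> z = x) ->
  par x \notin X /\ independent e (move X x (par x)).
Proof.
move=> iX py nxb xX lt done body heads.
have pX : par x \notin X.
  by apply/negP => pX; move: (iX _ _ pX xX); rewrite (edge_par C nxb).
split=> //; apply: indep_move => // z zX nzx; apply/negP.
rewrite (edgeE C) => /orP [/andP [nzb /eqP pzx]|/andP [nub /eqP pxz]].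
  case: (eqVneq (par x) b) => [pxb|npxb].
    have p1 v : v != b -> par v = b -> pos v = 1.
      by move=> nvb pv; rewrite (pos_par C nvb) pv (pos_body C).
    move: nzx; rewrite (heads (p1 _ nxb pxb) _ zX nzb) ?eqxx //.
    by apply: p1; rewrite ?pzx.
  by move: nzx; rewrite (child_uniq C nzb nxb) ?eqxx // pzx.
have lu := leg_par C nxb nub; have pu := pos_par C nxb.
have pu' := pos_par C nub; rewrite pxz in pu'.
case: (eqVneq z b) => [zb|nzb].
  rewrite zb (pos_body C) in pu'; rewrite zb in zX.
  have [y12 le1] := body zX.
  have := head_free C (leg x) iX zX.
  by move: lt; rewrite pu pu'; lia.
have lz : leg z = leg x by rewrite lu -pxz -(leg_par C nub) // pxz.
have := done _ zX nzb lz; rewrite lz.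
have := beyond_mem C X z; rewrite zX lz.
have := beyond_mono C X (leg x) (pos z).+1.
have := prof_two py (leg x) (pos_gt0 C nzb).
by move: lt; rewrite pu pu'; lia.
Qed.

Lemma first_token (X : {set T}) k p : 0 < p -> 0 < beyond X k p ->
  exists v, [/\ v \in X, v != b, leg v = k, p <= pos v
              & beyond X k (pos v) = beyond X k p].
Proof.
move=> p0; have [n] := ubnP (#|T| - p); elim: n p p0 => // n IH p p0 ltn Bp.
have [v [nvb lv pv]] := beyond_van C p0 Bp.
case: (boolP (v \in X)) => vX; first by exists v; rewrite pv.
have eqB : beyond X k p = beyond X k p.+1.
  by have := beyond_mem C X v; rewrite lv pv (negPf vX) addn0.
have ple : p <= #|T|.
  have nkb : k != b by rewrite -lv; case: (leg_nbody C nvb).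
  have /andP [_] : 0 < p <= leg_size leg k.
    by apply/(leg_size_coord C p nkb); exists v.
  by move/leq_trans; apply; apply: max_card.
case: (ltnP p #|T|) => [lt|ge].
  case: (IH p.+1 isT) => [||u [uX nub lu pu eu]]; [lia | by rewrite -eqB |].
  rewrite -eqB in eu; exists u; split => //; lia.
have [|u [nub lu pu]] := beyond_van C (X := X) (k := k) (ltn0Sn p).
  by rewrite -eqB.
have nkb : k != b by rewrite -lu; case: (leg_nbody C nub).
have /andP [_] : 0 < p.+1 <= leg_size leg k.
  by apply/(leg_size_coord C p.+1 nkb); exists u.
by have := max_card [set u | leg u == k]; rewrite -/(leg_size leg k); lia.
Qed.

Lemma prof_antitone f k p q : profile f -> 0 < p -> p <= q -> f k q <= f k p.
Proof.
move=> pf p0; elim: q => [|q IH]; first by lia.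
rewrite leq_eqVlt => /orP [/eqP -> //|pq].
by apply: leq_trans (IH _); [apply: (prof_mono pf); lia | lia].
Qed.

(** The count at p equals the count at the first token from p on, and the target is at least as
    large at p as there. So it suffices to compare at tokens. *)
Lemma in_done_le (X : {set T}) y k p : profile y ->
  (forall v, v \in X -> v != b ->
     beyond X (leg v) (pos v) <= y (leg v) (pos v)) ->
  0 < p -> beyond X k p <= y k p.
Proof.
move=> py done p0; case: (posnP (beyond X k p)) => [->//|].
case/(first_token p0) => v [vX nvb lv pv <-].
have := done _ vX nvb; rewrite lv => /leq_trans; apply.
exact: prof_antitone.
Qed.

(** On the way outwards the count of X drops only behind a token, which is where the hypothesis
    applies, while the target never rises. *)
Lemma out_done_ge (X : {set T}) y k p : profile y ->
  (forall v, v \in X -> v != b ->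
     y (leg v) (pos v).+1 <= beyond X (leg v) (pos v).+1) ->
  y k 1 <= beyond X k 1 -> 0 < p -> y k p <= beyond X k p.
Proof.
move=> py done le1; elim: p => // p IH _.
case: (posnP p) => [->//|p0].
have := beyondS C X k p; case: existsP => [[v]|_] /=.
  move=> /andP [vX /andP [/eqP lv /eqP pv]] _; rewrite -lv -pv; apply: done => //.
  by rewrite -(pos_eq0 C) pv -lt0n.
move=> E; have := IH p0; have := prof_mono py k p0; lia.
Qed.

(** The positions 1 to p - 1 hold [f k 1 - f k p] tokens, no two of them adjacent. Equality forces
    the tokens onto 1, 3, ..., p - 1, and this is the test made in [exit_profile]. *)
Lemma packing f k p : profile f -> 0 < p -> (f k 1 - f k p).*2 <= p.
Proof.
move=> pf; have [n] := ubnP p; elim: n p => // n IH [|[|[|p]]] //.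
- by rewrite subnn.
- by have := prof_two pf k (p := 1); have := prof_mono pf k (p := 2); lia.
move=> lt _; have := IH p.+1; have := prof_two pf k (p := p.+1); lia.
Qed.

(** With position 1 empty the tokens cannot be packed at 1, 3, 5, ..., so equality is impossible. *)
Lemma packing_free f k p : profile f -> f k 1 = f k 2 -> 0 < p ->
  (f k 1 - f k p).*2 < p.
Proof.
move=> pf free; have [n] := ubnP p; elim: n p => // n IH [|[|[|p]]] //.
- by rewrite subnn.
- by rewrite free subnn.
move=> lt _; have := IH p.+1; have := prof_two pf k (p := p.+1); lia.
Qed.

(* The profile that is closest to f among those reached by letting the first
   token of leg i step onto the body: in every other leg the packed tokens at
   positions 1, 3, 5, ... make one step outwards. *)
Definition exit_profile (f : T -> nat -> nat) (i k : T) (p : nat) :=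
  if k == i then f k p - (f k p == f k 1)
  else f k p + ((f k 1 - f k p).*2 == p).

(* The body counts as a leg of size one, so that a token on it forces i = b. *)
Definition exit_valid (X : {set T}) (i : T) :=
  [&& leg i == i, 0 < beyond X i 0 &
      [forall k, (leg k == k) && (k != i) ==>
                 ((beyond X k 0).*2 <= leg_size leg k)]].

Lemma exit_valid_other X i k : exit_valid X i -> leg k = k -> k != i ->
  (beyond X k 0).*2 <= leg_size leg k.
Proof. by case/and3P => _ _ /forallP /(_ k) /implyP H lk ki; apply: H; rewrite lk eqxx. Qed.

Lemma exit_valid_body X i : exit_valid X i -> (b \in X) = (i == b).
Proof.
move=> v; apply/idP/eqP => [bX|ib].
  apply/eqP; apply: contraTT bX => nib.
  have := exit_valid_other v (leg_body C); rewrite eq_sym nib => /(_ isT).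
  have -> : leg_size leg b = 1.
    apply/eqP/cards1P; exists b; apply/setP => u; rewrite !inE.
    by apply/eqP/eqP => [lu|->]; [apply/eqP; apply: contra_eqT lu => /(leg_nbody C) [] | exact: leg_body C].
  by rewrite (beyond_body0 C); case: (b \in X).
case/and3P: v => _; rewrite ib (beyond_body0 C) => + _.
by case: (b \in X).
Qed.

Lemma exit_profileP X i :
  independent e X -> exit_valid X i -> profile (exit_profile (beyond X) i).
Proof.
move=> iX vi; have pX := beyond_profile C iX.
have anti k p q : 0 < p -> p <= q -> beyond X k q <= beyond X k p.
  exact: prof_antitone.
split=> k p p0.
- have m := anti k p p.+1 p0 (leqnSn p); have t := prof_two pX k p0.
  have m2 := anti k p.+1 p.+2 isT (leqnSn _).
  have l1 := anti k 1 p isT p0.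
  rewrite /exit_profile; case: eqP => _; first by lia.
  by have := packing k pX p0; have := packing k pX (ltn0Sn p); lia.
- have m := anti k p p.+1 p0 (leqnSn p); have t := prof_two pX k p0.
  have m2 := anti k p.+1 p.+2 isT (leqnSn _).
  have l1 := anti k 1 p isT p0.
  rewrite /exit_profile; case: eqP => _; first by lia.
  by have := packing k pX p0; have := packing k pX (ltn0Sn p.+1); lia.
- rewrite /exit_profile; case: eqP => [_|/eqP nki] gt0.
    by apply: (prof_van pX) => //; lia.
  case: (posnP (beyond X k p)) gt0 => [B0|Bp _]; last exact: prof_van pX _ _ p0 Bp.
  (* All tokens of the leg are packed, and the outermost one is pushed to p, which is twice their
     number. [exit_valid] says that the leg is that long. *)
  rewrite B0 add0n subn0 lt0b => /eqP ep.
  have Bk1 : 0 < beyond X k 1 by lia.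
  have [v [nvb lv pv]] := beyond_van C (ltn0Sn 0) Bk1.
  have lk : leg k = k by rewrite -lv (leg_idem C).
  have nkb : k != b by rewrite -lv; case: (leg_nbody C nvb).
  apply/(leg_size_coord C p nkb); rewrite p0 -ep -(beyond0 C _ nkb).
  exact: exit_valid_other vi lk nki.
Qed.

Lemma exit_profile1 X i k :
  exit_profile (beyond X) i k 1 = beyond X k 1 - (k == i).
Proof. by rewrite /exit_profile; case: (k == i); rewrite ?eqxx ?subnn ?subn0 ?addn0. Qed.

Lemma exit_profile_free X i k : independent e X ->
  exit_profile (beyond X) i k 1 = exit_profile (beyond X) i k 2.
Proof.
move=> iX; have pX := beyond_profile C iX; rewrite exit_profile1 /exit_profile.
have := prof_mono pX k (p := 1) isT; have := prof_two pX k (p := 1) isT.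
have := prof_mono pX k (p := 2) isT.
by case: (k == i); lia.
Qed.

(** The one token that the counts miss is the token on the body. *)
Lemma exit_profile_card X i : exit_valid X i ->
  #|X| = (\sum_k exit_profile (beyond X) i k 1).+1.
Proof.
move=> vi; rewrite (card_beyond C X) (exit_valid_body vi).
under [in RHS]eq_bigr do rewrite exit_profile1.
rewrite (bigD1 i) //= [in RHS](bigD1 i) //= eqxx.
have -> : \sum_(k | k != i) (beyond X k 1 - (k == i)) = \sum_(k | k != i) beyond X k 1.
  by apply: eq_bigr => k /negPf ->; rewrite subn0.
case/and3P: vi => _ + _; case: eqVneq => [-> _|nib].
  by rewrite (beyond_body C) //; lia.
by rewrite (beyond0 C) //; lia.
Qed.

(** At every coordinate the exit value lies between those of X and Y. In leg i, unless it is the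
    body, Y has one token fewer, so lowering the counts up to the first token of X goes towards Y.
    In any other leg the numbers agree; where X is packed, [packing_free] gives Y a larger count, so
    raising that of X by one does not overshoot. *)
Lemma exit_profile_between X Y i :
  independent e X -> independent e Y -> exit_valid X i -> b \in Y ->
  (forall k, beyond Y k 1 + (k == i) = beyond X k 1 + ((k == i) && (i == b))) ->
  profile_dist (beyond X) (exit_profile (beyond X) i) +
  profile_dist (exit_profile (beyond X) i) (beyond Y) =
  profile_dist (beyond X) (beyond Y).
Proof.
move=> iX iY vi bY cnt; rewrite -big_split; apply: eq_bigr => v nvb /=.
have := pos_gt0 C nvb; move: (leg v) (pos v) => k p p0.
have pX := beyond_profile C iX; have pY := beyond_profile C iY.
have := prof_antitone k pX (ltn0Sn 0) p0; have := prof_antitone k pY (ltn0Sn 0) p0.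
have := cnt k; rewrite /exit_profile /absd.
case: eqVneq => [->|nki] /=.
  by case: eqVneq => [->|_] /=; rewrite ?(beyond_body C) //; lia.
have := packing_free pY (head_free C k iY bY) p0.
by lia.
Qed.

Lemma slide_move (A A' : {set T}) x y : slide e A A' x y ->
  [/\ e x y, x \in A, y \notin A & A' = move A x y].
Proof.
case=> exy /setP d1 /setP d2; have := d1 x; have := d2 y.
rewrite !inE !eqxx => /andP [yA _] /andP [_ xA]; split=> //.
apply/setP => u; have := d1 u; have := d2 u; rewrite !inE.
by case: (u \in A); case: (u \in A'); case: (u == x); case: (u == y).
Qed.

Lemma slide_sym (A A' : {set T}) x y : slide e A A' x y -> slide e A' A y x.
Proof. by case=> exy d1 d2; split; rewrite // -(edge_sym C). Qed.

Lemma move_slide (X : {set T}) x y : e x y -> x \in X -> y \notin X ->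
  slide e X (move X x y) x y.
Proof.
move=> exy xX yX; have nyx : y != x by apply: contraNneq yX => ->.
split=> //; apply/setP => u; rewrite !inE.
  case: (eqVneq u x) => [->|_]; first by rewrite xX eq_sym (negPf nyx).
  by case: (u \in X); rewrite ?orbT ?andbF.
case: (eqVneq u y) => [->|_] /=; first by rewrite yX.
by case: (u \in X); rewrite ?andbF.
Qed.

Lemma slide_coord (A A' : {set T}) x y : slide e A A' x y ->
  (y != b /\ par y = x /\ forall k p, 0 < p ->
     beyond A' k p = beyond A k p + ((k == leg y) && (p == pos y))) \/
  (x != b /\ par x = y /\ forall k p, 0 < p ->
     beyond A k p = beyond A' k p + ((k == leg x) && (p == pos x))).
Proof.
case/slide_move; rewrite (edgeE C) => /orP [] /andP [nb /eqP pe] xA yA ->.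
  right; split=> //; split=> // k p p0; rewrite -pe.
  by apply: (beyond_in C) => //; rewrite pe.
by left; split=> //; split=> // k p p0; apply: (beyond_out C).
Qed.

Lemma slide_dist (A A' : {set T}) x y : slide e A A' x y ->
  profile_dist (beyond A) (beyond A') = 1.
Proof.
have aux f g w : w != b ->
    (forall k p, 0 < p -> g k p = f k p + ((k == leg w) && (p == pos w))) ->
    profile_dist f g = 1.
  move=> nwb gE; have := profile_dist_step C g nwb gE.
  have -> : profile_dist g g = 0 by apply: profile_dist_eq.
  by rewrite gE ?(pos_gt0 C) // !eqxx /absd; lia.
case/slide_coord => -[nb [_ E]]; first exact: aux E.
by rewrite profile_distC; apply: aux E.
Qed.

(** * Lower bounds for sequences of slides *)

Section Walk.
Variable S : seq {set T}.
Hypothesis S_indep : forall A, A \in S -> independent e A.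
Hypothesis S_slide : forall i, i.+1 < size S ->
  exists x y, slide e (nth set0 S i) (nth set0 S i.+1) x y.

Lemma walk_dist i d : i + d < size S ->
  profile_dist (beyond (nth set0 S i)) (beyond (nth set0 S (i + d))) <= d.
Proof.
elim: d => [|d IH]; first by rewrite addn0 profile_dist_eq.
rewrite addnS => lt; have [x [y sl]] := S_slide lt.
apply: leq_trans (profile_dist_triangle _ _ _ _ (beyond (nth set0 S (i + d))) _) _.
by rewrite (slide_dist sl) addn1 ltnS; apply: IH; lia.
Qed.

Lemma walk_avoiding_body m : m < size S ->
  (forall i, i <= m -> b \notin nth set0 S i) ->
  forall k, beyond (nth set0 S m) k 1 = beyond (nth set0 S 0) k 1.
Proof.
elim: m => [|m IH] // lt avoid k.
rewrite -IH; [|lia|by move=> i im; apply: avoid; lia].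
have [x [y sl]] := S_slide lt; have [_ xA yA EA] := slide_move sl.
have nxb : x != b by apply: contraNneq (avoid m (leqnSn m)) => <-.
have nyb : y != b.
  by apply: contraNneq (avoid m.+1 (leqnn _)) => <-; rewrite EA !inE eqxx.
have far w u : w != b -> par w = u -> u != b -> (1 == pos w) = false.
  by move=> nwb pw nub; rewrite (pos_par C nwb) pw eq_sym eqSS (pos_eq0 C) (negPf nub).
case/slide_coord: sl => -[_ [pe E]]; rewrite E // (far _ _ _ pe) ?andbF ?addn0 //.
Qed.

(** f is the first time at which the body is occupied, and i is the leg from which the token enters,
    or the body itself if f = 0. *)
Lemma exit_bound : 0 < size S -> has (fun A : {set T} => b \in A) S ->
  let I := nth set0 S 0 in
  exists f i, [/\ f < size S, b \in nth set0 S f,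
    forall g, g < f -> b \notin nth set0 S g, exit_valid I i
    & profile_dist (beyond I) (exit_profile (beyond I) i) +
      profile_dist (exit_profile (beyond I) i) (beyond (nth set0 S f)) <= f].
Proof.
move=> S0 hasb I; pose f := find (fun A : {set T} => b \in A) S; exists f.
have fS : f < size S by rewrite -has_find.
have bf : b \in nth set0 S f by apply: (nth_find set0 hasb).
have before g : g < f -> b \notin nth set0 S g.
  by move=> gf; apply: negbT (before_find set0 gf).
have ind i : i < size S -> independent e (nth set0 S i).
  by move=> iS; apply: S_indep; apply: mem_nth.
have iI := ind _ S0; have iF := ind _ fS.
(* At time f the body is occupied, so the head of each leg is free and its tokens need twice as many
   positions as they are. *)
have half k : k != b -> (beyond (nth set0 S f) k 1).*2 <= leg_size leg k.
  move=> nkb; have pF := beyond_profile C iF.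
  have := packing_free pF (head_free C k iF bf) (ltn0Sn (leg_size leg k)).
  case: (posnP (beyond (nth set0 S f) k (leg_size leg k).+1)) => [->|]; first by lia.
  move=> /(beyond_van C (ltn0Sn _)) ex.
  have : 0 < (leg_size leg k).+1 <= leg_size leg k by apply/(leg_size_coord C _ nkb).
  by lia.
suff [i [vi cnt]] : exists i, exit_valid I i /\
    forall k, beyond (nth set0 S f) k 1 + (k == i) = beyond I k 1 + ((k == i) && (i == b)).
  exists i; split=> //; rewrite exit_profile_between //.
  by have := @walk_dist 0 f; rewrite add0n; apply.
case: (posnP f) => [f0|fpos].
  exists b; have bI : b \in I by rewrite /I -f0.
  split; last by move=> k; rewrite eqxx andbT f0.
  rewrite /exit_valid (leg_body C) eqxx (beyond_body0 C) bI /=.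
  apply/forallP => k; apply/implyP => /andP [_ nkb].
  by rewrite (beyond0 C) //; have := half k nkb; rewrite f0.
have fp : f.-1.+1 = f by lia.
have [x [y sl]] : exists x y, slide e (nth set0 S f.-1) (nth set0 S f) x y.
  by move: (S_slide (i := f.-1)); rewrite fp; apply.
have cntI k : beyond (nth set0 S f.-1) k 1 = beyond I k 1.
  by apply: walk_avoiding_body => [|i ile]; [lia | apply: before; lia].
have [_ xA yA EA] := slide_move sl.
have yb : y = b.
  apply/eqP; move: bf; rewrite EA !inE eq_sym => /orP [//|/andP [_]].
  by rewrite (negPf (before _ _)) //; lia.
case/slide_coord: sl => [[]|[nxb [pxb E]]]; first by rewrite yb eqxx.
have px : pos x = 1 by rewrite (pos_par C nxb) pxb yb (pos_body C).
have lx := leg_pos1 C px.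
have cnt k : beyond (nth set0 S f) k 1 + (k == x) = beyond I k 1.
  by rewrite -cntI E // lx px eqxx andbT.
exists x; split; last by move=> k; rewrite cnt (negPf nxb) andbF addn0.
rewrite /exit_valid lx eqxx /= (beyond0 C) // -cnt eqxx addn1 /=.
apply/forallP => k; apply/implyP => /andP [_ nkx].
case: (eqVneq k b) => [->|nkb].
  have -> : beyond I b 0 = 0 by rewrite (beyond_body0 C) (negPf (before 0 fpos)).
  by [].
by rewrite (beyond0 C) // -cnt (negPf nkx) addn0; apply: half.
Qed.

End Walk.

Definition detour_cost (I J : {set T}) (i j : T) :=
  profile_dist (beyond I) (exit_profile (beyond I) i) +
  profile_dist (exit_profile (beyond I) i) (exit_profile (beyond J) j) +
  profile_dist (exit_profile (beyond J) j) (beyond J).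

Lemma TS_length_dist I J S : TS_sequence e I J S ->
  profile_dist (beyond I) (beyond J) <= TS_length S.
Proof.
case=> S0 [<- <-] _ _ Sl; have := walk_dist Sl (i := 0) (d := (size S).-1).
by rewrite add0n; apply; lia.
Qed.

(** [exit_bound] applies to S and to its reversal. The first visit to the body is not later than the
    last one, so the two end pieces do not overlap, and the piece between them pays for the middle
    term by the triangle inequality. *)
Lemma TS_length_detour I J S : TS_sequence e I J S ->
  (exists2 k, leg k = k & beyond I k 0 != beyond J k 0) ->
  exists i j, [/\ exit_valid I i, exit_valid J j & detour_cost I J i j <= TS_length S].
Proof.
case=> S0 [EI EJ] Si _ Sl [k0 lk0 nk0].
(* Without a visit to the body the number of tokens in every leg would be the same at both ends. *)
have hasb : has (fun A : {set T} => b \in A) S.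
  apply: contraT => /hasPn nob.
  have avoid i : i < size S -> b \notin nth set0 S i.
    by move=> iS; apply: nob; apply: mem_nth.
  move: nk0; case: (eqVneq k0 b) => [->|nkb].
    rewrite !(beyond_body0 C) -EI -EJ !(negPf (avoid _ _)) ?eqxx //; lia.
  rewrite !(beyond0 C) // -EI -EJ (walk_avoiding_body Sl) ?eqxx //; first by lia.
  by move=> i ile; apply: avoid; lia.
have [f [i [fS bf bef vi lei]]] := exit_bound Si Sl S0 hasb.
have Si' A : A \in rev S -> independent e A by rewrite mem_rev; apply: Si.
have Sl' m : m.+1 < size (rev S) ->
    exists x y, slide e (nth set0 (rev S) m) (nth set0 (rev S) m.+1) x y.
  rewrite size_rev => lt; rewrite !nth_rev; [|lia|lia].
  have -> : size S - m.+1 = (size S - m.+2).+1 by lia.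
  have [|x [y sl]] := Sl (size S - m.+2); first by lia.
  by exists y, x; apply: slide_sym.
have [|| f' [j [fS' bf' bef' vj lej]]] := exit_bound Si' Sl'.
- by rewrite size_rev.
- by rewrite has_rev.
rewrite size_rev in fS'; rewrite !nth_rev // in bf' vj lej.
have J0 : nth set0 S (size S - 1) = J by rewrite -EJ subn1.
rewrite J0 in vj lej; rewrite EI in vi lei.
(* The time of the last visit to the body, counted from the beginning of S. *)
set l := size S - f'.+1 in bf' lej.
have fl : f <= l.
  by rewrite leqNgt; apply/negP => /bef; rewrite bf'.
have := walk_dist Sl (i := f) (d := l - f); rewrite subnKC // => /(_ _) mid.
exists i, j; split=> //; rewrite /detour_cost /TS_length.
have {}mid : profile_dist (beyond (nth set0 S f)) (beyond (nth set0 S l)) <= l - f.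
  by apply: mid; lia.
set P := exit_profile _ i in lei *; set Q := exit_profile _ j in lej *.
have t1 := profile_dist_triangle b pos leg P (beyond (nth set0 S f)) Q.
have t2 := profile_dist_triangle b pos leg (beyond (nth set0 S f)) (beyond (nth set0 S l)) Q.
have c1 := profile_distC b pos leg (beyond J) Q.
have c2 := profile_distC b pos leg (beyond (nth set0 S l)) Q.
rewrite -/P -/Q; have l' : l = size S - f'.+1 by [].
by lia.
Qed.

End Transport.

(** * Coordinates of a tree *)

Section Tree.
Variables (T : finType) (e : rel T).
Hypothesis tree_e : is_tree e.

(** Any other path from x to y, made simple, closes up with the edge xy to a cycle of at least 3
    vertices. *)
Lemma tree_edge_bridge x y : e x y ->
  ~~ connect [rel u v | e u v && ((u, v) != (x, y)) && ((u, v) != (y, x))] x y.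
Proof.
case: tree_e => -[sym irr] _ _ acyc exy; apply/negP => /connectP [p pp lp].
case: (shortenP pp) lp => q pq uq _ lq.
have /acyc : ucycle e (x :: q).
  rewrite /ucycle /ucycleb uq andbT /= rcons_path -lq sym exy andbT.
  by apply: sub_path pq => u v /andP [/andP []].
case: q pq lq {uq} => [|z [|//]] /=; first by move=> _ yx; rewrite yx irr in exy.
by move=> + yz; rewrite yz eqxx /= andbF.
Qed.

(** An edge that joins no vertex to its parent could be bypassed through the body along parent
    edges, which contradicts [tree_edge_bridge]. Off the body the degree bound leaves room for a
    single child besides the parent. *)
Lemma coords_of_tree b par pos leg :
  (forall v, v != b -> degree e v < 3) -> pos b = 0 -> leg b = b ->
  (forall v, v != b -> [/\ e (par v) v, pos v = (pos (par v)).+1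
                         & leg v = if par v == b then v else leg (par v)]) ->
  spider_coords e b par pos leg.
Proof.
case: (tree_e) => -[sym irr] _ _ _ deg pb lb step.
have edge x y : e x y = (x != b) && (par x == y) || (y != b) && (par y == x).
  apply/idP/orP => [exy|[] /andP [nb /eqP <-]]; last by case: (step _ nb).
    apply/orP; apply: contraT; rewrite negb_or => /andP [nx ny].
    have := tree_edge_bridge exy; set r := [rel u v | _] => /negP [].
    have symr : symmetric r.
      move=> u v /=; rewrite sym !xpair_eqE [(u == x) && _]andbC [(u == y) && _]andbC.
      by rewrite andbAC.
    (* Removing xy removes no parent edge, so every vertex still climbs to the body. *)
    have up v : connect r v b.
      have [m] := ubnP (pos v); elim: m v => // m IH v le_m.
      case: (eqVneq v b) => [->|nvb]; first exact: connect0.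
      have [ev pv _] := step _ nvb.
      apply: connect_trans (IH (par v) _); last by lia.
      apply: connect1; rewrite /= sym ev /= !xpair_eqE.
      apply/andP; split; apply/negP.
        by case/andP => /eqP vx /eqP pvy; move: nx; rewrite -vx nvb pvy eqxx.
      by case/andP => /eqP vy /eqP pvx; move: ny; rewrite -vy nvb pvx eqxx.
    apply: connect_trans (up x) _.
    by rewrite (sym_connect_sym symr); apply: up.
  by rewrite sym; case: (step _ nb).
split=> // [v nvb|v nvb pvb|v nvb /negPf npb|x y nxb nyb pxy npb].
- by case: (step _ nvb).
- by case: (step _ nvb) => _ _ ->; rewrite pvb eqxx.
- by case: (step _ nvb) => _ _ ->; rewrite npb.
apply/eqP; apply: contraT => nxy.
have [ex px _] := step _ nxb; have [ey py _] := step _ nyb.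
have [ep pp _] := step _ npb.
have sub : [set par (par x); x; y] \subset [set z | e (par x) z].
  apply/subsetP => z; rewrite !inE => /orP [/orP []|] /eqP ->; rewrite ?ex //.
    by rewrite sym.
  by rewrite pxy.
have := subset_leq_card sub; rewrite leqNgt => /negP []; apply: leq_trans (deg _ npb) _.
rewrite -setUA !cardsU1 cards1 !inE.
have -> : (par (par x) == x) = false by apply/eqP => E; rewrite E in pp; lia.
have -> : (par (par x) == y) = false by apply/eqP => E; rewrite E -pxy in pp py; lia.
by rewrite (negPf nxy).
Qed.

End Tree.

(** * Program logic *)

Fixpoint mod_vars (p : cmd) : seq nat :=
  match p with
  | Const x _ | Copy x _ | Add x _ _ | Defs.Sub x _ _ | Read x _ _ => [:: x]
  | Seq p q | If _ p q => mod_vars p ++ mod_vars q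
  | While _ p => mod_vars p
  | _ => [::]
  end.

Fixpoint mod_arrs (p : cmd) : seq nat :=
  match p with
  | Write a _ _ => [:: a]
  | Seq p q | If _ p q => mod_arrs p ++ mod_arrs q
  | While _ p => mod_arrs p
  | _ => [::]
  end.

Fixpoint silent (p : cmd) : bool :=
  match p with
  | Emit _ => false
  | Seq p q | If _ p q => silent p && silent q
  | While _ p => silent p
  | _ => true
  end.

(** Lets a specification mention only what a program is meant to change; what it preserves is read
    off its text. *)
Definition frame (p : cmd) (s s' : state) : Prop :=
  [/\ forall x, x \notin mod_vars p -> vars s' x = vars s x,
      forall a, a \notin mod_arrs p -> arrs s' a = arrs s a
    & silent p -> out s' = out s].

Lemma exec_frame W p s t s' : exec W p s t s' -> frame p s s'.
Proof.
elim=> {p s t s'}; rewrite /frame /=.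
1-8: by move=> *; split=> // z; rewrite inE /upd => /negPf ->.
- move=> p q s s' s'' t t' _ [v1 a1 o1] _ [v2 a2 o2]; split=> [x|a|].
  + by rewrite mem_cat negb_or => /andP [h1 h2]; rewrite v2 ?v1.
  + by rewrite mem_cat negb_or => /andP [h1 h2]; rewrite a2 ?a1.
  + by case/andP => h1 h2; rewrite o2 ?o1.
- move=> x p q s s' t _ _ [v1 a1 o1]; split=> [z|a|].
  + by rewrite mem_cat negb_or => /andP [h1 h2]; rewrite v1.
  + by rewrite mem_cat negb_or => /andP [h1 h2]; rewrite a1.
  + by case/andP => h1 h2; rewrite o1.
- move=> x p q s s' t _ _ [v1 a1 o1]; split=> [z|a|].
  + by rewrite mem_cat negb_or => /andP [h1 h2]; rewrite v1.
  + by rewrite mem_cat negb_or => /andP [h1 h2]; rewrite a1.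
  + by case/andP => h1 h2; rewrite o1.
- move=> x p s s' s'' t t' _ _ [v1 a1 o1] _ [v2 a2 o2]; split=> [z h|a h|h].
  + by rewrite v2 ?v1.
  + by rewrite a2 ?a1.
  + by rewrite o2 ?o1.
- by [].
Qed.

Lemma frame_refl p s : frame p s s.
Proof. by []. Qed.

Lemma frame_trans p s1 s2 s3 : frame p s1 s2 -> frame p s2 s3 -> frame p s1 s3.
Proof.
by move=> [v1 a1 o1] [v2 a2 o2]; split=> [x h|a h|h]; rewrite ?v2 ?v1 ?a2 ?a1 ?o2 ?o1.
Qed.

(* [wp W p t Q s]: from s, p halts within t steps, and Q holds of the final state
   and of a number of steps that are left over. *)
Definition wp W (p : cmd) (t : nat) (Q : nat -> state -> Prop) (s : state) : Prop :=
  exists t' r s', [/\ exec W p s t' s', t' + r <= t & Q r s'].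

Section Rules.
Variable W : nat.
Implicit Types (Q : nat -> state -> Prop) (R : state -> Prop).

Lemma wp_atom p t Q s s' : exec W p s 1 s' -> Q t s' -> wp W p t.+1 Q s.
Proof. by move=> ex q; exists 1, t, s'. Qed.

Lemma wp_skip t Q s : Q t s -> wp W Skip t.+1 Q s.
Proof. by apply: wp_atom; constructor. Qed.

Lemma wp_const x c t Q s : Q t (set_var s x c) -> wp W (Const x c) t.+1 Q s.
Proof. by apply: wp_atom; constructor. Qed.

Lemma wp_copy x y t Q s : Q t (set_var s x (vars s y)) -> wp W (Copy x y) t.+1 Q s.
Proof. by apply: wp_atom; constructor. Qed.

Lemma wp_add x y z t Q s : vars s y + vars s z < W ->
  Q t (set_var s x (vars s y + vars s z)) -> wp W (Add x y z) t.+1 Q s.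
Proof. by move=> lt; apply: wp_atom; rewrite -(modn_small lt); constructor. Qed.

Lemma wp_sub x y z t Q s :
  Q t (set_var s x (vars s y - vars s z)) -> wp W (Defs.Sub x y z) t.+1 Q s.
Proof. by apply: wp_atom; constructor. Qed.

Lemma wp_read x a y t Q s :
  Q t (set_var s x (arrs s a (vars s y))) -> wp W (Read x a y) t.+1 Q s.
Proof. by apply: wp_atom; constructor. Qed.

Lemma wp_write a x y t Q s :
  Q t (set_arr s a (vars s x) (vars s y)) -> wp W (Write a x y) t.+1 Q s.
Proof. by apply: wp_atom; constructor. Qed.

Lemma wp_emit x t Q s : Q t (put s (vars s x)) -> wp W (Emit x) t.+1 Q s.
Proof. by apply: wp_atom; constructor. Qed.

Lemma wp_seq p q t Q s : wp W p t (wp W q ^~ Q) s -> wp W (Seq p q) t Q s.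
Proof.
move=> [t1 [r1 [s1 [ex1 le1 [t2 [r2 [s2 [ex2 le2 HQ]]]]]]]]; exists (t1 + t2), r2, s2.
by split=> //; [apply: ESeq ex1 ex2 | lia].
Qed.

Lemma wp_if x p q t Q s :
  (vars s x <> 0 -> wp W p t Q s) -> (vars s x = 0 -> wp W q t Q s) ->
  wp W (If x p q) t.+1 Q s.
Proof.
move=> h1 h2; case: (eqVneq (vars s x) 0) => [z|nz].
  by have [t1 [r [s1 [ex1 le1 HQ]]]] := h2 z; exists t1.+1, r, s1; split=> //; constructor.
have [t1 [r [s1 [ex1 le1 HQ]]]] := h1 (elimN eqP nz).
by exists t1.+1, r, s1; split=> //; constructor.
Qed.

Lemma wp_call p t1 t2 t R Q s : wp W p t1 (fun _ => R) s -> t1 + t2 <= t ->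
  (forall s', frame p s s' -> R s' -> Q t2 s') -> wp W p t Q s.
Proof.
move=> [t' [r [s' [ex le HR]]]] le1 H; exists t', t2, s'; split=> //; first by lia.
by apply: H HR; apply: exec_frame ex.
Qed.

Lemma wp_weaken t1 p t Q s : wp W p t1 Q s -> t1 <= t -> wp W p t Q s.
Proof. by move=> [t' [r [s' [ex le HR]]]] le1; exists t', r, s'; split=> //; lia. Qed.

(* for x = 0, ..., y - 1 do p; variable 1 holds 1 and c is scratch. *)
Definition For (x c y : nat) (p : cmd) :=
  Seq (Const x 0) (Seq (Defs.Sub c y x)
    (While c (Seq p (Seq (Add x x 1) (Defs.Sub c y x))))).

Lemma wp_for x c y p N tb (Inv : nat -> state -> Prop) s :
  uniq [:: x; c; y; 1] -> x \notin mod_vars p -> y \notin mod_vars p ->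
  1 \notin mod_vars p ->
  vars s y = N -> vars s 1 = 1 -> N < W ->
  (forall i s' v w, Inv i s' -> Inv i (set_var (set_var s' x v) c w)) ->
  Inv 0 s ->
  (forall (i : 'I_N) s', frame (For x c y p) s s' -> vars s' x = i -> Inv i s' ->
     wp W p tb (fun _ => Inv i.+1) s') ->
  wp W (For x c y p) (N * (tb + 3) + 3) (fun _ => Inv N) s.
Proof.
move=> un xp yp op sy s1 NW st I0 body.
have [[nxc nxy nx1] [ncy nc1 ny1]] :
    [/\ x != c, x != y & x != 1] /\ [/\ c != y, c != 1 & y != 1].
  move: un; rewrite /= !inE !negb_or.
  by case/and4P => /and3P [-> -> ->] /andP [-> ->] ->.
have loop d i s' : N = i + d -> vars s' x = i -> vars s' c = N - i ->
    frame (For x c y p) s s' -> vars s' y = N -> vars s' 1 = 1 -> Inv i s' ->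
    exists t s'', [/\ exec W (While c (Seq p (Seq (Add x x 1) (Defs.Sub c y x)))) s' t s'',
                      t <= d * (tb + 3) + 1 & Inv N s''].
  elim: d i s' => [|d IH] i s' Ni xi ci fr yN o1 Ii.
    exists 1, s'; split=> //; first by apply: EWhileF; rewrite ci; lia.
    by rewrite Ni addn0.
  have iN : i < N by lia.
  have [t1 [r1 [s2 [ex1 le1 I2]]]] := body (Ordinal iN) s' fr xi Ii.
  have [v1 a1 o] := exec_frame ex1.
  pose s3 := set_var (set_var s2 x i.+1) c (N - i.+1).
  have exb : exec W (Seq p (Seq (Add x x 1) (Defs.Sub c y x))) s' (t1 + (1 + 1)) s3.
    apply: ESeq ex1 _.
    have -> : s3 = set_var (set_var s2 x ((vars s2 x + vars s2 1) %% W)) c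
        (vars (set_var s2 x ((vars s2 x + vars s2 1) %% W)) y -
         vars (set_var s2 x ((vars s2 x + vars s2 1) %% W)) x).
      rewrite /= /upd eqxx [y == x]eq_sym (negPf nxy) !v1 // xi o1 yN addn1.
      by rewrite modn_small //; lia.
    by apply: ESeq; constructor.
  have [||||||| t2 [s4 [ex2 le2 I4]]] := IH i.+1 s3; first by lia.
  - by rewrite /= /upd (negPf nxc) eqxx.
  - by rewrite /= /upd eqxx.
  - apply: frame_trans fr _; have [vb ab ob] := exec_frame exb.
    split=> [z zm|a am|sl].
    + by apply: vb; move: zm; rewrite /= !inE !negb_or => /and3P [].
    + by apply: ab.
    + by apply: ob.
  - by rewrite /= /upd ![y == _]eq_sym (negPf nxy) (negPf ncy) v1 // yN.
  - by rewrite /= /upd ![1 == _]eq_sym (negPf nx1) (negPf nc1) v1 // o1.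
  - exact: st.
  exists (t1 + (1 + 1) + t2).+1, s4; split=> //; last by lia.
  by apply: EWhileT exb ex2; rewrite ci; lia.
pose s0 := set_var (set_var s x 0) c N.
have [||||||t2 [s4 [ex2 le2 I4]]] := loop N 0 s0 (erefl N).
- by rewrite /= /upd (negPf nxc) eqxx.
- by rewrite /= /upd eqxx subn0.
- split=> //= z; rewrite !inE /= !negb_or /upd.
  by case/and3P => /negPf -> /negPf ->.
- by rewrite /= /upd ![y == _]eq_sym (negPf nxy) (negPf ncy) sy.
- by rewrite /= /upd ![1 == _]eq_sym (negPf nx1) (negPf nc1) s1.
- exact: st.
exists (1 + (1 + t2)), 0, s4; split=> //; last by lia.
apply: ESeq; first by constructor.
apply: ESeq ex2; have -> : s0 = set_var (set_var s x 0) c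
    (vars (set_var s x 0) y - vars (set_var s x 0) x).
  by rewrite /= /upd eqxx [y == x]eq_sym (negPf nxy) sy subn0.
by constructor.
Qed.

(* Variables 2 and 3 are the scratch variables of the comparisons. *)
Definition IfLt (x y : nat) (p q : cmd) := Seq (Defs.Sub 2 y x) (If 2 p q).

(** Two numbers are equal if both truncated differences vanish. Here x and y must differ from 2,
    which is overwritten before they are read again; [Copy 3 3] changes nothing. *)
Definition IfEq (x y : nat) (p q : cmd) :=
  Seq (Defs.Sub 2 x y) (Seq (Defs.Sub 3 y x)
    (Seq (If 2 (Const 3 1) (Copy 3 3)) (If 3 q p))).

Lemma wp_iflt x y p q t Q s : let s' := set_var s 2 (vars s y - vars s x) in
  (vars s x < vars s y -> wp W p t Q s') -> (vars s y <= vars s x -> wp W q t Q s') ->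
  wp W (IfLt x y p q) t.+2 Q s.
Proof.
move=> s' h1 h2; apply/wp_seq/wp_sub/wp_if => /= h; [apply: h1|apply: h2];
  by rewrite /upd /= in h; lia.
Qed.

Lemma wp_ifeq x y p q t Q s : x != 2 -> y != 2 ->
  (vars s x = vars s y ->
     forall u v w, wp W p t Q (set_var (set_var (set_var s 2 u) 3 v) 3 w)) ->
  (vars s x <> vars s y ->
     forall u v w, wp W q t Q (set_var (set_var (set_var s 2 u) 3 v) 3 w)) ->
  wp W (IfEq x y p q) t.+4.+1 Q s.
Proof.
move=> /negPf x2 /negPf y2 h1 h2; do 2 apply/wp_seq/wp_sub; apply/wp_seq/wp_if => h.
  apply/wp_const/wp_if => //= _; apply: h2.
  by move: h; rewrite /= /upd /=; lia.
apply/wp_copy/wp_if => /= h'; [apply: h2|apply: h1].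
  by move: h h'; rewrite /= /upd /= x2 y2; lia.
by move: h h'; rewrite /= /upd /= x2 y2; lia.
Qed.

End Rules.

(** * Finding the body and traversing the spider *)

Arguments upd V f x v y /.
Notation "p ;; q" := (Seq p q) (at level 90, right associativity).

Ltac step :=
  lazymatch goal with
  | |- wp _ (Seq _ _) _ _ _ => apply wp_seq; step
  | |- wp _ Skip _ _ _ => apply wp_skip; simpl
  | |- wp _ (Const _ _) _ _ _ => apply wp_const; simpl
  | |- wp _ (Copy _ _) _ _ _ => apply wp_copy; simpl
  | |- wp _ (Add _ _ _) _ _ _ => apply wp_add; simpl; [try lia|]
  | |- wp _ (Defs.Sub _ _ _) _ _ _ => apply wp_sub; simpl
  | |- wp _ (Read _ _ _) _ _ _ => apply wp_read; simpl
  | |- wp _ (Write _ _ _) _ _ _ => apply wp_write; simpl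
  | |- wp _ (Emit _) _ _ _ => apply wp_emit; simpl
  | |- wp _ (If _ _ _) _ _ _ => apply wp_if; simpl
  | |- wp _ (IfLt _ _ _ _) _ _ _ => apply wp_iflt; simpl
  | |- wp _ (IfEq _ _ _ _) _ _ _ => apply wp_ifeq; simpl; [done|done| |]
  end.

(** Brings the bound into the shape that the rules consume: a successor for each atomic step,
    [n * (t + 3) + 3] for a loop, sums for consecutive calls. *)
Ltac budget T := apply: (wp_weaken (t1 := T)); [|by lia].

Lemma sum_ltS n (F : 'I_n -> nat) (j : 'I_n) :
  \sum_(y < n | y < j.+1) F y = \sum_(y < n | y < j) F y + F j.
Proof.
rewrite (bigD1 j) //= addnC; congr (_ + _); apply: eq_bigl => y.
by rewrite ltnS [in RHS]ltn_neqAle andbC.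
Qed.

Lemma sum_lt_all n (F : 'I_n -> nat) : \sum_(y < n | y < n) F y = \sum_y F y.
Proof. by apply: eq_bigl => y; rewrite ltn_ord. Qed.

Lemma sum_le_bound n (P : pred 'I_n) (F : 'I_n -> nat) m :
  (forall y, F y <= m) -> \sum_(y | P y) F y <= n * m.
Proof.
move=> le; apply: leq_trans (_ : \sum_(y | P y) m <= _); first exact: leq_sum.
by rewrite sum_nat_const leq_mul2r -[X in _ <= X]card_ord max_card orbT.
Qed.

(** There is no multiplication, so variable 5 runs through the whole matrix and array 3 keeps the
    offset of each row. Variable 7 is nonzero exactly for degrees above 2. *)
Definition find_body :=
  Const 1 1;; Const 8 2;;
  For 10 11 0 (
    Write 3 10 5;; Const 6 0;;
    For 12 13 0 (Read 7 0 5;; Add 6 6 7;; Add 5 5 1);;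
    Defs.Sub 7 6 8;; If 7 (Copy 4 10) Skip).

Section FindBody.
Variables (n : nat) (e : rel 'I_n) (I J : {set 'I_n}) (W : nat).
(** The values computed are at most quadratic in n, so for such W no addition wraps around. *)
Hypothesis HW : 100 * (n * n) + 100 * n + 100 < W.

Lemma adj_arrayE (x y : 'I_n) : adj_array e (x * n + y) = e x y.
Proof.
rewrite /adj_array; congr nat_of_bool; apply/existsP/idP => [[u]|exy].
  case/existsP=> v /andP [/eqP E euv].
  have n0 : 0 < n by apply: leq_ltn_trans (ltn_ord x).
  have xu : x = u.
    apply: val_inj; have := congr1 (divn^~ n) E.
    by rewrite /= !divnMDl // !divn_small // !addn0.
  have yv : y = v by apply: val_inj; move: E; rewrite xu => /addnI.
  by rewrite xu yv.
by exists x; apply/existsP; exists y; rewrite eqxx.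
Qed.

Lemma find_body_ok (b : 'I_n) : (forall v, 3 <= degree e v -> v = b) -> 3 <= degree e b ->
  wp W find_body (100 * (n * n) + 100 * n + 100)
    (fun _ s => [/\ vars s 1 = 1, vars s 4 = b & forall v : 'I_n, arrs s 3 v = v * n])
    (input_state e I J).
Proof.
move=> ub db; budget (n * (n * 10 + 30 + 3) + 3 + 0).+2.
rewrite /find_body; step; step.
pose Inv i s := [/\ vars s 5 = i * n, forall v : 'I_n, v < i -> arrs s 3 v = v * n
  & b < i -> vars s 4 = b].
apply: (@wp_call _ _ _ 0).
- apply: (@wp_for _ _ _ _ _ n (n * 10 + 30) Inv) => //; first by lia.
  move=> i s [fv fa _] vi [H5 H3 H4]; budget (n * 6 + 3 + 20).+2.
  step; step.
  pose Inv2 j s' := [/\ vars s' 5 = i * n + j & vars s' 6 = \sum_(y < n | y < j) e i y].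
  apply: wp_seq; apply: (@wp_call _ _ (n * 6 + 3) 20).
  + apply: (@wp_for _ _ _ _ _ n 3 Inv2) => //=; [exact: fv|exact: fv|lia| |].
      by split; rewrite /= ?addn0 // big_pred0.
    move=> j s' [fv' fa' _] vj [H5' H6'].
    have E0 : arrs s' 0 (vars s' 5) = e i j by rewrite fa' //= fa //= H5' adj_arrayE.
    have le1 : vars s' 6 <= n * 1 by rewrite H6'; apply: sum_le_bound => y; case: (e i y).
    have o1 : vars s' 1 = 1 by rewrite fv' //= fv.
    have lij : i * n + j <= n * n by have := ltn_ord i; have := ltn_ord j; nia.
    rewrite -[i * n + j]H5' in lij.
    by step; step; step; split; rewrite /= ?sum_ltS ?E0 ?H6' // o1 H5' addn1 addnS.
  + by lia.
  move=> s' [fv' fa' _] [H5' H6']; rewrite sum_lt_all in H6'.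
  have E6 : vars s' 6 = degree e i.
    by rewrite H6' /degree -sum1_card [in RHS]big_mkcond; apply: eq_bigr => y _; rewrite inE; case: (e i y).
  have E8 : vars s' 8 = 2 by rewrite fv' //= fv.
  have E3 : forall v : 'I_n, v < i.+1 -> arrs s' 3 v = v * n.
    move=> v; rewrite ltnS leq_eqVlt fa' //= vi H5.
    by case: eqVneq => [<-|_] //=; apply: H3.
  have E5 : vars s' 5 = i.+1 * n by rewrite H5' mulSn addnC.
  have E10 : vars s' 10 = i by rewrite fv' //= vi.
  step; step => d; step; split => //=; rewrite E6 E8 in d.
    by rewrite E10 (ub i) //; lia.
  rewrite ltnS leq_eqVlt => /orP [/eqP/val_inj bi|bi]; first by move: db; rewrite bi; lia.
  by rewrite fv' //= H4.
- by lia.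
move=> s [fv fa _] [_ H3 H4]; split=> [||v]; [by rewrite fv | exact: H4 | exact: H3].
Qed.
End FindBody.

(** The loop counter is the head of the queue and variable 9 its tail; array 5 marks visited
    vertices. A neighbour of the body starts a leg named after itself, and every other vertex
    inherits the leg of its parent. *)
Definition bfs :=
  Const 9 1;; Const 20 0;; Write 4 20 4;; Write 5 4 1;; Write 8 4 4;;
  For 10 11 0 (
    Read 21 4 10;; Read 22 3 21;; Read 23 7 21;; Add 23 23 1;;
    For 12 13 0 (
      Add 24 22 12;; Read 24 0 24;;
      If 24
        (Read 25 5 12;;
         If 25 Skip (
           Write 5 12 1;; Write 6 12 21;; Write 7 12 23;;
           IfEq 21 4 (Write 8 12 12) (Read 26 8 21;; Write 8 12 26);;
           Add 27 12 1;; Write 9 21 27;; Write 4 9 12;; Add 9 9 1))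
        Skip)).

Lemma uniq_size_ord n (q : seq 'I_n) : uniq q -> size q <= n.
Proof. by move=> uq; rewrite -[X in _ <= X]card_ord -(card_uniqP uq) max_card. Qed.

Lemma all_size_ord n (q : seq 'I_n) : (forall v, v \in q) -> n <= size q.
Proof.
move=> all; rewrite -[X in X <= _]card_ord; apply: leq_trans (card_size q).
exact/subset_leq_card/subsetP.
Qed.

Lemma mem_full_uniq n (q : seq 'I_n) v : uniq q -> size q = n -> v \in q.
Proof.
move=> uq sq; apply: contraT => vq; have := @uniq_size_ord _ (v :: q).
by rewrite /= vq uq sq ltnn => /(_ isT).
Qed.

Section Layout.
Variable n : nat.

(* Array 4 lists the vertices so that parents precede their children; arrays 6,
   7, 8 hold parents, positions and legs, and array 9 the successor of the child
   (0 if there is none). *)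
Record layout (b : 'I_n) (par : 'I_n -> 'I_n) (pos : 'I_n -> nat) (leg : 'I_n -> 'I_n)
    (q : seq 'I_n) (s : state) : Prop := Layout {
  lay_one : vars s 1 = 1;
  lay_n : vars s 0 = n;
  lay_body : vars s 4 = b;
  lay_par : forall v, v != b -> arrs s 6 v = par v;
  lay_pos : forall v : 'I_n, arrs s 7 v = pos v;
  lay_leg : forall v : 'I_n, arrs s 8 v = leg v;
  lay_child : forall v, v != b ->
    arrs s 9 v = 0 /\ (forall w, w != b -> par w != v) \/
    exists w : 'I_n, [/\ w != b, par w = v & arrs s 9 v = w.+1];
  lay_uniq : uniq q;
  lay_size : size q = n;
  lay_queue : forall i, i < n -> arrs s 4 i = nth b q i;
  lay_order : forall v, v != b -> index (par v) q < index v q }.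

Lemma lay_mem b par pos leg q s v : layout b par pos leg q s -> v \in q.
Proof. by move=> L; apply: mem_full_uniq; [apply: lay_uniq L | apply: lay_size L]. Qed.

Lemma layout_frame b par pos leg q s p s' : layout b par pos leg q s -> frame p s s' ->
  all (fun x => x \notin mod_vars p) [:: 0; 1; 4] ->
  all (fun a => a \notin mod_arrs p) [:: 4; 6; 7; 8; 9] ->
  layout b par pos leg q s'.
Proof.
move=> L [fv fa _] /= /and4P [v0 v1 v4 _] /and5P [a4 a6 a7 a8 /andP [a9 _]].
by case: L => *; split; rewrite ?fv ?fa.
Qed.

Variables (e : rel 'I_n) (W : nat).
Hypothesis HW : 100 * (n * n) + 100 * n + 100 < W.

Record bfs_inv (b : 'I_n) (q : seq 'I_n) (s : state) : Prop := BfsInv {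
  bfs_uniq : uniq q;
  bfs_tail : vars s 9 = size q;
  bfs_body : b \in q;
  bfs_queue : forall i, i < size q -> arrs s 4 i = nth b q i;
  bfs_vis : forall v : 'I_n, arrs s 5 v = (v \in q);
  bfs_bpos : arrs s 7 b = 0;
  bfs_bleg : arrs s 8 b = b;
  bfs_par : forall v, v \in q -> v != b -> exists u : 'I_n,
    [/\ u \in q, index u q < index v q, arrs s 6 v = u, e u v &
      arrs s 7 v = (arrs s 7 u).+1 /\ arrs s 8 v = if u == b then val v else arrs s 8 u];
  bfs_pos : forall v, v \in q -> arrs s 7 v <= index v q;
  bfs_child : forall v : 'I_n,
    arrs s 9 v = 0 /\ (forall w, w \in q -> w != b -> arrs s 6 w != v) \/
    exists w : 'I_n, [/\ w \in q, w != b, arrs s 6 w = v & arrs s 9 v = w.+1] }.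

Lemma bfs_inv_eq b q s s' : bfs_inv b q s -> vars s' 9 = vars s 9 -> arrs s' = arrs s ->
  bfs_inv b q s'.
Proof. by move=> qi e9 ea; case: qi => *; split; rewrite ?e9 ?ea. Qed.

Lemma bfs_inv_rcons b q (x y : 'I_n) s s' : bfs_inv b q s -> x \in q -> y \notin q -> e x y ->
  vars s' 9 = (vars s 9).+1 ->
  arrs s' 4 = upd (arrs s 4) (vars s 9) y -> arrs s' 5 = upd (arrs s 5) y 1 ->
  arrs s' 6 = upd (arrs s 6) y x -> arrs s' 7 = upd (arrs s 7) y (arrs s 7 x).+1 ->
  arrs s' 8 = upd (arrs s 8) y (if x == b then val y else arrs s 8 x) ->
  arrs s' 9 = upd (arrs s 9) x y.+1 ->
  bfs_inv b (rcons q y) s'.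
Proof.
case=> uq tq bq Qq Vq pb lb Pq posq Cq xq yq exy E9 A4 A5 A6 A7 A8 A9.
have neq v : v \in q -> (val v == y) = false.
  by move=> vq; apply: contraNF yq => /eqP/val_inj <-.
have idx v : v \in q -> index v (rcons q y) = index v q.
  by move=> vq; rewrite -cats1 index_cat vq.
have idy : index y (rcons q y) = size q.
  by rewrite -cats1 index_cat (negPf yq) /= eqxx addn0.
split; rewrite ?size_rcons.
- by rewrite rcons_uniq yq.
- by rewrite E9 tq.
- by rewrite mem_rcons inE bq orbT.
- move=> i; rewrite A4 tq nth_rcons ltnS leq_eqVlt /=.
  by case: eqVneq => [->|_] /=; [rewrite ltnn | move=> iq; rewrite iq Qq].
- move=> v; rewrite A5 mem_rcons inE /= -(inj_eq val_inj).
  by case: eqP => //= _; rewrite Vq.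
- by rewrite A7 /= neq.
- by rewrite A8 /= neq.
- move=> v; rewrite mem_rcons inE; case: eqVneq => [->|_] /= => [_|vq] nvb.
    exists x; rewrite mem_rcons inE xq orbT idx // idy index_mem A6 A7 A8 /= eqxx neq //.
  have [u [uq' iu pu euv [pv lv]]] := Pq _ vq nvb; exists u.
  by rewrite mem_rcons inE uq' orbT !idx // A6 A7 A8 /= !neq.
- move=> v; rewrite mem_rcons inE; case: eqVneq => [->|_] /= => [_|vq].
    rewrite A7 /= eqxx idy; apply: leq_ltn_trans (posq _ xq) _; by rewrite index_mem.
  by rewrite A7 /= neq // idx // posq.
- move=> v; case: (eqVneq v x) => [->|nvx].
    right; exists y; rewrite mem_rcons mem_head A6 A9 /= !eqxx; split=> //.
    by apply: contraNneq yq => ->.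
  have nvx' : (val v == x) = false by apply: contraNF nvx => /eqP/val_inj ->.
  case: (Cq v) => [[c0 now]|[w [wq nwb pw cw]]]; [left|right].
    rewrite A9 /= nvx' c0; split=> // w; rewrite mem_rcons inE A6 /=.
    by case: eqVneq => [-> _ _|_ /= wq nwb]; rewrite ?eqxx ?neq ?now // eq_sym nvx'.
  by exists w; rewrite mem_rcons inE wq orbT A6 A9 /= nvx' neq.
Qed.

Lemma bfs_ok (b : 'I_n) s :
  symmetric e -> (forall x y, connect e x y) ->
  vars s 0 = n -> vars s 1 = 1 -> vars s 4 = b ->
  (forall v : 'I_n, arrs s 3 v = v * n) -> arrs s 0 = adj_array e ->
  (forall a i, 3 < a -> arrs s a i = 0) ->
  wp W bfs (n * (n * 40 + 50) + 50)
    (fun _ s' => exists q, size q = n /\ bfs_inv b q s') s.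
Proof.
move=> sym conn s0 s1 s4 s3 sadj szero; rewrite /bfs.
budget (n * (n * 37 + 40 + 3) + 3 + 0).+4.+1.
do 5 step.
pose Inv h s' := exists q, [/\ bfs_inv b q s' & forall i, i < h -> i < size q ->
  forall y, e (nth b q i) y -> y \in q].
apply: (@wp_call _ _ _ 0).
- apply: (@wp_for _ _ _ _ _ n (n * 37 + 40) Inv) => //; first by lia.
  + move=> i s' v w [q [qi cl]]; exists q; split=> //; exact: bfs_inv_eq qi _ _.
  + exists [:: b]; split=> //.
    split=> //=; rewrite ?s4 ?mem_head ?eqxx //.
    * by move=> [|//] _ ; rewrite eqxx.
    * by move=> v; rewrite inE szero // s1 -(inj_eq val_inj); case: eqP.
    * by rewrite szero.
    * by move=> v; rewrite inE => /eqP -> /eqP.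
    * by move=> v _; rewrite szero.
    * by move=> v; left; rewrite szero //; split=> // w; rewrite inE => /eqP -> /eqP.
  move=> h s' [fv fa _] vh [q [qi cl]].
  have [uq tq bq Qq Vq pb lb Pq posq Cq] := qi.
  (* The head cannot catch up with the tail: q would be closed under edges and, by connectivity,
     contain all n vertices. *)
  have hq : h < size q.
    rewrite ltnNge; apply/negP => qh.
    have clo : closed e [in q].
      apply: (intro_closed (sym_connect_sym sym)) => x y exy /= xq; have := cl (index x q); rewrite nth_index // index_mem xq; apply=> //.
      by apply: leq_trans qh; rewrite index_mem.
    suff : n <= size q by have := ltn_ord h; lia.
    by apply: all_size_ord => v; rewrite -(closed_connect clo (conn b v)).
  set x := nth b q h; have xq : x \in q by apply: mem_nth.
  have Ex : arrs s' 4 h = x by apply: Qq.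
  have px : arrs s' 7 x < n.
    apply: leq_ltn_trans (posq _ xq) _; apply: leq_trans (uniq_size_ord uq).
    by rewrite index_mem.
  budget (n * 37 + 3 + 20).+4; step; step; step; step.
    by rewrite vh Ex fv //= s1; lia.
  rewrite vh Ex fa //= s3 [vars s' 1]fv //= s1 addn1.
  set s1' := set_var _ 23 _.
  (* r lists the vertices discovered from x so far. None of them is x, so the position of x stays as
     it was read. *)
  pose Inv2 j s2 := exists r, [/\ bfs_inv b (q ++ r) s2, arrs s2 7 x = arrs s' 7 x
    & forall y : 'I_n, y < j -> e x y -> y \in q ++ r].
  apply: (@wp_call _ _ (n * 37 + 3) 20).
  + apply: (@wp_for _ _ _ _ _ n 34 Inv2) => //=; [rewrite fv //|rewrite fv //|lia| | |].
    * move=> i s2 v w [r [ri E7 cr]]; exists r; split=> //; exact: bfs_inv_eq ri _ _.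
    * by exists [::]; rewrite cats0; split=> //; apply: bfs_inv_eq qi _ _.
    move=> y s2 [fv2 fa2 _] vy [r [ri E7 cr]].
    have [E22 E21 E23 E1 E4] : [/\ vars s2 22 = x * n, vars s2 21 = x, vars s2 23 = (arrs s' 7 x).+1,
      vars s2 1 = 1 & vars s2 4 = b].
      by split; rewrite fv2 //= fv.
    have lexy : x * n + y <= n * n by have := ltn_ord x; have := ltn_ord y; nia.
    have E0 : arrs s2 0 (x * n + y) = e x y by rewrite fa2 //= fa //= sadj adj_arrayE.
    have vy' := ltn_ord y.
    step; step; rewrite E22 vy E0.
    have xqr : x \in q ++ r by rewrite mem_cat xq.
    have next t3 : bfs_inv b (q ++ r) t3 -> arrs t3 7 = arrs s2 7 -> (e x y -> y \in q ++ r) -> Inv2 y.+1 t3.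
      move=> ri3 e7 hy; exists r; split; rewrite ?e7 // => z; rewrite ltnS leq_eqVlt.
      by case/orP => [/eqP/val_inj -> //|]; apply: cr.
    step => [exy|nexy]; last by step; apply: next => //; [apply: bfs_inv_eq ri _ _ | move: nexy; case: (e x y)].
    step; rewrite vy (bfs_vis ri); step => [visy|nvisy].
      by step; apply: next => //; [apply: bfs_inv_eq ri _ _ | move: visy; case: (y \in _)].
    have {nvisy} yqr : y \notin q ++ r by apply/negP => h'; rewrite h' in nvisy.
    have {exy} exy : e x y by move: exy; case: (e x y).
    have sz : size (q ++ r) < n.
      by apply: (@uniq_size_ord _ (y :: q ++ r)); rewrite /= yqr (bfs_uniq ri).

    have E9 := bfs_tail ri.
    step; step; step; rewrite vy E1 E21 E23.
    have fin t3 : vars t3 9 = (vars s2 9).+1 ->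
        arrs t3 4 = upd (arrs s2 4) (vars s2 9) y -> arrs t3 5 = upd (arrs s2 5) y 1 ->
        arrs t3 6 = upd (arrs s2 6) y x -> arrs t3 7 = upd (arrs s2 7) y (arrs s2 7 x).+1 ->
        arrs t3 8 = upd (arrs s2 8) y (if x == b then val y else arrs s2 8 x) ->
        arrs t3 9 = upd (arrs s2 9) x y.+1 -> Inv2 y.+1 t3.
      move=> h9 h4 h5 h6 h7 h8 h9'; have ri3 : bfs_inv b (q ++ rcons r y) t3.
        by rewrite -rcons_cat; apply: bfs_inv_rcons ri xqr yqr exy _ _ _ _ _ _ _.
      exists (rcons r y); split=> // [|z].
        rewrite h7 /=; case: eqP => [/val_inj xy|//].
        by rewrite -xy xqr in yqr.
      rewrite ltnS leq_eqVlt -rcons_cat mem_rcons inE.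
      by case/orP => [/eqP/val_inj ->|zy exz]; rewrite ?eqxx // (cr z) ?orbT.
    apply: wp_seq; apply: wp_ifeq => //=.
      rewrite E21 E4 => /val_inj xb u v w.
      step; step.
      step; step; step.
      by apply: fin => //=; rewrite ?E1 ?addn1 ?E21 ?vy ?E7 ?xb ?eqxx.
    rewrite E21 E4 => nxb u v w.
    have xb : (x == b) = false by apply/eqP => xb; apply: nxb; rewrite xb.
    step; step; step.
    step; step; step.
    by apply: fin => //=; rewrite ?E1 ?addn1 ?E21 ?vy ?E7 ?xb.
  + by lia.
  move=> s2 [fv2 fa2 _] [r [ri E7 cr]]; exists (q ++ r); split=> // i.
  rewrite ltnS leq_eqVlt nth_cat => /orP [/eqP -> _ y|ih _ y].
    by rewrite hq; apply: cr.
  have iq : i < size q by lia.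
  by rewrite iq => ey; rewrite mem_cat (cl i ih iq).
- by lia.
move=> s' _ [q [qi cl]]; exists q; split=> //.
have clo : closed e [in q].
  apply: (intro_closed (sym_connect_sym sym)) => x y exy /= xq.
  have xq' : index x q < size q by rewrite index_mem.
  by apply: (cl _ _ xq'); rewrite ?nth_index //; apply: leq_trans xq' (uniq_size_ord (bfs_uniq qi)).
apply/eqP; rewrite eqn_leq (uniq_size_ord (bfs_uniq qi)) /=.
by apply: all_size_ord => v; rewrite -(closed_connect clo (conn b v)); apply: bfs_body qi.
Qed.
End Layout.

(** * Tables *)

Lemma layout_of_bfs n (e : rel 'I_n) (b : 'I_n) q s :
  is_tree e -> (forall v, v != b -> degree e v < 3) ->
  bfs_inv e b q s -> size q = n -> vars s 0 = n -> vars s 1 = 1 -> vars s 4 = b ->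
  exists par pos leg, spider_coords e b par pos leg /\ layout b par pos leg q s.
Proof.
move=> tree_e deg [uq _ _ Qq _ pb lb Pq _ Cq] sq s0 s1 s4.
have all v : v \in q by apply: mem_full_uniq.
(* Legs are handed down from parents, which come earlier in the queue, so by induction each entry is
   a vertex. *)
have legP (v : 'I_n) : exists l : 'I_n, arrs s 8 v = l.
  have [m] := ubnP (index v q); elim: m v => // m IH v ltm.
  case: (eqVneq v b) => [->|nvb]; first by exists b.
  have [u [_ iu _ _ [_ ->]]] := Pq v (all v) nvb.
  by case: eqP => _; [exists v | apply: IH; lia].
pose par (v : 'I_n) : 'I_n := insubd b (arrs s 6 v); pose leg (v : 'I_n) : 'I_n := insubd b (arrs s 8 v).
have legE (v : 'I_n) : arrs s 8 v = leg v.
  by have [l El] := legP v; rewrite /leg El valKd.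
have parE (v : 'I_n) : v != b -> arrs s 6 v = par v.
  by move=> nvb; have [u [_ _ Eu _ _]] := Pq v (all v) nvb; rewrite /par Eu valKd.
exists par, (fun v : 'I_n => arrs s 7 v), leg; split.
  apply: (coords_of_tree tree_e) => // [|v nvb].
    by apply: ord_inj; rewrite -legE lb.
  have [u [_ _ Eu euv [-> lv]]] := Pq v (all v) nvb.
  have -> : par v = u by rewrite /par Eu valKd.
  by split=> //; apply: ord_inj; rewrite -legE lv; case: eqP => // _; rewrite legE.
split=> // [v nvb|i il|v nvb].
- case: (Cq v) => [[c0 now]|[w [_ nwb pw cw]]]; [left|right].
    split=> // w nwb; apply: contraNneq (now w (all w) nwb) => pw.
    by rewrite parE // pw.
  by exists w; split=> //; apply: ord_inj; rewrite -parE.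
- by apply: Qq; rewrite sq.
- have [u [_ iu Eu _ _]] := Pq v (all v) nvb.
  by have -> : par v = u by rewrite /par Eu valKd.
Qed.

Lemma upd_lt n (v : 'I_n) (A : nat -> nat) c (F : 'I_n -> nat) : c = F v ->
  (forall w : 'I_n, w < v -> A w = F w) ->
  forall w : 'I_n, w < v.+1 -> upd A v c w = F w.
Proof.
move=> cF AF w; rewrite ltnS leq_eqVlt /= => /orP [/eqP/ord_inj ->|wv].
  by rewrite eqxx.
by case: eqP => [E|_]; [rewrite E ltnn in wv | apply: AF].
Qed.

Definition count_beyond (a c : nat) :=
  For 10 11 0 (
    Read 20 8 10;; Read 21 7 10;; Const 22 0;;
    For 12 13 0 (
      Read 23 a 12;;
      If 23 (Read 24 8 12;;
             IfEq 24 20 (Read 25 7 12;; IfLt 25 21 Skip (Add 22 22 1)) Skip)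
        Skip);;
    Write c 10 22).

Definition leg_sizes :=
  For 10 11 0 (Read 20 8 10;; Read 21 12 20;; Add 21 21 1;; Write 12 20 21).

Definition exit_valids (a c : nat) :=
  For 10 11 0 (
    Const 20 1;;
    For 12 13 0 (
      IfEq 12 10 Skip
        (Read 23 8 12;;
         IfEq 23 12
           (Read 24 12 12;; Read 25 a 12;; Add 25 25 25;; IfLt 24 25 (Const 20 0) Skip)
           Skip));;
    Read 21 8 10;; IfEq 21 10 Skip (Const 20 0);;
    Read 22 a 10;; If 22 Skip (Const 20 0);;
    Write c 10 20).

(* Array x gets the values of [exit_profile] in leg i, array r those elsewhere. *)
Definition exit_profiles (a r x : nat) :=
  For 10 11 0 (
    Read 20 8 10;; Read 21 a 20;; Read 22 a 10;;
    Defs.Sub 23 21 22;; Add 23 23 23;; Read 24 7 10;; Add 25 22 1;;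
    IfEq 23 24 (Write r 10 25) (Write r 10 22);;
    Defs.Sub 25 22 1;;
    IfEq 22 21 (Write x 10 25) (Write x 10 22)).

Section Tables.
Variables (n : nat) (e : rel 'I_n) (b : 'I_n) (par : 'I_n -> 'I_n).
Variables (pos : 'I_n -> nat) (leg : 'I_n -> 'I_n) (q : seq 'I_n) (W : nat).
Hypothesis HW : 100 * (n * n) + 100 * n + 100 < W.
Hypothesis C : spider_coords e b par pos leg.
Local Notation beyond := (beyond pos leg).
Local Notation layout := (layout b par pos leg q).

Lemma beyond_le X k p : beyond X k p <= n.
Proof. by rewrite -[X in _ <= X]card_ord; apply: max_card. Qed.

(** Since legs are named by their heads, the entry of a table of counts at such a name is the number
    of tokens in that leg, the body included as a leg of its own. *)
Lemma beyond_head X k : leg k = k -> beyond X k (pos k) = beyond X k 0.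
Proof.
move=> lk; case: (eqVneq k b) => [->|nkb]; first by rewrite (pos_body C).
by rewrite -{2}lk; case: (leg_nbody C nkb) => _ -> _; rewrite (beyond0 C).
Qed.

Lemma count_beyond_ok a c (X : {set 'I_n}) s : layout s -> a < c -> 9 < c ->
  (forall v : 'I_n, arrs s a v = (v \in X)) ->
  wp W (count_beyond a c) (n * (n * 40 + 50) + 50)
    (fun _ s' => forall v : 'I_n, arrs s' c v = beyond X (leg v) (pos v)) s.
Proof.
move=> L ac c8 sX; rewrite /count_beyond; budget (n * (n * 37 + 40 + 3) + 3).
have neq d : d < c -> (d == c) = false by move=> ?; apply/eqP; lia.
pose Inv i s' := forall v : 'I_n, v < i -> arrs s' c v = beyond X (leg v) (pos v).
apply: (@wp_call _ _ (n * (n * 37 + 40 + 3) + 3) 0).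
- apply: (@wp_for _ _ _ _ _ n (n * 37 + 40) Inv) => //; [exact: lay_n L|exact: lay_one L|lia|].
  move=> v s1 fr v1 H1.
  have L1 : layout s1 by apply: layout_frame L fr _ _; rewrite //= !inE !neq //; lia.
  have X1 (u : 'I_n) : arrs s1 a u = (u \in X) by case: fr => _ -> //; rewrite /= inE neq.
  budget (n * 23 + 3 + 20).+3; step; step; step.
  rewrite v1 (lay_leg L1) (lay_pos L1); apply: wp_seq.
  pose Inv2 j s' := vars s' 22 = \sum_(u < n | u < j) ((u \in X) && ((leg u == leg v) && (pos v <= pos u))).
  apply: (@wp_call _ _ (n * 23 + 3) 20).
  + apply: (@wp_for _ _ _ _ _ n 20 Inv2) => //=; [exact: lay_n L1|exact: lay_one L1|lia| |].
      by rewrite /Inv2 /= big_pred0.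
    move=> u s2 fr2 u2 H2.
    have fv2 := fr2; case: fv2 => fv2 fa2 _.
    have le2 : vars s2 22 <= n * 1 by rewrite H2; apply: sum_le_bound => y; case: (_ && _).
    have E1 : vars s2 1 = 1 by rewrite fv2 //= (lay_one L1).
    have E8 (w : 'I_n) : arrs s2 8 w = leg w by rewrite fa2 //= (lay_leg L1).
    have E7 (w : 'I_n) : arrs s2 7 w = pos w by rewrite fa2 //= (lay_pos L1).
    have Ea (w : 'I_n) : arrs s2 a w = (w \in X) by rewrite fa2 //= X1.
    have E20 : vars s2 20 = leg v by rewrite fv2.
    have E21 : vars s2 21 = pos v by rewrite fv2.
    step; rewrite u2 Ea; step => uX; last first.
      by step; rewrite /Inv2 /= sum_ltS H2; move: uX; case: (u \in X) => //=; rewrite addn0.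
    have {}uX : u \in X by move: uX; case: (u \in X).
    step; rewrite u2 E8; step; rewrite E20 => lu x y z; last first.
      step; rewrite /Inv2 /= sum_ltS H2 uX /=.
      by case: eqP => [lu'|_]; rewrite ?addn0 //; case: lu; rewrite lu'.
    step; rewrite u2 E7; step; rewrite E21 => pu.
      step; rewrite /Inv2 /= sum_ltS H2 [pos v <= _]leqNgt pu !andbF addn0 //.
    step; rewrite /Inv2 /= sum_ltS H2 E1 uX pu andbT (val_inj lu) eqxx //.
  + by lia.
  move=> s2 [fv2 fa2 _]; rewrite /Inv2 sum_lt_all => E22.
  step => w; rewrite ltnS leq_eqVlt /= eqxx fv2 //= v1.
  case: eqVneq => [Ew _|_ /= lt].
    have -> : w = v by apply: val_inj.
    rewrite E22 beyondE [in RHS]big_mkcond; apply: eq_bigr => u _.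
    by case: (u \in X).
  by rewrite fa2 // H1.
- by lia.
by move=> s' _ H' v; apply: H'.
Qed.

Lemma leg_sizes_ok s : layout s -> (forall i, arrs s 12 i = 0) ->
  wp W leg_sizes (n * 50 + 50)
    (fun _ s' => forall k : 'I_n, arrs s' 12 k = leg_size leg k) s.
Proof.
move=> L s12; rewrite /leg_sizes; budget (n * (10 + 3) + 3).
pose Inv i s' := forall k : 'I_n, arrs s' 12 k = \sum_(v < n | v < i) (leg v == k).
apply: (@wp_call _ _ (n * (10 + 3) + 3) 0).
- apply: (@wp_for _ _ _ _ _ n 10 Inv) => //; [exact: lay_n L|exact: lay_one L|lia| |].
    by move=> k; rewrite s12 big_pred0.
  move=> v s1 fr v1 H1; have L1 : layout s1 by apply: layout_frame L fr _ _.
  have le1 : arrs s1 12 (leg v) <= n * 1.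
    by rewrite H1; apply: sum_le_bound => y; case: (_ == _).
  step; rewrite v1 (lay_leg L1); step; step; first by rewrite (lay_one L1); lia.
  step => k /=; rewrite sum_ltS (lay_one L1).
  case: eqVneq => [/val_inj ->|nk]; rewrite H1 ?eqxx //.
  by case: eqP => [E|]; [rewrite -E eqxx in nk | rewrite addn0].
- by lia.
move=> s' _ H' k; rewrite H' sum_lt_all /leg_size -sum1_card [in RHS]big_mkcond.
by apply: eq_bigr => u _; rewrite inE; case: (_ == _).
Qed.

Lemma exit_valids_ok a c (X : {set 'I_n}) s : layout s -> a < c -> 12 < c ->
  (forall v : 'I_n, arrs s a v = beyond X (leg v) (pos v)) ->
  (forall k : 'I_n, arrs s 12 k = leg_size leg k) ->
  wp W (exit_valids a c) (n * (n * 40 + 50) + 50)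
    (fun _ s' => forall v : 'I_n, arrs s' c v = exit_valid pos leg X v) s.
Proof.
move=> L ac c12 sB sl; rewrite /exit_valids; budget (n * (n * 37 + 40 + 3) + 3).
have neq d : d < c -> (d == c) = false by move=> ?; apply/eqP; lia.
pose Inv i s' := forall v : 'I_n, v < i -> arrs s' c v = exit_valid pos leg X v.
apply: (@wp_call _ _ (n * (n * 37 + 40 + 3) + 3) 0).
- apply: (@wp_for _ _ _ _ _ n (n * 37 + 40) Inv) => //; [exact: lay_n L|exact: lay_one L|lia|].
  move=> v s1 fr v1 H1.
  have L1 : layout s1 by apply: layout_frame L fr _ _; rewrite //= !inE !neq //; lia.
  have B1 (u : 'I_n) : arrs s1 a u = beyond X (leg u) (pos u).
    by case: fr => _ -> //; rewrite /= inE neq.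
  have S1 (u : 'I_n) : arrs s1 12 u = leg_size leg u.
    by case: fr => _ -> //; rewrite /= inE neq.
  budget (n * 33 + 3 + 20).+1; step; apply: wp_seq.
  pose ok (k : 'I_n) := (leg k == k) && (k != v) ==> ((beyond X k 0).*2 <= leg_size leg k).
  pose Inv2 j s' := vars s' 20 = [forall k : 'I_n, (k < j) ==> ok k].
  have next j s' : vars s' 20 = [forall k : 'I_n, (k < val j) ==> ok k] && ok j -> Inv2 j.+1 s'.
    rewrite /Inv2 => ->; congr nat_of_bool; apply/andP/forallP => [[/forallP h hj] k|h].
      by rewrite ltnS leq_eqVlt; apply/implyP => /orP [/eqP/val_inj -> //|]; apply/implyP.
    split; last by have := h j; rewrite ltnSn.
    apply/forallP => k; apply/implyP => kj; have := h k; rewrite ltnS (ltnW kj); exact.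
  apply: (@wp_call _ _ (n * 33 + 3) 20).
  + apply: (@wp_for _ _ _ _ _ n 30 Inv2) => //=; [exact: lay_n L1|exact: lay_one L1|lia| |].
      by rewrite /Inv2 /=; case: forallP => // -[].
    move=> k s2 [fv2 fa2 _] k2 H2.
    have E10 : vars s2 10 = v by rewrite fv2.
    have E8 (w : 'I_n) : arrs s2 8 w = leg w by rewrite fa2 //= (lay_leg L1).
    have E12 (w : 'I_n) : arrs s2 12 w = leg_size leg w by rewrite fa2 //= S1.
    have Ea (w : 'I_n) : arrs s2 a w = beyond X (leg w) (pos w) by rewrite fa2 //= B1.
    step; rewrite k2 E10 => kv x y z.
      by step; apply: next; rewrite /= H2 /ok (val_inj kv) eqxx andbF andbT.
    have {}kv : k != v by apply: contra_notN kv => /eqP ->.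
    step; rewrite k2 E8; step; rewrite k2 => lk x' y' z'; last first.
      step; apply: next; rewrite /= H2 /ok; case: eqP => [lk'|_]; last by rewrite andbT.
      by case: lk; rewrite lk'.
    have {}lk : leg k = k by apply: val_inj.
    have := beyond_le X (leg k) (pos k) => leB.
    step; rewrite k2 E12; step; rewrite k2 Ea; step.
    rewrite lk beyond_head // addnn; step => cmp; step; apply: next; rewrite /= /ok lk eqxx kv /=.
      by rewrite leqNgt cmp andbF.
    by rewrite H2 cmp andbT.
  + by lia.
  move=> s2 [fv2 fa2 _] E20.
  have E10 : vars s2 10 = v by rewrite fv2.
  have {}E20 : vars s2 20 = [forall k, ok k].
    by rewrite E20; congr nat_of_bool; apply: eq_forallb => k; rewrite ltn_ord.
  have E8 : arrs s2 8 v = leg v by rewrite fa2 //= (lay_leg L1).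
  have Ea : arrs s2 a v = beyond X (leg v) (pos v) by rewrite fa2 //= B1.
  have store s3 : arrs s3 c = arrs s1 c -> vars s3 10 = v ->
      vars s3 20 = exit_valid pos leg X v -> wp W (Write c 10 20) 3 (fun=> Inv v.+1) s3.
    move=> e3 v3 res; step; rewrite /Inv /= eqxx v3 e3.
    exact: upd_lt.
  have ec : arrs s2 c = arrs s1 c by rewrite fa2.
  step; rewrite E10 E8; apply: wp_seq; apply: wp_ifeq => //=; rewrite E10 => lv x y z; step.
    have {}lv : leg v = v by apply: val_inj.
    step; rewrite E10 Ea; step => pB; step; apply: wp_weaken (store _ _ _ _) _ => //=;
      rewrite ?E20 /exit_valid lv eqxx /=; rewrite lv beyond_head // in pB.
      by rewrite lt0n (introN eqP pB).
    by rewrite pB.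
  have nv : exit_valid pos leg X v = false.
    by rewrite /exit_valid; case: eqP => // lv'; case: lv; rewrite lv'.
  by step; step => pB; step; apply: wp_weaken (store _ _ _ _) _ => //=; rewrite nv.
- by lia.
by move=> s' _ H' v; apply: H'.
Qed.

Lemma exit_profiles_ok a r x (X : {set 'I_n}) s : layout s -> a < r -> 9 < r -> r < x ->
  (forall v : 'I_n, arrs s a v = beyond X (leg v) (pos v)) ->
  wp W (exit_profiles a r x) (n * 50 + 50)
    (fun _ s' => forall i v : 'I_n, v != b ->
       exit_profile (beyond X) i (leg v) (pos v) =
       if leg v == i then arrs s' x v else arrs s' r v) s.
Proof.
move=> L ar r8 rx sB; rewrite /exit_profiles; budget (n * (40 + 3) + 3).
have neqr d : d < r -> (d == r) = false by move=> ?; apply/eqP; lia.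
have neqx d : d < x -> (d == x) = false by move=> ?; apply/eqP; lia.
pose Inv j s' := forall i v : 'I_n, v < j -> v != b ->
  exit_profile (beyond X) i (leg v) (pos v) = if leg v == i then arrs s' x v else arrs s' r v.
apply: (@wp_call _ _ (n * (40 + 3) + 3) 0).
- apply: (@wp_for _ _ _ _ _ n 40 Inv) => //; [exact: lay_n L|exact: lay_one L|lia|].
  move=> v s1 fr v1 H1.
  have L1 : layout s1.
    by apply: layout_frame L fr _ _; rewrite //= !inE ?neqr ?neqx //; lia.
  have B1 (u : 'I_n) : arrs s1 a u = beyond X (leg u) (pos u).
    by case: fr => _ -> //; rewrite /= !inE ?neqr ?neqx //; lia.
  have := beyond_le X (leg v) (pos v) => le1.
  have := beyond_le X (leg v) (pos (leg v)) => le2.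
  have fin s2 : arrs s2 r = upd (arrs s1 r) v (beyond X (leg v) (pos v) +
          ((beyond X (leg v) (pos (leg v)) - beyond X (leg v) (pos v)).*2 == pos v)) ->
      arrs s2 x = upd (arrs s1 x) v (beyond X (leg v) (pos v) -
          (beyond X (leg v) (pos v) == beyond X (leg v) (pos (leg v)))) -> Inv v.+1 s2.
    move=> er ex i w; rewrite ltnS leq_eqVlt er ex /= => /orP [/eqP/val_inj ->|lt] nwb.
      rewrite eqxx /exit_profile; case: (leg_nbody C nwb) => _ -> _.
      by case: ifP.
    by have -> : (val w == v) = false; [apply/eqP => E; rewrite E ltnn in lt | apply: H1].
  have o1 := lay_one L1; step; rewrite v1 (lay_leg L1).
  step; rewrite B1 (leg_idem C); step; rewrite v1 B1.
  step; step; rewrite addnn; step; rewrite v1 (lay_pos L1); step; rewrite (lay_one L1).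
  have nxr := neqx _ rx; have nrx : (x == r) = false by rewrite eq_sym.
  apply: wp_seq; apply: wp_ifeq => //= c1 u1 u2 u3; step; rewrite v1; step; rewrite (lay_one L1);
    apply: wp_ifeq => //= c2 u1' u2' u3'; step; rewrite v1; apply: fin => /=;
    rewrite ?eqxx ?nxr ?nrx ?(introT eqP c1) ?(introF eqP c1) ?(introT eqP c2) ?(introF eqP c2) ?addn0 ?subn0 //.
- by lia.
by move=> s' _ H' i v; apply: H'.
Qed.

End Tables.

(** * Choosing the route *)

(** The choice of x decides whether legs are treated as leg i, and that of y whether as leg j; every
    leg is priced under this assumption. *)
Definition cost_table (x y w : nat) :=
  Const 30 0;;
  For 10 11 0 (
    IfEq 10 4 Skip (
      Read 20 10 10;; Read 21 x 10;; Read 22 y 10;; Read 23 11 10;;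
      Defs.Sub 24 20 21;; Defs.Sub 25 21 20;; Add 24 24 25;;
      Defs.Sub 25 21 22;; Add 24 24 25;; Defs.Sub 25 22 21;; Add 24 24 25;;
      Defs.Sub 25 22 23;; Add 24 24 25;; Defs.Sub 25 23 22;; Add 24 24 25;;
      Read 26 8 10;; Read 27 w 26;; Add 27 27 24;; Write w 26 27;;
      Add 30 30 24)).

(* Arrays 13, 14: the valid exits of I and J; arrays 19, 20, 21, 22: the cost of a
   leg that is neither i nor j, only i, only j, or both; variable 30: the total
   cost if no leg is i or j; variables 32, 33, 34: the best cost and its pair. *)
Definition keep_pair := Copy 32 22;; Copy 33 10;; Copy 34 12;; Const 31 1.

(** The total for legs outside the pair is corrected at i and j only. All additions precede the
    subtractions, so that truncation does no harm. Variable 31 tells whether some valid pair has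
    been seen. *)
Definition best_pair :=
  Const 31 0;;
  For 10 11 0 (
    Read 20 13 10;;
    If 20
      (For 12 13 0 (
         Read 21 14 12;;
         If 21
           (IfEq 10 12
              (Read 22 22 10;; Add 22 30 22;; Read 23 19 10;; Defs.Sub 22 22 23)
              (Read 22 20 10;; Add 22 30 22;; Read 23 21 12;; Add 22 22 23;;
               Read 23 19 10;; Defs.Sub 22 22 23;;
               Read 23 19 12;; Defs.Sub 22 22 23);;
            If 31 (IfLt 22 32 keep_pair Skip) keep_pair)
           Skip))
      Skip).

Definition compare_counts :=
  Const 35 0;;
  For 10 11 0 (
    Read 20 8 10;;
    IfEq 20 10
      (Read 21 10 10;; Read 22 11 10;; IfEq 21 22 Skip (Const 35 1))
      Skip).

(* Variable 35 is 0 iff the body need not be used; arrays 15 to 18 come from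
   [exit_profiles], and arrays 23, 24 get the two intermediate profiles. *)
Definition set_targets :=
  For 10 11 0 (
    If 35
      (Read 20 8 10;;
       IfEq 20 33 (Read 21 16 10) (Read 21 15 10);; Write 23 10 21;;
       IfEq 20 34 (Read 21 18 10) (Read 21 17 10);; Write 24 10 21)
      (Read 21 10 10;; Write 23 10 21;; Read 21 11 10;; Write 24 10 21)).

Section PairCost.
Variables (T : finType) (b : T) (leg : T -> T) (F : bool -> bool -> T -> nat).

(** Only the terms of leg i differ. Additions on both sides avoid truncated subtraction. *)
Lemma pair_cost_eq i :
  \sum_(v | v != b) F (leg v == i) (leg v == i) v +
    \sum_v (if (v != b) && (leg v == i) then F false false v else 0) =
  \sum_(v | v != b) F false false v +
    \sum_v (if (v != b) && (leg v == i) then F true true v else 0).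
Proof.
rewrite ![\sum_(v | v != b) _]big_mkcond -!big_split; apply: eq_bigr => v _ /=.
by case: eqP => _; case: eqP => _ /=; lia.
Qed.

Lemma pair_cost_neq i j : i != j ->
  \sum_(v | v != b) F (leg v == i) (leg v == j) v +
    \sum_v (if (v != b) && (leg v == i) then F false false v else 0) +
    \sum_v (if (v != b) && (leg v == j) then F false false v else 0) =
  \sum_(v | v != b) F false false v +
    \sum_v (if (v != b) && (leg v == i) then F true false v else 0) +
    \sum_v (if (v != b) && (leg v == j) then F false true v else 0).
Proof.
move=> nij; rewrite ![\sum_(v | v != b) _]big_mkcond -!big_split.
apply: eq_bigr => v _ /=; case: (v != b) => //=.
case: (eqVneq (leg v) i) => [->|_]; first by rewrite (negPf nij) /=; lia.
by case: eqP => _ /=; lia.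
Qed.

End PairCost.

Section Choice.
Variables (n : nat) (e : rel 'I_n) (b : 'I_n) (par : 'I_n -> 'I_n).
Variables (pos : 'I_n -> nat) (leg : 'I_n -> 'I_n) (q : seq 'I_n) (W : nat).
Hypothesis HW : 100 * (n * n) + 100 * n + 100 < W.
Hypothesis C : spider_coords e b par pos leg.
Local Notation beyond := (beyond pos leg).
Local Notation layout := (layout b par pos leg q).

Lemma cost_table_ok x y w (fI fX fY fJ : 'I_n -> nat) s : layout s ->
  x < w -> y < w -> 11 < w ->
  (forall i, arrs s w i = 0) ->
  (forall v, v != b -> [/\ arrs s 10 v = fI v, arrs s x v = fX v, arrs s y v = fY v
                         & arrs s 11 v = fJ v]) ->
  (forall v, v != b -> [/\ fI v <= n.+1, fX v <= n.+1, fY v <= n.+1 & fJ v <= n.+1]) ->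
  let F v := absd (fI v) (fX v) + absd (fX v) (fY v) + absd (fY v) (fJ v) in
  wp W (cost_table x y w) (n * 100 + 50)
    (fun _ s' => (forall k : 'I_n, arrs s' w k =
                    \sum_v (if (v != b) && (leg v == k) then F v else 0)) /\
                 vars s' 30 = \sum_(v | v != b) F v) s.
Proof.
move=> L xw yw w11 w0 sf bd F; rewrite /cost_table; budget (n * (50 + 3) + 3 + 0).+1.
have neq d : d < w -> (d == w) = false by move=> ?; apply/eqP; lia.
pose G k v := if (v != b) && (leg v == k) then F v else 0.
pose Inv i s' := (forall k : 'I_n, arrs s' w k = \sum_(v < n | v < i) G k v) /\
  vars s' 30 = \sum_(v < n | v < i) if v != b then F v else 0.
have Fle v : v != b -> F v <= 3 * n.+1.
  by case/bd; rewrite /F /absd; lia.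
step; apply: (@wp_call _ _ (n * (50 + 3) + 3) 0).
- apply: (@wp_for _ _ _ _ _ n 50 Inv) => //; [exact: lay_n L|exact: lay_one L|lia| |].
    by split=> [k|] /=; rewrite ?w0 big_pred0.
  move=> v s1 fr v1 [H1 H2].
  have L1 : layout s1.
    have L0 : layout (set_var s 30 0) by case: L; split.
    by apply: layout_frame L0 fr _ _; rewrite //= !inE !neq //; lia.
  have sf1 u : u != b -> [/\ arrs s1 10 u = fI u, arrs s1 x u = fX u, arrs s1 y u = fY u
                           & arrs s1 11 u = fJ u].
    by case: fr => _ fa _ /sf [<- <- <- <-]; split; rewrite fa //= !inE neq //; lia.
  have G0 k : \sum_(u < n | u < v) G k u <= n * (3 * n.+1).
    by apply: sum_le_bound => u; rewrite /G; case: (boolP (u != b)) => //= /Fle; case: ifP.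
  have S0 : vars s1 30 <= n * (3 * n.+1).
    by rewrite H2; apply: sum_le_bound => u; case: (boolP (u != b)) => //= /Fle.
  step; rewrite v1 (lay_body L1) => vb u1 u2 u3.
    step; rewrite /Inv /= H2 (ord_inj vb); split=> [k|]; rewrite !sum_ltS /G eqxx /= addn0 //.
    by rewrite H1 (ord_inj vb).
  have nvb : v != b by apply: contra_notN vb => /eqP ->.
  have [e10 ex ey e11] := sf1 v nvb; have Fv := Fle v nvb; have [l1 l2 l3 l4] := bd v nvb.
  step; rewrite v1 e10; step; rewrite v1 ex; step; rewrite v1 ey; step; rewrite v1 e11.
  do 11 step.
  have -> : fI v - fX v + (fX v - fI v) + (fX v - fY v) + (fY v - fX v) + (fY v - fJ v) +
     (fJ v - fY v) = F v by rewrite /F /absd !addnA.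
  have := G0 (leg v); rewrite -H1 => Gv.
  step; rewrite v1 (lay_leg L1); step; step; step; step.
  rewrite /Inv /= eqxx H2; split=> [k|]; rewrite !sum_ltS ?nvb //.
  rewrite /=; case: eqVneq => [/ord_inj ->|nk]; rewrite H1 /G nvb ?eqxx //=.
  by case: eqVneq => [E|_]; rewrite ?addn0 //; rewrite E eqxx in nk.
- by lia.
move=> s' _ [H1 H2]; split=> [k|]; first by rewrite H1 sum_lt_all.
by rewrite H2 sum_lt_all [in RHS]big_mkcond.
Qed.

Lemma best_pair_ok (vI vJ : pred 'I_n) (K : 'I_n -> 'I_n -> nat)
    (w00 w10 w01 w11 : 'I_n -> nat) s : layout s ->
  (forall v : 'I_n, arrs s 13 v = vI v) -> (forall v : 'I_n, arrs s 14 v = vJ v) ->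
  (forall v : 'I_n, arrs s 19 v = w00 v) -> (forall v : 'I_n, arrs s 20 v = w10 v) ->
  (forall v : 'I_n, arrs s 21 v = w01 v) -> (forall v : 'I_n, arrs s 22 v = w11 v) ->
  (forall i, K i i + w00 i = vars s 30 + w11 i) ->
  (forall i j, i != j -> K i j + w00 i + w00 j = vars s 30 + w10 i + w01 j) ->
  vars s 30 <= n * (3 * n.+1) ->
  (forall v, [/\ w10 v <= n * (3 * n.+1), w01 v <= n * (3 * n.+1) & w11 v <= n * (3 * n.+1)]) ->
  wp W best_pair (n * (n * 60 + 50) + 50)
    (fun _ s' => (exists i j, vI i && vJ j) ->
       exists i j : 'I_n, [/\ vI i && vJ j, vars s' 33 = i, vars s' 34 = j
         & forall i' j', vI i' && vJ j' -> K i j <= K i' j']) s.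
Proof.
move=> L s13 s14 s19 s20 s21 s22 Keq Kneq bs bw; rewrite /best_pair.
budget (n * (n * 53 + 20 + 3) + 3 + 0).+1.
pose best (P : 'I_n -> 'I_n -> bool) s' :=
  vars s' 31 = 0 /\ (forall i j, P i j -> ~~ (vI i && vJ j)) \/
  vars s' 31 = 1 /\ exists i j : 'I_n, [/\ vI i && vJ j, vars s' 33 = i, vars s' 34 = j,
     vars s' 32 = K i j & forall i' j', P i' j' -> vI i' && vJ j' -> K i j <= K i' j'].
have best_eq P Q s1 s2 : (forall i j, vI i && vJ j -> Q i j = P i j) ->
    vars s2 31 = vars s1 31 -> vars s2 32 = vars s1 32 -> vars s2 33 = vars s1 33 ->
    vars s2 34 = vars s1 34 -> best P s1 -> best Q s2.
  move=> PQ e31 e32 e33 e34; rewrite /best e31 e32 e33 e34.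
  move=> [[f0 no]|[f1 [i [j [v33 v34 vi vj le]]]]]; [left|right]; split=> //.
    by move=> i j Qij; apply/negP => vij; rewrite PQ // in Qij; move: (no _ _ Qij); rewrite vij.
  by exists i, j; split=> // i' j' Q' vij; apply: le => //; rewrite -PQ.
pose Inv i s' := best (fun i' _ => i' < i) s'.
step; apply: (@wp_call _ _ (n * (n * 53 + 20 + 3) + 3) 0).
- apply: (@wp_for _ _ _ _ _ n (n * 53 + 20) Inv) => //; [exact: lay_n L|exact: lay_one L|lia| |].
    by left.
  move=> i s1 [fv fa _] v1 H1.
  have E30 : vars s1 30 = vars s 30 by rewrite fv.
  budget (n * 53 + 3).+3; step; rewrite v1 fa //= s13; step => vi; last first.
    step; apply: best_eq H1 => // i' j' /andP [vi' _]; rewrite ltnS leq_eqVlt.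
    by case: eqP => // /ord_inj E; rewrite E in vi'; rewrite vi' in vi.
  have {}vi : vI i by move: vi; case: (vI i).
  pose Inv2 j s' := best (fun i' j' => (i' < i) || (i' == i) && (j' < j)) s'.
  apply: (@wp_call _ _ (n * 53 + 3) 1).
  + apply: (@wp_for _ _ _ _ _ n 50 Inv2) => //=; [rewrite fv //=; exact: lay_n L|rewrite fv //=; exact: lay_one L|lia| |].
      by apply: best_eq H1 => // i' j' _; rewrite andbF orbF.
    move=> j s2 [fv2 fa2 _] j2 H2.
    have E10 : vars s2 10 = i by rewrite fv2.
    have E30' : vars s2 30 = vars s 30 by rewrite fv2 //= fv.
    have A19 (v : 'I_n) : arrs s2 19 v = w00 v by rewrite fa2 //= fa //= s19.
    have A20 (v : 'I_n) : arrs s2 20 v = w10 v by rewrite fa2 //= fa //= s20.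
    have A21 (v : 'I_n) : arrs s2 21 v = w01 v by rewrite fa2 //= fa //= s21.
    have A22 (v : 'I_n) : arrs s2 22 v = w11 v by rewrite fa2 //= fa //= s22.
    have A14 (v : 'I_n) : arrs s2 14 v = vJ v by rewrite fa2 //= fa //= s14.
    have ord (i' j' : 'I_n) : (i' < i) || (i' == i) && (j' < j.+1) =
        ((i' < i) || (i' == i) && (j' < j)) || ((i' == i) && (j' == j)).
      rewrite [j' < j.+1]ltnS [j' <= j]leq_eqVlt -!orbA; congr (_ || _).
      by case: (i' == i) => //=; rewrite orbC.
    step; rewrite j2 A14; step => vj; last first.
      step; apply: best_eq H2 => // i' j' /andP [_ vj'] /=; rewrite ord orbC.
      case: (eqVneq j' j) => [E|_]; last by rewrite andbF.
      by rewrite E in vj'; rewrite vj' in vj.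
    have {}vj : vJ j by move: vj; case: (vJ j).
    have [b10 b01 b11] := bw i; have [b10' b01' b11'] := bw j.
    have keep s3 : vars s3 22 = K i j -> vars s3 10 = i -> vars s3 12 = j ->
        vars s3 31 = 0 \/ K i j < vars s3 32 ->
        vars s3 31 = vars s2 31 -> vars s3 32 = vars s2 32 ->
        wp W keep_pair 10 (fun=> Inv2 j.+1) s3.
      move=> k3 i3 j3 cmp e31 e32; rewrite /keep_pair; do 4 step.
      right; rewrite /= k3 i3 j3; split=> //; exists i, j; split; rewrite ?vi //.
      move=> i' j'; rewrite ord => /orP [lt vij|/andP [/eqP -> /eqP ->] _] //.
      case: H2 => [[_ no]|[f1 [i0 [j0 [_ _ _ v32 le]]]]].
        by move: (no _ _ lt); rewrite vij.
      rewrite e31 e32 f1 v32 in cmp.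
      by case: cmp => // cmp; apply: leq_trans (ltnW cmp) (le _ _ lt vij).
    have fin s3 : vars s3 22 = K i j -> vars s3 10 = i -> vars s3 12 = j ->
        vars s3 31 = vars s2 31 -> vars s3 32 = vars s2 32 -> vars s3 33 = vars s2 33 ->
        vars s3 34 = vars s2 34 ->
        wp W (If 31 (IfLt 22 32 keep_pair Skip) keep_pair) 15 (fun=> Inv2 j.+1) s3.
      move=> k3 i3 j3 e31 e32 e33 e34; step => f; last first.
        by apply: wp_weaken (keep _ _ _ _ _ _ _) _ => //; left.
      step => cmp; first by apply: wp_weaken (keep _ _ _ _ _ _ _) _ => //=; right; rewrite -k3.
      step; case: H2 => [[f0 _]|[f1 [i0 [j0 [vij v33 v34 v32 le]]]]]; first by rewrite e31 in f.
      right; rewrite /= e31 e32 e33 e34; split=> //; exists i0, j0; split=> // i' j'.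
      rewrite ord => /orP [lt|/andP [/eqP -> /eqP ->] _]; first exact: le.
      by rewrite -v32 -e32 -k3.
    apply: wp_seq; apply: wp_ifeq => //=; rewrite E10 j2.
      move=> /ord_inj ij u1 u2 u3; have EK := Keq i.
      step; rewrite E10 A22; step; rewrite E30'; step; rewrite E10 A19; step.
      apply: wp_weaken (fin _ _ _ _ _ _ _ _) _ => //=; rewrite -ij; lia.
    move=> nij u1 u2 u3; have := Kneq i j; case: eqVneq => [E|_ /(_ isT) EK]; first by case: nij; rewrite E.
    step; rewrite E10 A20; step; rewrite E30'; step; rewrite j2 A21; step; step; rewrite E10 A19.
    step; step; rewrite j2 A19; step.
    apply: wp_weaken (fin _ _ _ _ _ _ _ _) _ => //=; lia.
  + by lia.
  move=> s2 _ H2; apply: best_eq H2 => // i' j' _; rewrite ltnS leq_eqVlt orbC.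
  by rewrite ltn_ord andbT.
- by lia.
move=> s' _ H' [i0 [j0 v0]]; case: H' => [[_ no]|[_ [i [j [vij v33 v34 _ le]]]]].
  by have := no i0 j0 (ltn_ord i0); rewrite v0.
by exists i, j; split=> // i' j' v'; apply: le; rewrite ?ltn_ord.
Qed.

Lemma compare_counts_ok (I J : {set 'I_n}) s : layout s ->
  (forall v : 'I_n, arrs s 10 v = beyond I (leg v) (pos v)) ->
  (forall v : 'I_n, arrs s 11 v = beyond J (leg v) (pos v)) ->
  wp W compare_counts (n * 50 + 50)
    (fun _ s' => vars s' 35 =
       ~~ [forall k, (leg k == k) ==> (beyond I k 0 == beyond J k 0)]) s.
Proof.
move=> L sI sJ; rewrite /compare_counts; budget (n * (30 + 3) + 3 + 0).+1.
pose ok k := (leg k == k) ==> (beyond I k 0 == beyond J k 0).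
pose Inv i s' := vars s' 35 = ~~ [forall k : 'I_n, (k < i) ==> ok k].
have next (j : 'I_n) s' : vars s' 35 = ~~ ([forall k : 'I_n, (k < j) ==> ok k] && ok j) ->
    Inv j.+1 s'.
  move=> E; rewrite /Inv E; congr (nat_of_bool (~~ _)); apply/andP/forallP => [[/forallP h hj] k|h].
    by rewrite ltnS leq_eqVlt; apply/implyP => /orP [/eqP/ord_inj -> //|]; apply/implyP.
  split; last by have := h j; rewrite ltnSn.
  apply/forallP => k; apply/implyP => kj; have := h k; rewrite ltnS (ltnW kj); exact.
step; apply: (@wp_call _ _ (n * (30 + 3) + 3) 0).
- apply: (@wp_for _ _ _ _ _ n 30 Inv) => //; [exact: lay_n L|exact: lay_one L|lia| |].
    by rewrite /Inv /=; case: forallP => // -[].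
  move=> v s1 [fv fa _] v1 H1.
  step; rewrite v1 fa //= (lay_leg L); step; rewrite v1 => lv u1 u2 u3; last first.
    step; apply: next; rewrite /= H1 /ok; case: eqP => [lv'|_]; last by rewrite andbT.
    by case: lv; rewrite lv'.
  have {}lv : leg v = v by apply: ord_inj.
  step; rewrite v1 fa //= sI; step; rewrite v1 fa //= sJ.
  rewrite lv !(beyond_head C) //; step => c w1 w2 w3; step; apply: next; rewrite /= /ok lv eqxx /=.
    by rewrite H1 c eqxx andbT.
  by rewrite (introF eqP c) andbF.
- by lia.
move=> s' _ ->; congr (nat_of_bool (~~ _)); apply: eq_forallb => k.
by rewrite ltn_ord.
Qed.

Lemma set_targets_ok (i j : 'I_n) s : layout s ->
  (vars s 35 <> 0 -> vars s 33 = i /\ vars s 34 = j) ->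
  wp W set_targets (n * 50 + 50)
    (fun _ s' => forall v : 'I_n,
       arrs s' 23 v = (if vars s 35 == 0 then arrs s 10 v
                       else if leg v == i then arrs s 16 v else arrs s 15 v) /\
       arrs s' 24 v = (if vars s 35 == 0 then arrs s 11 v
                       else if leg v == j then arrs s 18 v else arrs s 17 v)) s.
Proof.
move=> L ij; rewrite /set_targets; budget (n * (30 + 3) + 3).
pose f1 (v : 'I_n) := if vars s 35 == 0 then arrs s 10 v
  else if leg v == i then arrs s 16 v else arrs s 15 v.
pose f2 (v : 'I_n) := if vars s 35 == 0 then arrs s 11 v
  else if leg v == j then arrs s 18 v else arrs s 17 v.
pose Inv i s' := forall v : 'I_n, v < i -> arrs s' 23 v = f1 v /\ arrs s' 24 v = f2 v.
apply: (@wp_call _ _ (n * (30 + 3) + 3) 0).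
- apply: (@wp_for _ _ _ _ _ n 30 Inv) => //; [exact: lay_n L|exact: lay_one L|lia|].
  move=> v s1 [fv fa _] v1 H1.
  have fin s2 : arrs s2 23 = upd (arrs s1 23) v (f1 v) ->
      arrs s2 24 = upd (arrs s1 24) v (f2 v) -> Inv v.+1 s2.
    by move=> h1 h2 w wv; rewrite h1 h2; split; apply: upd_lt => // u uv; case: (H1 u uv).
  have [A10 A11] : arrs s1 10 = arrs s 10 /\ arrs s1 11 = arrs s 11 by rewrite !fa.
  have [A15 A16 A17 A18] : [/\ arrs s1 15 = arrs s 15, arrs s1 16 = arrs s 16,
    arrs s1 17 = arrs s 17 & arrs s1 18 = arrs s 18] by rewrite !fa.
  have [V33 V34] : vars s1 33 = vars s 33 /\ vars s1 34 = vars s 34 by rewrite !fv.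
  rewrite /f1 /f2 in fin; step; rewrite fv // => f; last first.
    by rewrite f /= in fin; do 4 step; apply: fin; rewrite /= ?v1 ?A10 ?A11.
  have [v33 v34] := ij f; rewrite (introF eqP f) in fin.
  have eqo (k l : 'I_n) : (k == l) = (val k == l) by [].
  rewrite !eqo in fin; step; rewrite v1 fa // (lay_leg L).
  apply: wp_seq; apply: wp_ifeq => //=; rewrite V33 v33 => c1 u1 u2 u3; step; step;
    (apply: wp_seq; apply: wp_ifeq => //=; rewrite V34 v34 => c2 w1 w2 w3; step; step);
    apply: fin => /=; rewrite v1 ?A15 ?A16 ?A17 ?A18 ?(introT eqP c1) ?(introT eqP c2)
      ?(introF eqP c1) ?(introF eqP c2) //.
- by lia.
by move=> s' _ H' v; apply: H'.
Qed.

End Choice.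

(** * Transporting the tokens *)

(* Arrays 25, 26, 27: tokens, their [beyond] counts, and the target counts;
   arrays 28, 29 and variable 46: the log of the moves and its length. *)
Definition log_move (x y : nat) := Write 28 46 x;; Write 29 46 y;; Add 46 46 1.

(* Moves the token on vertex 40 outwards as long as the target asks for it;
   variable 41 is the successor of the next vertex, or 0. *)
Definition slide_out :=
  For 14 15 0 (
    If 41
      (Defs.Sub 42 41 1;; Read 43 26 42;; Read 44 27 42;;
       IfLt 43 44
         (Add 43 43 1;; Write 26 42 43;; Const 45 0;; Write 25 40 45;; Write 25 42 1;;
          log_move 40 42;; Copy 40 42;; Read 41 9 42)
         Skip)
      Skip).

Definition slide_in :=
  For 14 15 0 (
    IfEq 40 4 Skip (
      Read 43 26 40;; Read 44 27 40;;
      IfLt 44 43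
        (Defs.Sub 43 43 1;; Write 26 40 43;; Const 45 0;; Write 25 40 45;;
         Read 42 6 40;; Write 25 42 1;; log_move 40 42;; Copy 40 42)
        Skip)).

(** The queue lists parents before children, so reading it from the end treats the tokens of each
    leg farthest first. *)
Definition out_sweep :=
  For 10 11 0 (
    Defs.Sub 47 0 1;; Defs.Sub 47 47 10;; Read 48 4 47;;
    IfEq 48 4 Skip (
      Read 49 25 48;;
      If 49 (Copy 40 48;; Read 41 9 48;; slide_out) Skip)).

Definition find_deficit :=
  For 12 13 0 (
    IfEq 12 4 Skip (
      Read 50 8 12;;
      IfEq 50 12 (Read 51 26 12;; Read 52 27 12;; IfLt 51 52 (Copy 53 12) Skip) Skip)).

Definition push_body := find_deficit;; Copy 40 4;; Add 41 53 1;; slide_out.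

(** The counts at the name of a leg show whether it has too many tokens, which is when one of them
    will have to enter the body. *)
Definition in_sweep :=
  For 10 11 0 (
    Read 48 4 10;;
    IfEq 48 4 Skip (
      Read 49 25 48;;
      If 49
        (Read 50 8 48;; Read 51 26 50;; Read 52 27 50;;
         IfLt 52 51 (Read 49 25 4;; If 49 push_body Skip) Skip;;
         Copy 40 48;; slide_in)
        Skip)).

Definition transport := out_sweep;; in_sweep.

(** * Sliding a single token *)

Section Sweeps.
Variables (n : nat) (e : rel 'I_n) (b : 'I_n) (par : 'I_n -> 'I_n).
Variables (pos : 'I_n -> nat) (leg : 'I_n -> 'I_n) (q : seq 'I_n) (W : nat).
Hypothesis HW : 100 * (n * n) + 100 * n + 100 < W.
Hypothesis C : spider_coords e b par pos leg.
Local Notation beyond := (beyond pos leg).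
Local Notation layout := (layout b par pos leg q).
Local Notation profile_dist := (profile_dist b pos leg).

Definition logged (s : state) (ms : seq ('I_n * 'I_n)) : Prop :=
  vars s 46 = size ms /\ forall i m0, i < size ms ->
    arrs s 28 i = (nth m0 ms i).1 /\ arrs s 29 i = (nth m0 ms i).2.

Lemma logged_rcons s s' ms x z : logged s ms ->
  vars s' 46 = (vars s 46).+1 -> arrs s' 28 = upd (arrs s 28) (vars s 46) (val x) ->
  arrs s' 29 = upd (arrs s 29) (vars s 46) (val z) -> logged s' (rcons ms (x, z)).
Proof.
move=> [sz lg] e46 e28 e29; split=> [|i m0]; first by rewrite size_rcons e46 sz.
rewrite size_rcons ltnS leq_eqVlt e28 e29 sz nth_rcons /=.
by case: eqVneq => [->|_ /= lt]; rewrite ?ltnn ?lt //; apply: lg.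
Qed.

Variables (y : 'I_n -> nat -> nat) (X0 : {set 'I_n}) (ms0 : seq ('I_n * 'I_n)).
Hypothesis py : profile b pos leg y.
Hypothesis HL : size ms0 + profile_dist (beyond X0) y < W.

(** The equation in [cf_log] carries optimality: each slide has lowered the distance to the target
    by one, so on arrival the log is as long as the initial distance. *)
Record conf (X : {set 'I_n}) (s : state) : Prop := Conf {
  cf_lay : layout s;
  cf_tgt : forall v, v != b -> arrs s 27 v = y (leg v) (pos v);
  cf_tok : forall v : 'I_n, arrs s 25 v = (v \in X);
  cf_bey : forall v, v != b -> arrs s 26 v = beyond X (leg v) (pos v);
  cf_ind : independent e X;
  cf_log : exists ms : seq ('I_n * 'I_n), [/\ moves e X0 ms X, logged s (ms0 ++ ms) &
    size ms + profile_dist (beyond X) y = profile_dist (beyond X0) y] }.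

Lemma conf_frame X s p s' : conf X s -> frame p s s' ->
  all (fun x => x \notin mod_vars p) [:: 0; 1; 4; 46] ->
  all (fun a => a \notin mod_arrs p) [:: 4; 6; 7; 8; 9; 25; 26; 27; 28; 29] -> conf X s'.
Proof.
move=> [L tgt tok bey ind [ms [mv [lg1 lg2] sz]]] fr fv fa.
have [v46 a25 a26 a27 [a28 a29]] : [/\ vars s' 46 = vars s 46, arrs s' 25 = arrs s 25,
    arrs s' 26 = arrs s 26, arrs s' 27 = arrs s 27
    & arrs s' 28 = arrs s 28 /\ arrs s' 29 = arrs s 29].
  have /allP fa' := fa; have /allP fv' := fv; case: fr => fv1 fa1 _.
  by split; [apply/fv1/fv' | apply/fa1/fa' | apply/fa1/fa' | apply/fa1/fa' | split; apply/fa1/fa'].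
split=> //; rewrite ?a25 ?a26 ?a27 //.
  apply: layout_frame L fr _ _.
    by move: fv => /= /and5P [-> -> -> _ _].
  by move: fa => /= /and5P [-> -> -> -> /andP [-> _]].
by exists ms; split=> //; split; rewrite ?v46 ?a28 ?a29.
Qed.

Lemma conf_set_var X s x v : x \notin [:: 0; 1; 4; 46] -> conf X s -> conf X (set_var s x v).
Proof.
move=> nx cf; apply: (@conf_frame _ _ (Const x v)) cf _ _ _ => //.
  by split=> //= z; rewrite inE => /negPf ->.
by apply/allP => z zin; rewrite inE; apply: contraNneq nx => <-.
Qed.

Lemma conf_card X s : conf X s -> #|X| = #|X0|.
Proof. by case=> _ _ _ _ _ [ms [/card_moves]]. Qed.

(** A discrepancy keeps the distance positive, so by [cf_log] the log has not yet reached its final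
    length and its counter cannot wrap. *)
Lemma conf_count X s w : conf X s -> w != b ->
  beyond X (leg w) (pos w) <> y (leg w) (pos w) -> vars s 46 + 1 < W.
Proof.
move=> [_ _ _ _ _ [ms [_ [-> _] sz]]] nwb neq; rewrite size_cat.
have : 0 < profile_dist (beyond X) y.
  rewrite /profile_dist (bigD1 w) //= addn_gt0; apply/orP; left.
  by rewrite /absd; lia.
by lia.
Qed.

Lemma conf_move X s x z w s' : conf X s -> layout s' -> arrs s' 27 = arrs s 27 ->
  e x z -> x \in X -> z \notin X -> independent e (move X x z) -> w != b ->
  let X' := move X x z in
  (forall k p, 0 < p -> beyond X' k p = beyond X k p + ((k == leg w) && (p == pos w))) /\
     beyond X (leg w) (pos w) < y (leg w) (pos w) \/
  (forall k p, 0 < p -> beyond X k p = beyond X' k p + ((k == leg w) && (p == pos w))) /\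
     y (leg w) (pos w) < beyond X (leg w) (pos w) ->
  arrs s' 25 = upd (upd (arrs s 25) x 0) z 1 ->
  arrs s' 26 = upd (arrs s 26) w (beyond X' (leg w) (pos w)) ->
  arrs s' 28 = upd (arrs s 28) (vars s 46) x -> arrs s' 29 = upd (arrs s 29) (vars s 46) z ->
  vars s' 46 = (vars s 46).+1 -> conf X' s'.
Proof.
move=> cf L' e27 exz xX zX iX' nwb X' chg e25 e26 e28 e29 e46.
have [L tgt tok bey ind [ms [mv lg sz]]] := cf; split=> //.
- by move=> v nvb; rewrite e27 tgt.
- move=> v; rewrite e25 /= !inE tok.
  rewrite -[v == z]/(val v == z) -[v == x]/(val v == x).
  by case: (val v == z) => //; case: (val v == x).
- move=> v nvb; rewrite e26 /=; case: eqVneq => [/ord_inj -> //|nvw].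
  have d0 : (leg v == leg w) && (pos v == pos w) = false.
    by apply: contraNF nvw => /andP [/eqP el /eqP ep]; rewrite (coord_inj C el ep).
  rewrite bey //; have pv := pos_gt0 C nvb.
  by case: chg => -[E _]; rewrite E // d0 addn0.
- exists (rcons ms (x, z)); split; first exact: moves_rcons.
    by rewrite -rcons_cat; apply: logged_rcons lg _ _ _.
  rewrite size_rcons; case: chg => -[E lt]; have := profile_dist_step C y nwb E;
    move: lt; rewrite E ?(pos_gt0 C) // !eqxx /absd /=; lia.
Qed.

(** The condition sits on the edge that a token on v would cross next: the one behind v here, the
    one towards the body in [in_done]. *)
Definition out_done (X : {set 'I_n}) v := y (leg v) (pos v).+1 <= beyond X (leg v) (pos v).+1.
Definition in_done (X : {set 'I_n}) v := beyond X (leg v) (pos v) <= y (leg v) (pos v).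

(** Counts rise, but never above the target. Hence growth creates no surplus and does not spoil
    [in_done]. *)
Definition grown (X X' : {set 'I_n}) := forall k p, 0 < p ->
  beyond X k p <= beyond X' k p /\
  (beyond X' k p = beyond X k p \/ beyond X' k p <= y k p).

Lemma grown_refl X : grown X X.
Proof. by move=> k p _; split=> //; left. Qed.

Lemma grown_trans X1 X2 X3 : grown X1 X2 -> grown X2 X3 -> grown X1 X3.
Proof.
move=> g1 g2 k p p0; have [l1 o1] := g1 k p p0; have [l2 o2] := g2 k p p0.
by split; [apply: leq_trans l1 l2 | case: o2 => [->|]; [|right]].
Qed.

Lemma pos_lt s v : layout s -> pos v < n.
Proof.
move=> L; suff H : forall m (u : 'I_n), index u q < m -> pos u <= index u q.
  have vq := lay_mem v L.
  apply: leq_ltn_trans (H _ _ (ltnSn _)) _; by rewrite -{2}(lay_size L) index_mem.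
elim=> // m IH u lt; case: (eqVneq u b) => [->|nub]; first by rewrite (pos_body C).
rewrite (pos_par C nub); have := lay_order L nub => lo.
by apply: leq_ltn_trans (lay_order L nub); apply: IH; lia.
Qed.

Lemma index_lt s u v : layout s -> u != b -> leg u = leg v -> pos u < pos v ->
  index u q < index v q.
Proof.
move=> L nub; have [m] := ubnP (pos v); elim: m v => // m IH v ltm el lt.
have nvb : v != b by rewrite -(pos_eq0 C); lia.
have p1 : pos v != 1 by have := pos_gt0 C nub; lia.
have [npb lp pp] := par_coord C nvb p1.
have := lay_order L nvb; case: (ltngtP (pos u) (pos (par v))) => [lt'|gt|eq']; last 1 first.
- by have <- : u = par v by apply: (coord_inj C); rewrite ?lp.
- by move=> lo; apply: ltn_trans lo; apply: IH; rewrite ?lp //; lia.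
- by lia.
Qed.

Definition next_vertex (k c : 'I_n) (m : nat) :=
  m = 0 /\ (forall w, w != b -> par w = c -> leg w != k) \/
  exists w : 'I_n, [/\ w != b, par w = c, leg w = k & m = w.+1].

(** The threshold h covers two uses. In the sweep it is the queue index of c0, so that only tokens
    treated before are assumed to be done; when the body is cleared, c0 is the body and h is 0. *)
Lemma slide_out_ok X1 c0 k h s : conf X1 s ->
  c0 \in X1 -> vars s 40 = c0 -> next_vertex k c0 (vars s 41) ->
  (c0 == b) || (leg c0 == k) -> h <= index c0 q ->
  (forall v, v \in X1 -> v != b -> v != c0 -> h <= index v q -> out_done X1 v) ->
  wp W slide_out (n * 50 + 50)
    (fun _ s' => exists X, [/\ conf X s', grown X1 X,
        forall v, v \in X -> v != b -> h <= index v q -> out_done X v,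
        (forall v, v \in X1 -> v != c0 -> v \in X) /\
        (forall v, v \in X -> v \in X1 \/ v != b /\ in_done X v) &
        c0 = b -> beyond X1 k 1 < y k 1 -> b \notin X]) s.
Proof.
move=> cf1 cX1 s40 s41 ck hc od1; rewrite /slide_out; budget (n * (30 + 3) + 3).
(* By the last clause n rounds suffice: the token has stopped or is at distance at least i from the
   body, and distances are below n. *)
pose Inv i s' := exists X (cur : 'I_n), [/\ [/\ conf X s', vars s' 40 = cur,
    next_vertex k cur (vars s' 41) & cur \in X],
  [/\ (cur == b) || (leg cur == k), h <= index cur q, pos c0 <= pos cur
    & if cur == c0 then X = X1 else c0 \notin X /\ cur \notin X1],
  grown X1 X /\ (forall v, v \in X -> v != b -> v != cur -> h <= index v q -> out_done X v),
  (forall v, v \in X1 -> v != c0 -> v \in X) /\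
        (forall v, v \in X -> v \in X1 \/ v != b /\ in_done X v)
  & y k (pos cur).+1 <= beyond X k (pos cur).+1 \/ i <= pos cur].
apply: (@wp_call _ _ (n * (30 + 3) + 3) 0).
- apply: (@wp_for _ _ _ _ _ n 30 Inv) => //; [exact: lay_n (cf_lay cf1)|exact: lay_one (cf_lay cf1)|lia| | |].
  + move=> i s' v w [X [cur [[cf v40 v41 cX] h1 h2 h3 h4]]]; exists X, cur; split=> //; split=> //.
    by do 2 apply: conf_set_var => //.
  + exists X1, c0; split=> //; last by right.
    * by rewrite eqxx.
    * by split=> //; apply: grown_refl.
    * by split=> // v; left.
  move=> i s1 _ _ [X [cur [[cf v40 v41 cX] [ckur hcur pc0 Xc] [gr od] [kp nw] prog]]].
  have L := cf_lay cf; have o1 := lay_one L.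
  have stop s' : conf X s' -> vars s' 40 = cur -> vars s' 41 = vars s1 41 ->
      y k (pos cur).+1 <= beyond X k (pos cur).+1 -> Inv i.+1 s'.
    by move=> cf' v40' v41' st; exists X, cur; split=> //; [split; rewrite ?v41' | left].
  step => m0; last first.
    step; apply: stop => //.
    case: v41 => [[_ no]|[w [_ _ _ Em]]]; last by rewrite Em in m0.
    (* The leg ends at [cur], and behind its end the target vanishes by [prof_van]. *)
    case: (posnP (y k (pos cur).+1)) => [-> //|/(prof_van py (ltn0Sn _)) [w [nwb lw pw]]].
    have pwc : par w = cur.
      case/orP: ckur => [/eqP cb|/eqP lc].
        by rewrite cb; apply: (par_body C) => //; rewrite pw cb (pos_body C).
      apply: (par_of_coord C) => //; rewrite ?lc ?lw //.
      by rewrite -lc in lw; apply: contraTneq nwb => cb; rewrite negbK;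
         apply: contraT => /(leg_nbody C) []; rewrite lw cb (leg_body C) eqxx.
    by move: (no _ nwb pwc); rewrite lw eqxx.
  case: v41 => [[]//|[w [nwb pw lw Em]]].
  have pwS : pos w = (pos cur).+1 by rewrite (pos_par C nwb) pw.
  step; rewrite Em o1 subn1 /=; step; rewrite (cf_bey cf) //; step; rewrite (cf_tgt cf) //.
  rewrite lw pwS; step => lt; last first.
    by step; apply: stop => //=; do 5 apply: conf_set_var => //.
  have lt' : beyond X (leg w) (pos w) < y (leg w) (pos w) by rewrite lw pwS.
  have [||wX iX'] := @slide_out_indep _ _ _ _ _ _ C X y w (cf_ind cf) py nwb _ lt'.
  - by rewrite pw.
  - move=> z zX nzb pz; apply: od => //.
      by apply: contraTneq nwb => zc; rewrite negbK -pz zc; have := pos_par C nzb; rewrite pz zc pwS; lia.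
    have lw1 := lay_order L nwb; have lz := lay_order L nzb; rewrite pw in lw1; rewrite pz in lz.
    exact: leq_trans hcur (ltnW (ltn_trans lw1 lz)).
  rewrite pw in iX'; set X' := move X cur w in iX'.
  have E' kk p : 0 < p -> beyond X' kk p = beyond X kk p + ((kk == leg w) && (p == pos w)).
    by move=> p0; apply: (beyond_out C).
  have cnt : vars s1 46 + 1 < W.
    by apply: conf_count cf nwb _; lia.
  have := @beyond_le n pos leg X k (pos cur).+1 => leB.
  rewrite /log_move; do 8 step.
  step; step; set sF := set_var _ 41 _.
  have LF : layout sF by case: L; split.
  have nwc0 : w != c0 by apply: contraTneq pc0 => <-; rewrite pwS -ltnNge.
  have XsubP v : v \in X' -> v != w -> v \in X /\ v != cur.
    by rewrite !inE => /orP [->//|/andP [-> ->]].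
  exists X', w; split.
  - split=> //; last by rewrite !inE eqxx.
      apply: (conf_move cf LF _ _ cX wX iX' nwb) => //=.
      + by rewrite -pw (edge_par C nwb).
      + by left.
      + by rewrite v40 o1.
      + by rewrite E' ?(pos_gt0 C) // !eqxx lw pwS o1.
      + by rewrite v40.
      + by rewrite o1 addn1.
    rewrite /=; case: (lay_child L nwb) => [[-> no]|[w' [nwb' pw' ->]]]; [left|right].
      by split=> // w' nwb' pw'; case/negP: (no _ nwb'); apply/eqP.
    by exists w'; split=> //; rewrite (leg_par C) // pw'.
  - split; first by rewrite lw eqxx orbT.
    + by apply: leq_trans hcur (ltnW _); rewrite -pw; apply: lay_order L _ nwb.
    + by rewrite pwS; lia.
    + rewrite (negPf nwc0); split.
        rewrite !inE [c0 == w]eq_sym (negPf nwc0) /=.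
        by case: (eqVneq cur c0) Xc => [<-|_ [/negPf -> _]]; rewrite ?eqxx ?andbF.
      by apply: contraNN wX => wX1; apply: kp.
  - split.
      apply: grown_trans gr _ => kk p p0; rewrite E' //; split; first exact: leq_addr.
      case: eqVneq => [->|_] /=; last by left; rewrite addn0.
      case: eqVneq => [->|_] /=; last by left; rewrite addn0.
      by right; rewrite addn1.
    move=> v vX' nvb nvw hv; have [vX nvc] := XsubP _ vX' nvw.
    by apply: leq_trans (od v vX nvb nvc hv) _; rewrite E' // leq_addr.
  - split=> v.
      move=> vX1 nv0; rewrite !inE (kp _ vX1 nv0) andbT; apply/orP; right.
      case: (eqVneq cur c0) Xc => [-> _|_ [_ ncX1]]; first exact: nv0.
      by apply: contraNneq ncX1 => <-.
    case: (eqVneq v w) => [-> _|nvw vX'].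
      by right; rewrite /in_done E' ?(pos_gt0 C) // !eqxx addn1.
    have [vX nvc] := XsubP _ vX' nvw; case: (nw _ vX) => [|[nvb di]]; [by left|right].
    split=> //; rewrite /in_done E' ?(pos_gt0 C) //.
    case: eqP => [el|_]; last by rewrite addn0.
    case: eqP => [ep|_]; last by rewrite addn0.
    by move: nvw; rewrite (coord_inj C el ep) eqxx.
  - by right; rewrite pwS; case: prog => [st|]; [move: lt; rewrite ltnNge st | rewrite ltnS].
- by lia.
move=> s' _ [X [cur [[cf v40 v41 cX] [ckur hcur pc0 Xc] [gr od] [kp nw] prog]]].
have st : y k (pos cur).+1 <= beyond X k (pos cur).+1.
  by case: prog => // le; have := pos_lt cur (cf_lay cf); rewrite ltnNge le.
exists X; split=> //.
  move=> v vX nvb hv; case: (eqVneq v cur) => [vc|nvc]; last exact: od.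
  rewrite /out_done vc; case/orP: ckur => [/eqP cb|/eqP -> //].
  by rewrite vc cb eqxx in nvb.
move=> c0b lt; case: (eqVneq cur c0) Xc => [cc0 EX|_ []]; last by rewrite c0b.
by move: st; rewrite EX cc0 c0b (pos_body C) leqNgt lt.
Qed.

(** Either the body stays empty and each leg already has its final number of tokens, or the target
    has free heads and a token on the body. In the second case the last clause keeps a token about
    to enter the body from meeting one on another head. *)
Definition sweep_mode (X : {set 'I_n}) :=
  b \notin X /\ (forall k, beyond X k 1 = y k 1) \/
  [/\ forall k, y k 1 = y k 2, #|X0| = (\sum_k y k 1).+1 &
      forall k1 k2, k1 != k2 -> beyond X k1 2 < beyond X k1 1 -> beyond X k2 1 <= y k2 1].

Lemma head_token (X : {set 'I_n}) k : beyond X k 2 < beyond X k 1 ->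
  exists v, [/\ v \in X, v != b, leg v = k & pos v = 1].
Proof.
move=> lt; have k0 : 0 < beyond X k 1 by apply: leq_ltn_trans lt.
have [v [nvb lv pv]] := beyond_van C (ltn0Sn 0) k0; exists v; split=> //.
by rewrite (head_memE C) ?lv //; apply: (par_body C).
Qed.

Lemma slide_in_ok X1 x s : conf X1 s -> x \in X1 -> x != b -> vars s 40 = x ->
  (forall v, v \in X1 -> v != b -> out_done X1 v) ->
  (forall v, v \in X1 -> v != b -> v != x -> index v q <= index x q -> in_done X1 v) ->
  sweep_mode X1 -> (y (leg x) 1 < beyond X1 (leg x) 1 -> b \notin X1) ->
  wp W slide_in (n * 50 + 50)
    (fun _ s' => exists X, [/\ conf X s', forall v, v \in X -> v != b -> out_done X v,
        forall v, v \in X -> v != b -> index v q <= index x q -> in_done X v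
        & sweep_mode X]) s.
Proof.
move=> cf1 xX1 nxb s40 od1 id1 md1 bX1; rewrite /slide_in; budget (n * (30 + 3) + 3).
set k := leg x in bX1.
pose Inv i s' := exists X (cur : 'I_n), [/\ [/\ conf X s', vars s' 40 = cur, cur \in X
    & cur = b \/ [/\ cur != b, leg cur = k & index cur q <= index x q]],
  forall v, v \in X -> v != b -> out_done X v,
  forall v, v \in X -> v != b -> v != cur -> index v q <= index x q -> in_done X v,
  [/\ forall kk p, 0 < p -> beyond X kk p <= beyond X1 kk p /\
        (beyond X kk p = beyond X1 kk p \/ y kk p <= beyond X kk p),
      forall kk p, kk != k -> 0 < p -> beyond X kk p = beyond X1 kk p,
      cur != b -> beyond X k 1 = beyond X1 k 1 /\ (b \in X -> b \in X1)
    & cur = b -> y k 1 < beyond X1 k 1]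
  & [\/ cur = b, in_done X cur | i + pos cur <= pos x]].
apply: (@wp_call _ _ (n * (30 + 3) + 3) 0).
- apply: (@wp_for _ _ _ _ _ n 30 Inv) => //; [exact: lay_n (cf_lay cf1)|exact: lay_one (cf_lay cf1)|lia| | |].
  + move=> i s' v w [X [cur [[cf v40 cX cb] h1 h2 h3 h4]]]; exists X, cur; split=> //; split=> //.
    by do 2 apply: conf_set_var => //.
  + exists X1, x; split=> //; last by constructor 3.
    * by split=> //; right.
    * by split=> // [kk p p0|xb]; [split=> //; left | rewrite xb eqxx in nxb].
  move=> i s1 _ _ [X [cur [[cf v40 cX cb] od id [sh fr hd bd] prog]]].
  have L := cf_lay cf; have o1 := lay_one L.
  have stop s' : conf X s' -> vars s' 40 = cur -> cur = b \/ in_done X cur -> Inv i.+1 s'.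
    by move=> cf' v40' st; exists X, cur; split=> //; case: st; [constructor 1 | constructor 2].
  step; rewrite v40 (lay_body L) => cbE u1 u2 u3.
    step; apply: stop => //=; last by left; apply: ord_inj.
    by do 3 apply: conf_set_var => //.
  have ncb : cur != b by apply: contra_notN cbE => /eqP ->.
  case: cb => [cb|[_ lc ic]]; first by rewrite cb eqxx in ncb.
  have [h1 hb] := hd ncb.
  step; rewrite v40 (cf_bey cf) //; step; rewrite v40 (cf_tgt cf) //; step => lt; last first.
    by step; apply: stop; [do 6 apply: conf_set_var => // | | right].
  set u := par cur.
  have [|||uX iX'] := @slide_in_indep _ _ _ _ _ _ C X y cur (cf_ind cf) py ncb cX lt.
  - move=> z zX nzb lz pz; apply: id => //.
      by apply: contraTneq pz => ->; rewrite ltnn.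
    by apply: leq_trans (ltnW _) ic; apply: index_lt L nzb lz pz.
  - rewrite lc => bX; case: md1 => [[nb _]|[y12 _ _]]; first by rewrite (hb bX) in nb.
    split=> //; rewrite h1 leqNgt; apply/negP => /bX1; by rewrite hb.
  (* A token on another head z would, by the last clause of [sweep_mode], rule out the surplus of
     leg k. *)
  - move=> pc z zX nzb pz; apply/eqP; apply: contraT => nzc.
    have lz := leg_pos1 C pz; rewrite lc pc h1 in lt.
    case: md1 => [[_ eqk]|[_ _ gam]]; first by rewrite eqk ltnn in lt.
    have nzk : z != k by apply: contraNneq nzc => zk; apply/eqP/(coord_inj C); rewrite ?lz ?lc ?pz.
    have := zX; rewrite (head_memE C X nzb (par_body C nzb pz)) lz !fr // => hz.
    by move: lt; rewrite ltnNge (gam z).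
  rewrite -/u in uX iX'; set X' := move X cur u in iX'.
  have E' kk p : 0 < p -> beyond X kk p = beyond X' kk p + ((kk == leg cur) && (p == pos cur)).
    by move=> p0; apply: (beyond_in C).
  have cnt : vars s1 46 + 1 < W by apply: conf_count cf ncb _; lia.
  rewrite /log_move; do 10 step; set sF := set_var _ 40 _.
  have LF : layout sF by case: L; split.
  have Ecur : beyond X k (pos cur) = (beyond X' k (pos cur)).+1.
    by rewrite E' ?(pos_gt0 C) // lc !eqxx addn1.
  rewrite lc in lt.
  have le' kk p : 0 < p -> beyond X' kk p <= beyond X kk p by move=> p0; rewrite E' // leq_addr.
  have ge' kk p : 0 < p -> beyond X' kk p = beyond X kk p \/ y kk p <= beyond X' kk p.
    move=> p0; rewrite E' //; case: eqP => [->|_] /=; last by left; rewrite addn0.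
    case: eqP => [->|_] /=; last by left; rewrite addn0.
    by right; rewrite lc; lia.
  have pcu := pos_par C ncb; rewrite -/u in pcu.
  have XsubP v : v \in X' -> v != u -> v \in X /\ v != cur.
    by rewrite !inE => /orP [->//|/andP [-> ->]].
  have par_cur : arrs s1 6 cur = u by apply: lay_par L _ ncb.
  exists X', u; split.
  - split=> //.
    + apply: (conf_move cf LF _ _ cX uX iX' ncb) => //=.
      * by rewrite (edge_sym C) (edge_par C ncb).
      * by right; split=> //; rewrite lc.
      * by rewrite v40 o1 par_cur.
      * by rewrite v40 o1 lc Ecur subn1.
      * by rewrite v40.
      * by rewrite v40 par_cur.
      * by rewrite o1 addn1.
    + by rewrite /= v40.
    + by rewrite !inE eqxx.
    + case: (eqVneq u b) => [|nub]; [by left|right]; split=> //.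
        by rewrite -lc (leg_par C ncb nub).
      by apply: leq_trans (ltnW (lay_order L ncb)) ic.
  - move=> v vX' nvb; rewrite /out_done; case: (eqVneq v u) => [vu|nvu].
      rewrite vu in nvb *; rewrite -pcu -(leg_par C ncb nvb) lc; lia.
    have [vX _] := XsubP _ vX' nvu; have := od v vX nvb; rewrite /out_done.
    by case: (ge' (leg v) (pos v).+1 isT) => [->|].
  - move=> v vX' nvb nvu iv; have [vX nvc] := XsubP _ vX' nvu.
    by apply: leq_trans (id v vX nvb nvc iv); apply/le'/(pos_gt0 C).
  - split=> [kk p p0|kk p nkk p0|nub|ub].
    + have := sh kk p p0; have := le' kk p p0; have := ge' kk p p0; lia.
    + by rewrite -fr // E' // lc (negPf nkk) addn0.
    + rewrite -h1 E' // lc eqxx pcu [1 == _]eq_sym eqSS (pos_eq0 C) (negPf nub) addn0.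
      by split=> //; rewrite !inE eq_sym (negPf nub) /= => /andP [_ /hb].
    + rewrite ub (pos_body C) in pcu; rewrite pcu in lt; by rewrite -h1.
  - case: prog => [cb|di|le]; first by rewrite cb eqxx in ncb.
      by move: di; rewrite /in_done lc leqNgt lt.
    by constructor 3; lia.
- by lia.
move=> s' _ [X [cur [[cf v40 cX cb] od id [sh fr hd bd] prog]]].
have L := cf_lay cf; exists X.
have idX v : v \in X -> v != b -> index v q <= index x q -> in_done X v.
  move=> vX nvb iv; case: (eqVneq v cur) => [vc|nvc]; last exact: id.
  case: prog => [cb'|di|le]; first by rewrite vc cb' eqxx in nvb.
    by rewrite vc.
  by have := pos_lt x L; lia.
split=> //; case: md1 => [[nb eqk]|[y12 cX0 gam]]; [left|right].
  (* No leg has a surplus in this mode, so no token is sent to the body. *)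
  have ncb : cur != b by apply/eqP => /bd; rewrite eqk ltnn.
  split; first by apply: contraNN nb; case: (hd ncb).
  move=> kk; case: (eqVneq kk k) => [->|nkk]; last by rewrite fr.
  by rewrite -eqk; case: (hd ncb).
split=> // k1 k2 nk hd1; case: (eqVneq k1 k) => [k1k|nk1].
  (* A token left on the head of leg k would be done in both directions. Then the count at 1 is at
     most [y k 1], the count at 2 at least [y k 2], and these targets are equal. *)
  have [v [vX nvb lv pv]] := head_token hd1.
  have iv : index v q <= index x q.
    case: (eqVneq (pos x) 1) => [px|npx].
      by have -> : v = x by apply: (coord_inj C); rewrite ?lv ?pv.
    apply: ltnW; apply: (index_lt L nvb); first by rewrite lv.
    by have := pos_gt0 C nxb; rewrite pv; lia.
  have := idX v vX nvb iv; have := od v vX nvb; rewrite /in_done /out_done lv pv.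
  by move: hd1 (y12 k1); lia.
rewrite !fr // in hd1; apply: leq_trans (gam _ _ nk hd1).
by case: (sh k2 1 isT).
Qed.
End Sweeps.

(** * The outward and the inward sweep *)

Section TransportSweeps.
Variables (n : nat) (e : rel 'I_n) (b : 'I_n) (par : 'I_n -> 'I_n).
Variables (pos : 'I_n -> nat) (leg : 'I_n -> 'I_n) (q : seq 'I_n) (W : nat).
Hypothesis HW : 100 * (n * n) + 100 * n + 100 < W.
Hypothesis C : spider_coords e b par pos leg.
Local Notation beyond := (beyond pos leg).
Local Notation layout := (layout b par pos leg q).
Local Notation profile_dist := (profile_dist b pos leg).
Variables (y : 'I_n -> nat -> nat) (X0 : {set 'I_n}) (ms0 : seq ('I_n * 'I_n)).
Hypothesis py : profile b pos leg y.
Hypothesis HL : size ms0 + profile_dist (beyond X0) y < W.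
Local Notation conf := (conf e b par pos leg q y X0 ms0).
Local Notation grown := (grown pos leg y).
Local Notation sweep_mode := (sweep_mode b pos leg y X0).

Lemma lay_index s h v : layout s -> index v q = h -> v = nth b q h.
Proof. by move=> L <-; rewrite nth_index // (lay_mem v L). Qed.

Lemma lay_index_lt s v : layout s -> index v q < n.
Proof. by move=> L; have := lay_mem v L; rewrite -index_mem (lay_size L). Qed.

Lemma out_sweep_ok s : conf X0 s ->
  wp W out_sweep (n * (n * 50 + 100) + 50)
    (fun _ s' => exists X, [/\ conf X s', grown X0 X,
       forall v, v \in X -> v != b -> out_done pos leg y X v & (b \in X) = (b \in X0)]) s.
Proof.
move=> cf0; rewrite /out_sweep; budget (n * (n * 50 + 80 + 3) + 3).
pose Inv i s' := exists X, [/\ conf X s', grown X0 X,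
  forall v, v \in X -> v != b -> n - i <= index v q -> out_done pos leg y X v & (b \in X) = (b \in X0)].
apply: (@wp_call _ _ (n * (n * 50 + 80 + 3) + 3) 0).
- apply: (@wp_for _ _ _ _ _ n (n * 50 + 80) Inv) => //; [exact: lay_n (cf_lay cf0)|exact: lay_one (cf_lay cf0)|lia| | |].
  + by move=> i s' v w [X [cf ? ? ?]]; exists X; split=> //; do 2 apply: conf_set_var => //.
  + exists X0; split=> //; first exact: grown_refl.
    by move=> v _ _; rewrite subn0 leqNgt (lay_index_lt v (cf_lay cf0)).
  move=> i s1 _ vi [X [cf gr od bE]]; have L := cf_lay cf.
  have hn : n - 1 - i < n by have := ltn_ord i; lia.
  set h := n - 1 - i in hn; have hi : n - i.+1 = h by rewrite /h; lia.
  set x := nth b q h.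
  have Ex : arrs s1 4 h = x by apply: lay_queue L _ hn.
  have ix : index x q = h by rewrite index_uniq ?(lay_size L) ?(lay_uniq L).
  have od' v : v \in X -> v != b -> v != x -> h <= index v q -> out_done pos leg y X v.
    move=> vX nvb nvx; rewrite leq_eqVlt => /orP [/eqP hv|hv].
      by rewrite /x (lay_index L (esym hv)) hv eqxx in nvx.
    by apply: od => //; have := ltn_ord i; rewrite /h in hv; lia.
  budget (n * 50 + 50).+4.+4.+4.
  step; step; step; rewrite (lay_n L) (lay_one L) vi Ex.
  step; rewrite (lay_body L) => xb u1 u2 u3.
    step; exists X; split=> //; first by do 7 apply: conf_set_var => //.
    move=> v vX nvb; rewrite hi; apply: od' => //.
    by apply: contraNneq nvb => ->; apply/eqP/ord_inj.
  have nxb : x != b by apply: contra_notN xb => /eqP ->.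
  step; rewrite (cf_tok cf); step => xX; last first.
    step; exists X; split=> //; first by do 8 apply: conf_set_var => //.
    move=> v vX nvb; rewrite hi; apply: od' => //.
    by apply: contraTneq vX => ->; move: xX; case: (x \in X).
  have {}xX : x \in X by move: xX; case: (x \in X).
  step; step; set s2 := set_var _ 41 _.
  have cf2 : conf X s2 by do 10 apply: conf_set_var => //.
  apply: (@wp_call _ _ (n * 50 + 50) 0).
  + apply: (slide_out_ok HW C py HL (c0 := x) (k := leg x) (h := h) cf2) => //.
    * have -> : vars s2 41 = arrs s1 9 x by [].
      case: (lay_child L nxb) => [[-> no]|[w [nwb pw ->]]]; [left|right].
        by split=> // w nwb pw; case/negP: (no _ nwb); apply/eqP.
      by exists w; split=> //; rewrite (leg_par C) // pw.
    * by rewrite eqxx orbT.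
    * by rewrite ix.
  + by lia.
  move=> s3 _ [X' [cf' gr' odX' [kp nw] _]]; exists X'; split=> //.
  + exact: (grown_trans gr gr').
  + by move=> v vX nvb; rewrite hi; apply: odX'.
  + rewrite -bE; apply/idP/idP => [/nw [//|[]]|bX]; first by rewrite eqxx.
    by apply: kp; rewrite // eq_sym.
- by lia.
move=> s' _ [X [cf gr od bE]]; exists X; split=> // v vX nvb; apply: od => //.
by rewrite subnn.
Qed.

Lemma find_deficit_ok X s : conf X s -> (exists k, beyond X k 1 < y k 1) ->
  wp W find_deficit (n * 50 + 50)
    (fun _ s' => exists K : 'I_n, [/\ vars s' 53 = K, K != b, leg K = K
       & beyond X K 1 < y K 1]) s.
Proof.
move=> cf0 [k0 def0]; rewrite /find_deficit; budget (n * (30 + 3) + 3).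
pose def v := [&& v != b, leg v == v & beyond X v 1 < y v 1].
pose Inv i s' := (exists2 v : 'I_n, v < i & def v) -> exists2 K, vars s' 53 = nat_of_ord K & def K.
have L := cf_lay cf0.
apply: (@wp_call _ _ (n * (30 + 3) + 3) 0).
- apply: (@wp_for _ _ _ _ _ n 30 Inv) => //; [exact: lay_n L|exact: lay_one L|lia| |].
    by case.
  move=> v s1 fr v1 H1.
  have cf : conf X s1 by apply: conf_frame cf0 fr _ _.
  have L1 := cf_lay cf.
  have next s' : vars s' 53 = vars s1 53 -> ~~ def v -> Inv v.+1 s'.
    move=> e53 ndv [w]; rewrite ltnS leq_eqVlt => /orP [/eqP/ord_inj ->|wv dw].
      by rewrite (negPf ndv).
    by rewrite e53; apply: H1; exists w.
  step; rewrite v1 (lay_body L1) => vb u1 u2 u3.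
    by step; apply: next; rewrite // /def (ord_inj vb) eqxx.
  have nvb : v != b by apply: contra_notN vb => /eqP ->.
  step; rewrite v1 (lay_leg L1); step; rewrite v1 => lv w1 w2 w3; last first.
    step; apply: next; rewrite // /def nvb /=; case: eqP => // lv'.
    by case: lv; rewrite lv'.
  have {}lv : leg v = v by apply: ord_inj.
  have pv : pos v = 1 by rewrite -{1}lv; case: (leg_nbody C nvb).
  step; rewrite v1 (cf_bey cf) //; step; rewrite v1 (cf_tgt cf) // lv pv.
  step => cmp; step; last by apply: next; rewrite // /def nvb lv eqxx /= -leqNgt.
  by move=> _; exists v; rewrite //= /def nvb lv eqxx.
- by lia.
move=> s' _ H'.
have [k [nkb lk pk]] := prof_van py (ltn0Sn 0) (leq_ltn_trans (leq0n _) def0).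
have [|K v53 /and3P [nKb /eqP lK dK]] := H'; last by exists K.
have kk0 : k = k0 by rewrite -lk (leg_pos1 C pk).
rewrite -kk0 in lk def0.
by exists k; rewrite ?ltn_ord // /def nkb lk eqxx.
Qed.

(** The target has an empty head, so a token on the head that need not go outwards is one too many
    in its leg. *)
Lemma occupied_head_surplus (X : {set 'I_n}) k : (forall k, y k 1 = y k 2) ->
  (forall v, v \in X -> v != b -> out_done pos leg y X v) ->
  beyond X k 2 < beyond X k 1 -> y k 1 < beyond X k 1.
Proof.
move=> y12 od hd; have [v [vX nvb lv pv]] := head_token C hd.
have := od v vX nvb; rewrite /out_done lv pv; have := y12 k.
by move: hd; lia.
Qed.

Lemma push_body_ok X k s : conf X s -> b \in X -> y k 1 < beyond X k 1 ->
  (forall v, v \in X -> v != b -> out_done pos leg y X v) -> sweep_mode X ->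
  wp W push_body (n * 100 + 200)
    (fun _ s' => exists X1, [/\ conf X1 s', forall v, v \in X1 -> v != b -> out_done pos leg y X1 v,
       forall v, v \in X1 -> v != b -> in_done pos leg y X1 v \/ v \in X /\ ~~ in_done pos leg y X v,
       sweep_mode X1 & (forall v, v \in X -> v != b -> v \in X1) /\ b \notin X1]) s.
Proof.
move=> cf bX sk od [[nb _]|[y12 cX0 gam]]; first by rewrite bX in nb.
rewrite /push_body; budget (n * 50 + 50 + (n * 50 + 50 + 0).+2).
have L := cf_lay cf; apply: wp_seq; apply: (@wp_call _ _ (n * 50 + 50) (n * 50 + 50 + 0).+2).
- apply: (find_deficit_ok cf).
  case: (pickP (fun k => beyond X k 1 < y k 1)) => [K dK|no]; first by exists K.
  (* With one token on the body the legs together hold as many tokens as the target asks for, so the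
     surplus of leg k forces a deficit elsewhere. *)
  have : \sum_k y k 1 < \sum_k beyond X k 1.
    rewrite (bigD1 k) //= [ltnRHS](bigD1 k) //= -addSn leq_add //.
    by apply: leq_sum => k' _; rewrite leqNgt no.
  by have := card_beyond C X; rewrite (conf_card cf) cX0 bX; lia.
- by lia.
move=> s1 fr1 [K [v53 nKb lK dK]].
have cf1 : conf X s1 by apply: conf_frame cf fr1 _ _.
have L1 := cf_lay cf1; have o1 := lay_one L1.
have KW := ltn_ord K; step; step; set s2 := set_var _ 41 _.
have cf2 : conf X s2 by do 2 apply: conf_set_var => //.
apply: (@wp_call _ _ (n * 50 + 50) 0).
- apply: (slide_out_ok HW C py HL (c0 := b) (k := K) (h := 0) cf2) => //.
  + by rewrite /= (lay_body L1).
  + have pK : pos K = 1 by rewrite -{1}lK; case: (leg_nbody C nKb).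
    right; exists K; split=> //; first exact: (par_body C).
    by rewrite /= v53 o1 addn1.
  + by rewrite eqxx.
  + by move=> v vX nvb _ _; apply: od.
- by lia.
move=> s3 _ [X1 [cf3 gr odX [kp nw] nb]]; exists X1; split=> //.
- by move=> v vX nvb; apply: odX.
- move=> v vX nvb; case: (nw v vX) => [vX'|[_ ?]]; last by left.
  case: (boolP (in_done pos leg y X v)) => d; last by right.
  left; rewrite /in_done; move: d; rewrite /in_done.
  by case: (gr (leg v) (pos v) (pos_gt0 C nvb)) => _ [->|].
(* An occupied head means a surplus, and growth creates none. So this head was occupied in X
   already, and the clause for X applies. *)
- right; split=> // k1 k2 nk hd.
  have odX1 v : v \in X1 -> v != b -> out_done pos leg y X1 v by move=> vX nvb; apply: odX.
  have s1k := occupied_head_surplus y12 odX1 hd.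
  have [g1 g1'] := gr k1 1 isT; have [g2 _] := gr k1 2 isT.
  have := gam k1 k2 nk; have [_ g3] := gr k2 1 isT.
  by move=> /(_ _) gm; have : beyond X k2 1 <= y k2 1; [apply: gm; lia | lia].
- by split; last exact: nb.
Qed.

Lemma in_sweep_ok X s : conf X s ->
  (forall v, v \in X -> v != b -> out_done pos leg y X v) -> sweep_mode X ->
  wp W in_sweep (n * (n * 200 + 400) + 50)
    (fun _ s' => exists X1, [/\ conf X1 s', forall v, v \in X1 -> v != b -> out_done pos leg y X1 v,
       forall v, v \in X1 -> v != b -> in_done pos leg y X1 v & sweep_mode X1]) s.
Proof.
move=> cf0 od0 md0; rewrite /in_sweep; budget (n * (n * 150 + 300 + 3) + 3).
pose Inv i s' := exists X, [/\ conf X s', forall v, v \in X -> v != b -> out_done pos leg y X v,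
  forall v, v \in X -> v != b -> index v q < i -> in_done pos leg y X v & sweep_mode X].
apply: (@wp_call _ _ (n * (n * 150 + 300 + 3) + 3) 0).
- apply: (@wp_for _ _ _ _ _ n (n * 150 + 300) Inv) => //; [exact: lay_n (cf_lay cf0)|exact: lay_one (cf_lay cf0)|lia| | |].
  + by move=> i s' v w [Y [cf ? ? ?]]; exists Y; split=> //; do 2 apply: conf_set_var => //.
  + by exists X.
  move=> h s1 _ vh [Y [cf od id md]]; have L := cf_lay cf.
  set x := nth b q h; have Ex : arrs s1 4 h = x by apply: lay_queue L _ (ltn_ord h).
  have ix : index x q = h by rewrite index_uniq ?(lay_size L) ?(lay_uniq L).
  have id' (Z : {set 'I_n}) v : (forall v, v \in Z -> v != b -> index v q < h -> in_done pos leg y Z v) ->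
      v \in Z -> v != b -> v != x -> index v q <= h -> in_done pos leg y Z v.
    move=> idZ vZ nvb nvx; rewrite leq_eqVlt => /orP [/eqP hv|hv]; last exact: idZ.
    by rewrite /x -(lay_index L hv) eqxx in nvx.
  budget (n * 100 + 200 + (n * 50 + 50 + 10)).+4.+4.+4.+4.+4.
  step; rewrite vh Ex; step; rewrite (lay_body L) => xb u1 u2 u3.
    step; exists Y; split=> //; first by do 4 apply: conf_set_var => //.
    move=> v vY nvb hv; apply: id' => //.
    by apply: contraNneq nvb => ->; apply/eqP/ord_inj.
  have nxb : x != b by apply: contra_notN xb => /eqP ->.
  step; rewrite (cf_tok cf); step => xY; last first.
    step; exists Y; split=> //; first by do 5 apply: conf_set_var => //.
    move=> v vY nvb hv; apply: id' => //.
    by apply: contraTneq vY => ->; move: xY; case: (x \in Y).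
  have {}xY : x \in Y by move: xY; case: (x \in Y).
  have [nlb plx llx] := leg_nbody C nxb.
  step; rewrite (lay_leg L); step; rewrite (cf_bey cf) // llx plx.
  step; rewrite (cf_tgt cf) // llx plx.
  set s2 := set_var _ 52 _; have cf2 : conf Y s2 by do 8 apply: conf_set_var => //.
  have fin (Z : {set 'I_n}) t3 : conf Z t3 -> vars t3 48 = x -> x \in Z ->
      (forall v, v \in Z -> v != b -> out_done pos leg y Z v) ->
      (forall v, v \in Z -> v != b -> index v q < h -> in_done pos leg y Z v) -> sweep_mode Z ->
      (y (leg x) 1 < beyond Z (leg x) 1 -> b \notin Z) ->
      wp W (Copy 40 48;; slide_in) (n * 50 + 50 + 1) (fun=> Inv h.+1) t3.
    move=> cfZ v48 xZ odZ idZ mdZ bZ; budget (n * 50 + 50 + 0).+1; step.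
    apply: (@wp_call _ _ (n * 50 + 50) 0).
    + have cfZ2 : conf Z (set_var t3 40 (vars t3 48)) by apply: conf_set_var.
      apply: (slide_in_ok HW C py HL (x := x) cfZ2) => //.
      by rewrite ix => v vZ nvb nvx iv; apply: id'.
    + by lia.
    move=> s4 _ [Z' [cfZ' odZ' idZ' mdZ']]; exists Z'; split=> // v vZ nvb iv.
    by apply: idZ' => //; rewrite ix.
  apply: wp_seq; apply: wp_iflt => /= cmp; last first.
    step; apply: (wp_weaken (fin Y _ _ _ _ _ _ _ _)) => //; last by lia.
      by do 1 apply: conf_set_var => //.
    by rewrite ltnNge cmp.
  step; rewrite (lay_body L) (cf_tok cf); step => bY; last first.
    step; apply: (wp_weaken (fin Y _ _ _ _ _ _ _ _)) => //; last by lia.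
      by do 2 apply: conf_set_var => //.
    by move=> _; move: bY; case: (b \in Y).
  have {}bY : b \in Y by move: bY; case: (b \in Y).
  set s3 := set_var _ 49 _; have cf3 : conf Y s3 by do 2 apply: conf_set_var => //.
  apply: (@wp_call _ _ (n * 100 + 200) (n * 50 + 50 + 10)).
  + exact: push_body_ok cf3 bY cmp od md.
  + by lia.
  move=> s4 [fv4 _ _] [Z [cfZ odZ idZ mdZ [kp nb]]].
  apply: (wp_weaken (fin Z _ _ _ _ _ _ _ _)) => //; last by lia.
  + by rewrite fv4.
  + exact: kp.
  + move=> v vZ nvb iv; case: (idZ v vZ nvb) => // -[vY]; by rewrite id.
- by lia.
move=> s' _ [Z [cf od id md]]; exists Z; split=> // v vZ nvb; apply: id => //.
exact: lay_index_lt (cf_lay cf).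
Qed.

(** Tokens on the body and on a head exclude each other. So either no head is occupied at the start,
    or the body is empty and a surplus in a single leg keeps the heads from conflicting. *)
Definition transportable :=
  b \notin X0 /\ (forall k, beyond X0 k 1 = y k 1) \/
  [/\ forall k, y k 1 = y k 2, #|X0| = (\sum_k y k 1).+1 &
      b \in X0 \/ exists i, forall k, k != i -> beyond X0 k 1 <= y k 1].

Lemma transport_ok s : conf X0 s -> transportable ->
  wp W transport (n * (n * 250 + 500) + 100)
    (fun _ s' => exists X, conf X s' /\
       forall v, v != b -> beyond X (leg v) (pos v) = y (leg v) (pos v)) s.
Proof.
move=> cf0 md0; rewrite /transport.
budget (n * (n * 50 + 100) + 50 + (n * (n * 200 + 400) + 50 + 0)); apply: wp_seq.
apply: (@wp_call _ _ (n * (n * 50 + 100) + 50) (n * (n * 200 + 400) + 50 + 0)).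
- exact: out_sweep_ok.
- by lia.
move=> s1 _ [X1 [cf1 gr od bE]].
have md1 : sweep_mode X1.
  case: md0 => [[nb eqk]|[y12 cX0 ini]]; [left|right].
    split; first by rewrite bE.
    by move=> k; have := gr k 1 isT; rewrite eqk; lia.
  split=> // k1 k2 nk hd; case: ini => [bX0|[i ini]].
    by move: hd; rewrite (head_free C k1 (cf_ind cf1)) ?ltnn // bE.
  have s1k := occupied_head_surplus y12 od hd.
  have k1i : k1 = i.
    apply/eqP; apply: contraT => /ini; have := gr k1 1 isT; lia.
  have := ini k2; rewrite -k1i eq_sym nk => /(_ isT).
  by have := gr k2 1 isT; lia.
apply: (@wp_call _ _ (n * (n * 200 + 400) + 50) 0).
- exact: in_sweep_ok cf1 od md1.
- by lia.
move=> s2 _ [X [cf odX idX md]]; exists X; split=> // v nvb.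
have le k p : 0 < p -> beyond X k p <= y k p.
  by move=> p0; apply: (in_done_le C k py idX p0).
(* No leg has more tokens than the target, and the body takes at most the one token that the target
   leaves over, so no leg has fewer. *)
have ge1 k : y k 1 <= beyond X k 1.
  case: md => [[_ ->//]|[_ cX0 _]]; rewrite leqNgt; apply/negP => lt.
  have : \sum_k beyond X k 1 < \sum_k y k 1.
    rewrite (bigD1 k) //= [ltnRHS](bigD1 k) //= -addSn leq_add //.
    by apply: leq_sum => k' _; apply: le.
  by have := card_beyond C X; rewrite (conf_card cf) cX0; case: (b \in X); lia.
apply/eqP; rewrite eqn_leq le ?(pos_gt0 C) //=.
exact: (out_done_ge C py odX (ge1 _) (pos_gt0 C nvb)).
Qed.

End TransportSweeps.

(** * Optimality and output *)

Section MoveSequences.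
Variables (T : finType) (e : rel T).
Hypothesis sym_e : symmetric e.

Lemma moves_cat X ms Y ms' Z : moves e X ms Y -> moves e Y ms' Z -> moves e X (ms ++ ms') Z.
Proof.
move=> m1; elim=> [|{}ms' {}Z x y _ IH exy xZ yZ iZ]; first by rewrite cats0.
by rewrite -rcons_cat; apply: moves_rcons.
Qed.

Definition swap (m : T * T) := (m.2, m.1).

Lemma moves_rev X ms Y : independent e X -> moves e X ms Y -> moves e Y (rev (map swap ms)) X.
Proof.
move=> iX; elim=> [|{}ms {}Y x y m IH exy xY yY iY']; first exact: moves_nil.
have nyx : y != x by apply: contraNneq yY => ->.
rewrite map_rcons rev_rcons -cat1s; apply: moves_cat IH.
have back : move (move Y x y) y x = Y.
  apply/setP => z; rewrite !inE; case: (eqVneq z x) => [->|_] //=.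
  by case: (eqVneq z y) => [->|_] //=; rewrite (negPf yY).
rewrite -[X in moves e _ _ X]back; apply: (@moves_rcons _ _ _ [::]).
- exact: moves_nil.
- by rewrite sym_e.
- by rewrite !inE eqxx.
- by rewrite !inE eqxx eq_sym (negPf nyx).
- by rewrite back; apply: moves_indep iX m.
Qed.

Lemma moves_TS X ms Y : independent e X -> moves e X ms Y ->
  exists S, TS_sequence e X Y S /\ slides_of e S ms.
Proof.
move=> iX; elim=> [|{}ms {}Y x y m [S [[S0 [SX SY] Si Sc Sl] [sz sl]]] exy xY yY iY'].
  by exists [:: X]; split; split=> // A; rewrite inE => /eqP ->.
rewrite /TS_length in sz; have szS : size S = (size ms).+1 by rewrite sz prednK.
have nthS i : i < size S -> nth set0 (rcons S (move Y x y)) i = nth set0 S i.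
  by move=> iS; rewrite nth_rcons iS.
have nthl : nth set0 (rcons S (move Y x y)) (size S) = move Y x y.
  by rewrite nth_rcons ltnn eqxx.
have lastY : nth set0 S (size ms) = Y by rewrite -SY szS.
have slY : slide e Y (move Y x y) x y by apply: move_slide.
exists (rcons S (move Y x y)); split; split; rewrite ?size_rcons //.
- by rewrite nthS.
- by move=> A; rewrite mem_rcons inE => /orP [/eqP ->//|/Si].
- move=> A; rewrite mem_rcons inE => /orP [/eqP ->|/Sc //].
  by rewrite card_move // (card_moves m).
- move=> i; rewrite ltnS leq_eqVlt => /orP [/eqP iS|iS].
    exists x, y; rewrite iS nthl nthS; last by rewrite -iS.
    by have -> : i = size ms; [apply/eqP; rewrite -eqSS iS szS | rewrite lastY].
  by rewrite !nthS //; [apply: Sl | apply: ltnW].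
- by rewrite /TS_length size_rcons /= szS.
- move=> i m0; rewrite ltnS leq_eqVlt [nth m0 _ _]nth_rcons => /orP [/eqP ->|lt].
    by rewrite ltnn eqxx -szS nthl nthS ?szS // lastY.
  by rewrite lt !nthS ?szS ?ltnS //; [apply: sl | apply: ltnW].
Qed.

End MoveSequences.

(** * The direct route and the detour as pairs of targets *)

Section Plan.
Variables (n : nat) (e : rel 'I_n) (b : 'I_n) (par : 'I_n -> 'I_n).
Variables (pos : 'I_n -> nat) (leg : 'I_n -> 'I_n).
Hypothesis C : spider_coords e b par pos leg.
Local Notation beyond := (beyond pos leg).
Local Notation profile := (profile b pos leg).
Local Notation profile_dist := (profile_dist b pos leg).
Local Notation exit_valid := (exit_valid pos leg).
Local Notation transportable := (transportable b pos leg).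

Definition realizes (X : {set 'I_n}) (y : 'I_n -> nat -> nat) :=
  forall v, v != b -> beyond X (leg v) (pos v) = y (leg v) (pos v).

(** The first transport ends in a set known only by its counts and its size, hence the form of
    [plan_second]. *)
Record plan (I J : {set 'I_n}) (yI yJ : 'I_n -> nat -> nat) : Prop := Plan {
  plan_profI : profile yI;
  plan_profJ : profile yJ;
  plan_boundI : forall k p, yI k p <= n.+1;
  plan_boundJ : forall k p, yJ k p <= n.+1;
  plan_first : transportable yI I;
  plan_second : forall X, realizes X yI -> #|X| = #|I| -> transportable yJ X;
  plan_third : transportable yJ J;
  plan_opt : forall S, TS_sequence e I J S ->
    profile_dist (beyond I) yI + profile_dist yI yJ + profile_dist (beyond J) yJ <=
    TS_length S }.

Lemma realizes_all X y k p : profile y -> realizes X y -> 0 < p -> beyond X k p = y k p.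
Proof.
move=> py rX p0; case: (posnP (beyond X k p)) => [x0|/(beyond_van C p0) [v [nvb <- <-]]]; last exact: rX.
by case: (posnP (y k p)) => [->//|/(prof_van py p0) [v [nvb <- <-]]]; apply: rX.
Qed.

Variables (I J : {set 'I_n}).
Hypotheses (iI : independent e I) (iJ : independent e J) (cIJ : #|I| = #|J|).

(** The targets are the counts of I and J themselves, so the first and third transports have length
    0. *)
Lemma plan_direct : (forall k, leg k = k -> beyond I k 0 = beyond J k 0) ->
  plan I J (beyond I) (beyond J).
Proof.
move=> cnt.
have bIJ : (b \in I) = (b \in J).
  by have := cnt b (leg_body C); rewrite !(beyond_body0 C); case: (b \in I); case: (b \in J).
have cnt1 k : beyond I k 1 = beyond J k 1.
  have head X : 0 < beyond X k 1 -> leg k = k /\ k != b.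
    case/(beyond_van C (ltn0Sn 0)) => v [nvb lv _].
    by rewrite -lv (leg_idem C); case: (leg_nbody C nvb).
  case: (posnP (beyond I k 1)) => [x0|/head [lk nkb]]; last by rewrite -!(beyond0 C) ?cnt.
  by case: (posnP (beyond J k 1)) => [->//|/head [lk nkb]]; rewrite -!(beyond0 C) ?cnt.
have tr (X Y : {set 'I_n}) : independent e Y -> (b \in X) = (b \in Y) -> #|X| = #|Y| ->
    (forall k, beyond X k 1 = beyond Y k 1) -> transportable (beyond Y) X.
  move=> iY bXY cXY eqk; case: (boolP (b \in X)) => bX; [right|by left].
  have bY : b \in Y by rewrite -bXY.
  split; [by move=> k; apply: (head_free C) | by rewrite cXY (card_beyond C) bY | by left].
split=> //; try by [apply: (beyond_profile C) | move=> k p; apply: leqW; apply: beyond_le | apply: tr].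
- by move=> X rX cX; have -> : X = I; [apply: (set_of_beyond C) | apply: tr].
- have z X : profile_dist (beyond X) (beyond X) = 0 by apply: profile_dist_eq.
  by move=> S /(TS_length_dist C); rewrite !z add0n addn0.
Qed.

Lemma plan_detour i j : exit_valid I i -> exit_valid J j ->
  (exists2 k, leg k = k & beyond I k 0 != beyond J k 0) ->
  (forall i' j', exit_valid I i' -> exit_valid J j' ->
     detour_cost b pos leg I J i j <= detour_cost b pos leg I J i' j') ->
  plan I J (exit_profile (beyond I) i) (exit_profile (beyond J) j).
Proof.
move=> vi vj dif opt.
have bd X l k p : exit_profile (beyond X) l k p <= n.+1.
  by rewrite /exit_profile; have := beyond_le pos leg X k p; case: (k == l); lia.
have tr X l : independent e X -> exit_valid X l -> transportable (exit_profile (beyond X) l) X.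
  move=> iX vl; right; split; first by move=> k; apply: (exit_profile_free C).
    exact: (exit_profile_card C).
  by right; exists l => k /negPf nkl; rewrite exit_profile1 nkl subn0.
have pI := exit_profileP C iI vi; have pJ := exit_profileP C iJ vj.
split=> //; try exact: tr.
- move=> X rX cX; right; split; first by move=> k; apply: (exit_profile_free C).
    by rewrite cX cIJ; apply: (exit_profile_card C).
  (* The exit profile accounts for all tokens but one, which must be on the body when the second
     transport starts. *)
  left; have := card_beyond C X; rewrite cX (exit_profile_card C vi).
  under [in X in _ = X -> _]eq_bigr do rewrite (realizes_all _ pI rX) //.
  by case: (b \in X); lia.
- move=> S /(TS_length_detour C)/(_ dif) [i' [j' [vi' vj' le]]].
  apply: leq_trans le; apply: leq_trans (opt _ _ vi' vj').
  by rewrite /detour_cost [profile_dist _ (beyond J)]profile_distC.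
Qed.

End Plan.

Lemma wp_seq_call W p q t1 t2 (R : state -> Prop) Q s : wp W p t1 (fun _ => R) s ->
  (forall s', frame p s s' -> R s' -> wp W q t2 Q s') -> wp W (p;; q) (t1 + t2) Q s.
Proof. by move=> h1 h2; apply: wp_seq; apply: (wp_call h1 (leqnn _)). Qed.

Definition copy_array (a c : nat) := For 10 11 0 (Read 20 a 10;; Write c 10 20).

Definition prepare := find_body;; bfs.

Definition tables :=
  count_beyond 1 10;; count_beyond 2 11;; leg_sizes;;
  exit_valids 10 13;; exit_valids 11 14;;
  exit_profiles 10 15 16;; exit_profiles 11 17 18.

(** The call for legs outside the pair comes last, because variable 30 has to keep its total. *)
Definition costs :=
  cost_table 16 17 20;; cost_table 15 18 21;; cost_table 16 18 22;; cost_table 15 17 19.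

Definition choose := tables;; costs;; best_pair;; compare_counts;; set_targets.

(** The third transport starts afresh from J while array 27 still holds the second target; variable
    54 marks where its part of the log begins. *)
Definition run_plan :=
  copy_array 1 25;; copy_array 10 26;; copy_array 23 27;; transport;;
  copy_array 24 27;; transport;; Copy 54 46;;
  copy_array 2 25;; copy_array 11 26;; transport.

Definition emit_log :=
  For 10 11 54 (Read 20 28 10;; Emit 20;; Read 20 29 10;; Emit 20);;
  Defs.Sub 55 46 54;;
  For 10 11 55 (
    Defs.Sub 56 46 1;; Defs.Sub 56 56 10;;
    Read 20 29 56;; Emit 20;; Read 20 28 56;; Emit 20).

Definition shortest_sliding := prepare;; choose;; run_plan;; emit_log.

Lemma copy_array_ok n W a c s : n < W -> a != c -> vars s 0 = n -> vars s 1 = 1 ->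
  wp W (copy_array a c) (n * 5 + 3)
    (fun _ s' => forall v : 'I_n, arrs s' c v = arrs s a v) s.
Proof.
move=> nW nac s0 s1; rewrite /copy_array.
pose Inv i s' := forall v : 'I_n, v < i -> arrs s' c v = arrs s a v.
apply: (@wp_call _ _ (n * 5 + 3) 0); [apply: (@wp_for _ _ _ _ _ n 2 Inv) => // | by rewrite addn0 |].
  move=> i t [_ fa _] vi H; step; step; rewrite /Inv /= eqxx vi.
  by apply: upd_lt => //; rewrite fa //= inE.
by move=> t _ H v; apply: H.
Qed.

Lemma moves_output_cat n (ms ms' : seq ('I_n * 'I_n)) :
  moves_output (ms ++ ms') = moves_output ms ++ moves_output ms'.
Proof. by rewrite /moves_output map_cat flatten_cat. Qed.

Lemma moves_output_take n (ms : seq ('I_n * 'I_n)) i m0 : i < size ms ->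
  moves_output (take i.+1 ms) =
  rcons (rcons (moves_output (take i ms)) (nth m0 ms i).1) (nth m0 ms i).2.
Proof.
by move=> lt; rewrite (take_nth m0) // -cats1 moves_output_cat /= -!cats1 -catA.
Qed.

Lemma emit_log_ok n W (m0 : 'I_n * 'I_n) (ms ms' : seq ('I_n * 'I_n)) s : size (ms ++ ms') < W ->
  logged s (ms ++ ms') -> vars s 54 = size ms -> vars s 1 = 1 -> out s = [::] ->
  wp W emit_log (size (ms ++ ms') * 10 + 10)
    (fun _ s' => out s' = moves_output (ms ++ rev (map (@swap _) ms'))) s.
Proof.
rewrite size_cat => ltW [v46 lg] v54 s1 out0; rewrite size_cat in v46 lg.
set L := rev _; have sL : size L = size ms' by rewrite size_rev size_map.
rewrite /emit_log; budget ((size ms * 7 + 3) + (size ms' * 9 + 3 + 0).+1).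
pose Inv i t := out t = moves_output (take i ms).
apply: (@wp_seq_call _ _ _ _ _ (Inv (size ms))).
  apply: (@wp_for _ _ _ _ _ _ 4 Inv) => //; first by lia.
    by rewrite /Inv take0 out0.
  move=> i t [_ fa _] vi H; have := ltn_ord i => im.
  have [|e28 e29] := lg i m0; first by lia.
  rewrite nth_cat im in e28 e29.
  by do 4 step; rewrite /Inv /= vi !fa // e28 e29 H (moves_output_take m0).
move=> s2 [fv2 fa2 _]; rewrite /Inv take_size => out2; step.
rewrite !fv2 // v46 v54 addKn.
pose Inv2 i t := out t = moves_output ms ++ moves_output (take i L).
apply: (@wp_call _ _ (size ms' * 9 + 3) 0 _ (Inv2 (size ms'))); last first.
- by move=> t _; rewrite /Inv2 -sL take_size moves_output_cat.
- by lia.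
apply: (@wp_for _ _ _ _ _ _ 6 Inv2) => //=; [by rewrite fv2 | by lia | by rewrite /Inv2 take0 cats0 |].
move=> i t [fv fa _] vi H; have := ltn_ord i => im.
have [|e28 e29] := lg (size ms + (size ms' - i.+1)) m0; first by lia.
have idx : vars t 46 - vars t 1 - vars t 10 = size ms + (size ms' - i.+1).
  by rewrite vi !fv //= !fv2 // v46 s1; lia.
do 6 step; rewrite /Inv2 /= idx !fa //= !fa2 // e28 e29 H (moves_output_take (swap m0)) ?sL //.
rewrite nth_rev ?size_map // (nth_map m0) /=; last by lia.
rewrite nth_cat ifF; last by apply/negbTE; rewrite -leqNgt leq_addr.
by rewrite addKn -!rcons_cat.
Qed.

(** * Tables, costs and the chosen targets *)

Section Assembly.
Variables (n : nat) (e : rel 'I_n) (b : 'I_n) (par : 'I_n -> 'I_n).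
Variables (pos : 'I_n -> nat) (leg : 'I_n -> 'I_n) (q : seq 'I_n) (W : nat).
Hypothesis HW : 100 * (n * n) + 100 * n + 100 < W.
Hypothesis C : spider_coords e b par pos leg.
Local Notation beyond := (beyond pos leg).
Local Notation layout := (layout b par pos leg q).
Local Notation profile_dist := (profile_dist b pos leg).
Local Notation exit_valid := (exit_valid pos leg).
Variables (I J : {set 'I_n}).
Hypotheses (iI : independent e I) (iJ : independent e J) (cIJ : #|I| = #|J|).

Record table_spec (s : state) : Prop := TableSpec {
  tb_I : forall v : 'I_n, arrs s 10 v = beyond I (leg v) (pos v);
  tb_J : forall v : 'I_n, arrs s 11 v = beyond J (leg v) (pos v);
  tb_vI : forall v : 'I_n, arrs s 13 v = exit_valid I v;
  tb_vJ : forall v : 'I_n, arrs s 14 v = exit_valid J v;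
  tb_pI : forall i v : 'I_n, v != b -> exit_profile (beyond I) i (leg v) (pos v) =
            if leg v == i then arrs s 16 v else arrs s 15 v;
  tb_pJ : forall i v : 'I_n, v != b -> exit_profile (beyond J) i (leg v) (pos v) =
            if leg v == i then arrs s 18 v else arrs s 17 v }.

Lemma tables_ok s : layout s ->
  (forall v : 'I_n, arrs s 1 v = (v \in I)) -> (forall v : 'I_n, arrs s 2 v = (v \in J)) ->
  (forall i, arrs s 12 i = 0) ->
  wp W tables (n * (n * 160 + 400) + 400) (fun _ => table_spec) s.
Proof.
move=> L0 sI sJ s12; rewrite /tables.
pose B1 := n * (n * 40 + 50) + 50; pose B2 := n * 50 + 50.
budget (B1 + (B1 + (B2 + (B1 + (B1 + (B2 + (B2 + 0))))))).
apply: (@wp_seq_call _ _ _ _ _ _ _ _ (count_beyond_ok HW L0 (X := I) (a := 1) (c := 10) _ _ _)) => //.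
move=> s1 fr1 t10; have L1 : layout s1 by apply: layout_frame L0 fr1 _ _.
have [_ fa1 _] := fr1.
apply: (@wp_seq_call _ _ _ _ _ _ _ _ (count_beyond_ok HW L1 (X := J) (a := 2) (c := 11) _ _ _)) => //.
  by move=> v; rewrite fa1.
move=> s2 fr2 t11; have L2 : layout s2 by apply: layout_frame L1 fr2 _ _.
have [_ fa2 _] := fr2.
apply: (@wp_seq_call _ _ _ _ _ _ _ _ (leg_sizes_ok HW L2 _)) => //.
  by move=> v; rewrite fa2 // fa1.
move=> s3 fr3 t12; have L3 : layout s3 by apply: layout_frame L2 fr3 _ _.
have [_ fa3 _] := fr3.
apply: (@wp_seq_call _ _ _ _ _ _ _ _ (exit_valids_ok HW C L3 (X := I) (a := 10) (c := 13) _ _ _ _)) => //.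
  by move=> v; rewrite fa3 // fa2.
move=> s4 fr4 t13; have L4 : layout s4 by apply: layout_frame L3 fr4 _ _.
have [_ fa4 _] := fr4.
apply: (@wp_seq_call _ _ _ _ _ _ _ _ (exit_valids_ok HW C L4 (X := J) (a := 11) (c := 14) _ _ _ _)) => //.
- by move=> v; rewrite fa4 // fa3.
- by move=> v; rewrite fa4.
move=> s5 fr5 t14; have L5 : layout s5 by apply: layout_frame L4 fr5 _ _.
have [_ fa5 _] := fr5.
have t10' (v : 'I_n) : arrs s5 10 v = beyond I (leg v) (pos v).
  by rewrite fa5 // fa4 // fa3 // fa2.
have t11' (v : 'I_n) : arrs s5 11 v = beyond J (leg v) (pos v).
  by rewrite fa5 // fa4 // fa3.
apply: (@wp_seq_call _ _ _ _ _ _ _ _ (exit_profiles_ok HW C L5 (X := I) (a := 10) (r := 15) (x := 16) _ _ _ t10')) => //.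
move=> s6 fr6 tI; have L6 : layout s6 by apply: layout_frame L5 fr6 _ _.
have [_ fa6 _] := fr6.
have t11'' (v : 'I_n) : arrs s6 11 v = beyond J (leg v) (pos v) by rewrite fa6.
apply: (@wp_call _ _ B2 0 _ _ _ _ (exit_profiles_ok HW C L6 (X := J) (a := 11) (r := 17) (x := 18) _ _ _ t11'')) => //.
move=> s7 [_ fa7 _] tJ; split=> //.
- by move=> v; rewrite fa7 // fa6.
- by move=> v; rewrite fa7.
- by move=> v; rewrite fa7 // fa6 // fa5.
- by move=> v; rewrite fa7 // fa6.
- by move=> i v nvb; rewrite fa7 // fa7 // tI.
Qed.

Definition vertex_cost (s : state) (a c : bool) (v : 'I_n) :=
  let x := if a then arrs s 16 v else arrs s 15 v in
  let y := if c then arrs s 18 v else arrs s 17 v in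
  absd (arrs s 10 v) x + absd x y + absd y (arrs s 11 v).

Definition leg_cost s a c (k : 'I_n) :=
  \sum_v (if (v != b) && (leg v == k) then vertex_cost s a c v else 0).

Lemma costs_ok s : layout s -> table_spec s ->
  (forall a i, 18 < a -> arrs s a i = 0) ->
  wp W costs (n * 400 + 200)
    (fun _ s' => [/\ forall k : 'I_n, arrs s' 20 k = leg_cost s true false k,
      forall k : 'I_n, arrs s' 21 k = leg_cost s false true k,
      forall k : 'I_n, arrs s' 22 k = leg_cost s true true k,
      forall k : 'I_n, arrs s' 19 k = leg_cost s false false k
      & vars s' 30 = \sum_(v | v != b) vertex_cost s false false v]) s.
Proof.
move=> L0 tb z; rewrite /costs; pose B := n * 100 + 50.
budget (B + (B + (B + (B + 0)))).
have bd v : v != b -> [/\ arrs s 10 v <= n.+1, arrs s 11 v <= n.+1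
    & [/\ arrs s 15 v <= n.+1, arrs s 16 v <= n.+1, arrs s 17 v <= n.+1 & arrs s 18 v <= n.+1]].
  move=> nvb; have [nlb _ _] := leg_nbody C nvb.
  have bE X i k p : exit_profile (beyond X) i k p <= n.+1.
    by rewrite /exit_profile; have := beyond_le pos leg X k p; case: (k == i); lia.
  have := tb_pI tb (leg v) nvb; have := tb_pI tb b nvb.
  have := tb_pJ tb (leg v) nvb; have := tb_pJ tb b nvb.
  rewrite eqxx (negPf nlb) => <- <- <- <-; rewrite (tb_I tb) (tb_J tb).
  by split; [apply/leqW/beyond_le | apply/leqW/beyond_le |].
have call x y w (a c : bool) s1 : layout s1 -> (forall d, d < 19 -> arrs s1 d = arrs s d) ->
    x = (if a then 16 else 15) -> y = (if c then 18 else 17) -> 18 < w ->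
    (forall i, arrs s1 w i = 0) ->
    wp W (cost_table x y w) B (fun _ s' => (forall k : 'I_n, arrs s' w k = leg_cost s a c k) /\
      vars s' 30 = \sum_(v | v != b) vertex_cost s a c v) s1.
  move=> L1 eqa xE yE w18 w0.
  have xw : x < w by rewrite xE; case: (a); lia.
  have yw : y < w by rewrite yE; case: (c); lia.
  have w11 : 11 < w by lia.
  have := @cost_table_ok n b par pos leg q W HW x y w (fun v => arrs s 10 v)
    (fun v => arrs s x v) (fun v => arrs s y v) (fun v => arrs s 11 v) s1 L1 xw yw w11 w0.
  have FE (v : 'I_n) : absd (arrs s 10 v) (arrs s x v) + absd (arrs s x v) (arrs s y v) +
      absd (arrs s y v) (arrs s 11 v) = vertex_cost s a c v.
    by rewrite /vertex_cost xE yE; case: (a); case: (c).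
  move=> H; apply: (@wp_call _ _ B 0 _ _ _ _ (H _ _)) => [v nvb|v nvb||].
  - by split; rewrite eqa // ?xE ?yE; [case: (a) | case: (c)].
  - by have [? ? [? ? ? ?]] := bd v nvb; split; rewrite // ?xE ?yE; [case: (a) | case: (c)].
  - by rewrite addn0.
  move=> s' _ [h1 h2]; split=> [k|].
    by rewrite h1; apply: eq_bigr => v _; rewrite FE.
  by rewrite h2; apply: eq_bigr => v _; rewrite FE.
have small p s1 s2 : frame p s1 s2 -> all (fun d => d \notin mod_arrs p) (iota 0 19) ->
    (forall d, d < 19 -> arrs s1 d = arrs s d) -> forall d, d < 19 -> arrs s2 d = arrs s d.
  move=> [_ fa _] /allP al eqs d d19; rewrite fa ?eqs //; apply: al.
  by rewrite mem_iota.
apply: wp_seq_call (call 16 17 20 true false s _ _ _ _ _ _) _ => //; first by move=> i; apply: z.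
move=> s1 fr1 [t20 _]; have [_ fa1 _] := fr1.
have L1 : layout s1 by apply: layout_frame L0 fr1 _ _.
have e1 := small _ _ _ fr1 isT (fun _ _ => erefl).
apply: wp_seq_call (call 15 18 21 false true s1 L1 e1 _ _ _ _) _ => //.
  by move=> i; rewrite fa1 // z.
move=> s2 fr2 [t21 _]; have [_ fa2 _] := fr2.
have L2 : layout s2 by apply: layout_frame L1 fr2 _ _.
have e2 := small _ _ _ fr2 isT e1.
apply: wp_seq_call (call 16 18 22 true true s2 L2 e2 _ _ _ _) _ => //.
  by move=> i; rewrite fa2 // fa1 // z.
move=> s3 fr3 [t22 _]; have [_ fa3 _] := fr3.
have L3 : layout s3 by apply: layout_frame L2 fr3 _ _.
have e3 := small _ _ _ fr3 isT e2.
apply: (@wp_call _ _ B 0 _ _ _ _ (call 15 17 19 false false s3 L3 e3 _ _ _ _)) => //.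
  by move=> i; rewrite fa3 // fa2 // fa1 // z.
move=> s4 [_ fa4 _] [t19 v30]; split=> // k.
- by rewrite fa4 // fa3 // fa2.
- by rewrite fa4 // fa3.
- by rewrite fa4.
Qed.

Definition target_spec (s : state) : Prop := exists yI yJ, plan e b pos leg I J yI yJ /\
  forall v, v != b -> arrs s 23 v = yI (leg v) (pos v) /\ arrs s 24 v = yJ (leg v) (pos v).

Lemma choose_ok s : layout s -> reconfigurable e I J ->
  (forall v : 'I_n, arrs s 1 v = (v \in I)) -> (forall v : 'I_n, arrs s 2 v = (v \in J)) ->
  (forall a i, 9 < a -> arrs s a i = 0) ->
  wp W choose (n * (n * 250 + 1500) + 1500)
    (fun _ s' => [/\ forall v : 'I_n, arrs s' 10 v = beyond I (leg v) (pos v),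
       forall v : 'I_n, arrs s' 11 v = beyond J (leg v) (pos v) & target_spec s']) s.
Proof.
move=> L0 [S0 TS0] sI sJ z; rewrite /choose.
budget (n * (n * 160 + 400) + 400 + (n * 400 + 200 + (n * (n * 60 + 50) + 50 + (n * 50 + 50 + (n * 50 + 50 + 0))))).
apply: wp_seq_call (tables_ok L0 sI sJ _) _; first by move=> i; apply: z.
move=> s1 fr1 tb; have [fv1 fa1 _] := fr1.
have L1 : layout s1 by apply: layout_frame L0 fr1 _ _.
apply: wp_seq_call (costs_ok L1 tb _) _.
  move=> a i a18; rewrite fa1; first by apply: z; lia.
  by do 18 (case: a a18 => // a a18); rewrite /= !inE; lia.
move=> s2 fr2 [t20 t21 t22 t19 v30]; have [fv2 fa2 _] := fr2.
have L2 : layout s2 by apply: layout_frame L1 fr2 _ _.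
have costE i j : detour_cost b pos leg I J i j =
    \sum_(v | v != b) vertex_cost s1 (leg v == i) (leg v == j) v.
  rewrite /detour_cost -!big_split; apply: eq_bigr => v nvb /=.
  by rewrite /vertex_cost (tb_pI tb) // (tb_pJ tb) // (tb_I tb) (tb_J tb).
have Fb a c v : v != b -> vertex_cost s1 a c v <= 3 * n.+1.
  move=> nvb; have [nlb _ _] := leg_nbody C nvb.
  have bE X i k p : exit_profile (beyond X) i k p <= n.+1.
    by rewrite /exit_profile; have := beyond_le pos leg X k p; case: (k == i); lia.
  have := bE I (leg v) (leg v) (pos v); have := bE I b (leg v) (pos v).
  have := bE J (leg v) (leg v) (pos v); have := bE J b (leg v) (pos v).
  rewrite !(tb_pI tb) // !(tb_pJ tb) // eqxx (negPf nlb).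
  have := beyond_le pos leg I (leg v) (pos v); have := beyond_le pos leg J (leg v) (pos v).
  by rewrite -(tb_I tb) -(tb_J tb) /vertex_cost /absd; case: (a); case: (c); lia.
have lb a c k : leg_cost s1 a c k <= n * (3 * n.+1).
  by apply: sum_le_bound => v; case: (boolP (v != b)) => //= nvb; case: ifP => // _; apply: Fb.
apply: wp_seq_call (best_pair_ok HW (vI := exit_valid I) (vJ := exit_valid J)
  (K := detour_cost b pos leg I J) L2 _ _ t19 t20 t21 t22 _ _ _ _) _.
- by move=> v; rewrite fa2 // (tb_vI tb).
- by move=> v; rewrite fa2 // (tb_vJ tb).
- by move=> i; rewrite costE v30; apply: pair_cost_eq.
- by move=> i j nij; rewrite costE v30; apply: pair_cost_neq.
- by rewrite v30 big_mkcond /=; apply: sum_le_bound => v; case: ifP => // nvb; apply: Fb.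
- by move=> v; split; apply: lb.
move=> s3 fr3 bp; have [fv3 fa3 _] := fr3.
have L3 : layout s3 by apply: layout_frame L2 fr3 _ _.
have A s' p : frame p s3 s' -> 10 \notin mod_arrs p -> 11 \notin mod_arrs p ->
   (forall v : 'I_n, arrs s' 10 v = beyond I (leg v) (pos v)) /\
   (forall v : 'I_n, arrs s' 11 v = beyond J (leg v) (pos v)).
  by move=> [_ fa _] n10 n11; split=> v; rewrite fa // fa3 // fa2 // ?(tb_I tb) ?(tb_J tb).
have [t10 t11] := A s3 Skip (frame_refl _ _) isT isT.
apply: wp_seq_call (compare_counts_ok HW C L3 t10 t11) _.
move=> s4 fr4 v35; have [fv4 fa4 _] := fr4.
have L4 : layout s4 by apply: layout_frame L3 fr4 _ _.
have [t10' t11'] := A s4 _ fr4 isT isT.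
have E a : a < 19 -> 14 < a -> arrs s4 a = arrs s1 a.
  move=> h1 h2; rewrite fa4 // fa3 // fa2 //.
  by do 19 (case: a h1 h2 => // a h1 h2).
case: forallP v35 => [direct|dif] v35.
  apply: (@wp_call _ _ (n * 50 + 50) 0 _ _ _ _ (@set_targets_ok n b par pos leg q W HW b b s4 L4 _)) => //.
  move=> s5 [_ fa5 _] tg; split=> [v|v|]; rewrite ?fa5 //.
  exists (beyond I), (beyond J); split.
    apply: (plan_direct C) => // k lk; have := direct k; rewrite lk eqxx => /eqP //.
  by move=> v nvb; have [-> ->] := tg v; rewrite v35 /= t10' t11'.
have dif' : exists2 k, leg k = k & beyond I k 0 != beyond J k 0.
  case: (pickP (fun k => (leg k == k) && (beyond I k 0 != beyond J k 0))) => [k /andP [/eqP]|no].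
    by exists k.
  by case: dif => k; apply/implyP => lk; have := no k; rewrite lk /= => /negbFE.
have [i [j [/andP [vi vj] v33 v34 opt]]] : exists i j : 'I_n,
    [/\ exit_valid I i && exit_valid J j, vars s3 33 = i, vars s3 34 = j
      & forall i' j', exit_valid I i' && exit_valid J j' ->
          detour_cost b pos leg I J i j <= detour_cost b pos leg I J i' j'].
  (* The given sequence supplies a valid pair, so the search cannot have come back empty. *)
  have [i [j [vi vj _]]] := TS_length_detour C TS0 dif'.
  by apply: bp; exists i, j; rewrite vi.
apply: (@wp_call _ _ (n * 50 + 50) 0 _ _ _ _ (@set_targets_ok n b par pos leg q W HW i j s4 L4 _)) => //.
  by move=> _; rewrite !fv4.
move=> s5 [_ fa5 _] tg; split=> [v|v|]; rewrite ?fa5 //.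
exists (exit_profile (beyond I) i), (exit_profile (beyond J) j); split.
  by apply: (plan_detour C) => // i' j' vi' vj'; apply: opt; rewrite vi'.
move=> v nvb; have [-> ->] := tg v; rewrite v35 /= !E //.
by rewrite (tb_pI tb) // (tb_pJ tb).
Qed.
End Assembly.

(** * The three transports and their log *)

Section Run.
Variables (n : nat) (e : rel 'I_n) (b : 'I_n) (par : 'I_n -> 'I_n).
Variables (pos : 'I_n -> nat) (leg : 'I_n -> 'I_n) (q : seq 'I_n) (W : nat).
Hypothesis HW : 100 * (n * n) + 100 * n + 100 < W.
Hypothesis C : spider_coords e b par pos leg.
Local Notation beyond := (beyond pos leg).
Local Notation layout := (layout b par pos leg q).
Local Notation profile_dist := (profile_dist b pos leg).
Local Notation conf := (conf e b par pos leg q).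
Variables (I J : {set 'I_n}).
Hypotheses (iI : independent e I) (iJ : independent e J) (cIJ : #|I| = #|J|).

Lemma profile_dist_bound f g : (forall k p, f k p <= n.+1) -> (forall k p, g k p <= n.+1) ->
  profile_dist f g <= n * n.+1.
Proof.
move=> bf bg; apply: sum_le_bound => v; rewrite /absd.
by have := bf (leg v) (pos v); have := bg (leg v) (pos v); lia.
Qed.

Lemma transport_spec y (X0 : {set 'I_n}) ms0 s : profile b pos leg y -> (forall k p, y k p <= n.+1) ->
  size ms0 <= 2 * (n * n.+1) -> layout s -> logged s ms0 -> independent e X0 ->
  transportable b pos leg y X0 ->
  (forall v, v != b -> arrs s 27 v = y (leg v) (pos v)) ->
  (forall v : 'I_n, arrs s 25 v = (v \in X0)) ->
  (forall v, v != b -> arrs s 26 v = beyond X0 (leg v) (pos v)) ->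
  wp W transport (n * (n * 250 + 500) + 100)
    (fun _ s' => exists X ms, [/\ logged s' (ms0 ++ ms), moves e X0 ms X, realizes b pos leg X y,
       size ms = profile_dist (beyond X0) y
       & (forall v : 'I_n, arrs s' 25 v = (v \in X)) /\
         (forall v, v != b -> arrs s' 26 v = beyond X (leg v) (pos v))]) s.
Proof.
move=> py by1 sz0 L lg iX tr s27 s25 s26.
(* Each transport takes at most [n * n.+1] slides, and at most two precede this one. *)
have HL : size ms0 + profile_dist (beyond X0) y < W.
  have := @profile_dist_bound (beyond X0) y; have bb k p : beyond X0 k p <= n.+1.
    exact/leqW/beyond_le.
  by move=> /(_ bb by1); lia.
have cf : conf y X0 ms0 X0 s.
  by split=> //; exists [::]; split; rewrite ?cats0 //; apply: moves_nil.
apply: (@wp_call _ _ _ 0 _ _ _ _ (transport_ok HW C py HL cf tr)); first by rewrite addn0.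
move=> s' _ [X [[_ _ tok bey _ [ms [mv lg' sz]]] rX]]; exists X, ms; split=> //.
by rewrite (profile_dist_eq (g := y)) // addn0 in sz.
Qed.

Lemma run_plan_ok s yI yJ : layout s -> plan e b pos leg I J yI yJ ->
  (forall v : 'I_n, arrs s 1 v = (v \in I)) -> (forall v : 'I_n, arrs s 2 v = (v \in J)) ->
  (forall v : 'I_n, arrs s 10 v = beyond I (leg v) (pos v)) ->
  (forall v : 'I_n, arrs s 11 v = beyond J (leg v) (pos v)) ->
  (forall v, v != b -> arrs s 23 v = yI (leg v) (pos v) /\ arrs s 24 v = yJ (leg v) (pos v)) ->
  vars s 46 = 0 ->
  wp W run_plan (n * (n * 750 + 1600) + 400)
    (fun _ s' => exists ms ms', [/\ logged s' (ms ++ ms'), vars s' 54 = size ms,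
       moves e I (ms ++ rev (map (@swap _) ms')) J, size (ms ++ ms') <= 3 * (n * n.+1)
       & forall S, TS_sequence e I J S -> size (ms ++ ms') <= TS_length S]) s.
Proof.
move=> L0 [pI pJ bI bJ tr1 tr2 tr3 opt] a1 a2 a10 a11 a23 v46; rewrite /run_plan.
have nW : n < W by lia.
pose c := n * 5 + 3; pose t := n * (n * 250 + 500) + 100.
budget (c + (c + (c + (t + (c + (t + (c + (c + (t + 0))).+1)))))).
have cp a d s' : layout s' -> a != d -> wp W (copy_array a d) c
    (fun _ s' => forall v : 'I_n, arrs s' d v = arrs s' a v) s'.
  move=> L' nad; apply: (@wp_call _ _ c 0 _ _ _ _ (copy_array_ok nW nad (lay_n L') (lay_one L'))).
    by rewrite addn0.
  by move=> s'' [_ fa _] h v; rewrite h fa //= inE.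
have bX X k p : beyond X k p <= n.+1 by apply/leqW/beyond_le.
have [d1 d2 d3] : [/\ profile_dist (beyond I) yI <= n * n.+1, profile_dist yI yJ <= n * n.+1
    & profile_dist (beyond J) yJ <= n * n.+1] by split; apply: profile_dist_bound.
apply: wp_seq_call (cp 1 25 _ L0 isT) _ => s1 fr1 c25.
have L1 : layout s1 by apply: layout_frame L0 fr1 _ _.
have [fv1 fa1 _] := fr1.
apply: wp_seq_call (cp 10 26 _ L1 isT) _ => s2 fr2 c26.
have L2 : layout s2 by apply: layout_frame L1 fr2 _ _.
have [fv2 fa2 _] := fr2.
apply: wp_seq_call (cp 23 27 _ L2 isT) _ => s3 fr3 c27.
have L3 : layout s3 by apply: layout_frame L2 fr3 _ _.
have [fv3 fa3 _] := fr3.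
apply: wp_seq_call (transport_spec (ms0 := [::]) pI bI _ L3 _ iI tr1 _ _ _) _ => //.
- by split=> //; rewrite fv3 // fv2 // fv1.
- by move=> v nvb; rewrite c27 fa3 // fa2 // fa1 //; case: (a23 v nvb).
- by move=> v; rewrite fa3 // fa2 // c25 fa1 // a1.
- by move=> v nvb; rewrite fa3 // c26 fa2 // fa1 // a10.
move=> s4 fr4 [I1 [ms1 [lg1 mv1 r1 z1 [t25 t26]]]]; rewrite cat0s in lg1.
have L4 : layout s4 by apply: layout_frame L3 fr4 _ _.
have [_ fa4 _] := fr4; have i1 := moves_indep iI mv1.
apply: wp_seq_call (cp 24 27 _ L4 isT) _ => s5 fr5 c27'.
have L5 : layout s5 by apply: layout_frame L4 fr5 _ _.
have [fv5 fa5 _] := fr5.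
apply: wp_seq_call (transport_spec (X0 := I1) (ms0 := ms1) pJ bJ _ L5 _ i1 _ _ _ _) _.
- by rewrite z1; lia.
- by case: lg1 => l1 l2; split; rewrite ?fv5 ?fa5.
- by apply: tr2 r1 _; apply: card_moves mv1.
- move=> v nvb; rewrite c27' fa5 // fa4 // fa3 // fa2 // fa1 //.
  by case: (a23 v nvb).
- by move=> v; rewrite fa5.
- by move=> v nvb; rewrite fa5 // t26.
move=> s6 fr6 [I2 [ms2 [lg2 mv2 r2 z2 _]]].
have L6 : layout s6 by apply: layout_frame L5 fr6 _ _.
have [_ fa6 _] := fr6.
rewrite (profile_dist_congr _ r1) in z2.
step; set s7 := set_var _ 54 _.
have L7 : layout s7 by case: L6; split.
apply: wp_seq_call (cp 2 25 _ L7 isT) _ => s8 fr8 c25'.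
have L8 : layout s8 by apply: layout_frame L7 fr8 _ _.
have [fv8 fa8 _] := fr8.
apply: wp_seq_call (cp 11 26 _ L8 isT) _ => s9 fr9 c26'.
have L9 : layout s9 by apply: layout_frame L8 fr9 _ _.
have [fv9 fa9 _] := fr9.
have lg9 : logged s9 (ms1 ++ ms2).
  by case: lg2 => l1 l2; split; rewrite ?fv9 ?fv8 // fa9 // fa8 // fa9 // fa8.
apply: (@wp_call _ _ t 0 _ _ _ _ (transport_spec (X0 := J) (ms0 := ms1 ++ ms2) pJ bJ _ L9 lg9 iJ tr3 _ _ _)).
- by rewrite size_cat z1 z2; lia.
- move=> v nvb; rewrite fa9 // fa8 //= fa6 // c27' fa5 // fa4 // fa3 // fa2 // fa1 //.
  by case: (a23 v nvb).
- by move=> v; rewrite fa9 // c25' fa8 //= fa6 // fa5 // fa4 // fa3 // fa2 // fa1.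
- by move=> v nvb; rewrite c26' fa9 // fa8 //= fa6 // fa5 // fa4 // fa3 // fa2 // fa1.
- by rewrite addn0.
move=> s10 [fv10 _ _] [J2 [ms3 [lg3 mv3 r3 z3 _]]]; exists (ms1 ++ ms2), ms3.
(* Both sets have the counts [yJ] and the same size, so the runs from I and from J meet. *)
have E2 : I2 = J2.
  apply: (set_of_beyond C) => [v nvb|]; first by rewrite r2 // r3.
  by rewrite (card_moves mv2) (card_moves mv1) (card_moves mv3).
split=> //.
- by rewrite fv10 // fv9 // fv8 //=; case: lg2.
- apply: moves_cat (moves_cat mv1 mv2) _; rewrite E2; apply: moves_rev mv3 => //.
  by move=> x y; rewrite (edge_sym C).
- by rewrite !size_cat z1 z2 z3; lia.
- by move=> S /opt; rewrite !size_cat z1 z2 z3.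
Qed.

End Run.

Lemma set_arrayE n (X : {set 'I_n}) (v : 'I_n) : set_array X v = (v \in X).
Proof.
rewrite /set_array; congr nat_of_bool; apply/existsP/idP => [[x]|vX].
  by case/andP => /eqP/ord_inj ->.
by exists v; rewrite eqxx.
Qed.

Lemma prepare_ok n (e : rel 'I_n) (I J : {set 'I_n}) W :
  100 * (n * n) + 100 * n + 100 < W -> is_spider e ->
  wp W prepare (n * (n * 140 + 150) + 150)
    (fun _ s => exists b par pos leg q,
       spider_coords e b par pos leg /\ layout b par pos leg q s) (input_state e I J).
Proof.
move=> HW [tree_e [b [db ub]]]; rewrite /prepare.
have [[sym _] _ conn _] := tree_e.
budget (100 * (n * n) + 100 * n + 100 + (n * (n * 40 + 50) + 50 + 0)).
apply: wp_seq_call (find_body_ok I J HW (b := b) _ db) _ => [v dv|].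
  by rewrite (ub v dv).
move=> s1 [fv1 fa1 _] [o1 v4 a3].
have n0 : vars s1 0 = n by rewrite fv1.
apply: (@wp_call _ _ _ 0 _ _ _ _ (bfs_ok HW sym conn n0 o1 v4 a3 _ _)).
- by rewrite fa1.
- by move=> a i a3'; rewrite fa1; [case: a a3' => [|[|[|a]]] | move: a3'; rewrite /= inE; lia].
- by [].
move=> s2 [fv2 _ _] [q [sq bi]].
have deg v : v != b -> degree e v < 3.
  by move=> nvb; rewrite ltnNge; apply: contra nvb => dv; rewrite (ub v dv).
have [par [pos [leg [C L]]]] : exists par pos leg,
    spider_coords e b par pos leg /\ layout b par pos leg q s2.
  by apply: (layout_of_bfs tree_e deg bi sq); rewrite fv2.
by exists b, par, pos, leg, q.
Qed.

Theorem theorem1 :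
  exists (p : cmd) (k c : nat),
    forall (n : nat) (e : rel 'I_n) (I J : {set 'I_n}),
      is_spider e -> independent e I -> independent e J -> #|I| = #|J| ->
      reconfigurable e I J ->
      exists (t : nat) (s : state) (S : seq {set 'I_n})
             (ms : seq ('I_n * 'I_n)),
        [/\ exec (word_bound k n) p (input_state e I J) t s,
            t <= c * n ^ 2,
            shortest_TS_sequence e I J S,
            slides_of e S ms
          & out s = moves_output ms].
Proof.
(* The bounds of the four phases are quadratic polynomials whose coefficients add up to 6510; as n
   is positive, each monomial is at most [n * n]. *)
exists shortest_sliding, 10, (100 * 100) => n e I J spider iI iJ cIJ rec.
set W := word_bound 10 n.
have HW : 100 * (n * n) + 100 * n + 100 < W.
  (* The factor (n + 2)^8 is at least 256 and absorbs the constants. *)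
  have -> : W = (n + 2) ^ 2 * (n + 2) ^ 8 by rewrite /W /word_bound -expnD.
  have : 2 ^ 8 <= (n + 2) ^ 8 by rewrite leq_exp2r // leq_addl.
  by move: ((n + 2) ^ 8) => z; rewrite (_ : 2 ^ 8 = 256) // => z256; nia.
have n0 : 0 < n by case: spider => -[_ + _ _] _; rewrite card_ord.
suff [t [r [s [ex le [S [ms [h1 h2 h3]]]]]]] : wp W shortest_sliding (100 * 100 * (n * n))
    (fun _ s => exists S ms, [/\ shortest_TS_sequence e I J S, slides_of e S ms
       & out s = moves_output ms]) (input_state e I J).
  by exists t, s, S, ms; split=> //; rewrite -mulnn; lia.
rewrite /shortest_sliding; have nn : n <= n * n by rewrite leq_pmulr.
budget (n * (n * 140 + 150) + 150 + (n * (n * 250 + 1500) + 1500 +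
  (n * (n * 750 + 1600) + 400 + (3 * (n * n.+1) * 10 + 10 + 0)))).
apply: wp_seq_call (prepare_ok I J HW spider) _.
move=> s1 [fv1 fa1 fo1] [b [par [pos [leg [q [C L1]]]]]].
apply: wp_seq_call (choose_ok HW C iI iJ cIJ L1 rec _ _ _) _.
- by move=> v; rewrite fa1 //= set_arrayE.
- by move=> v; rewrite fa1 //= set_arrayE.
- move=> a i a9; rewrite fa1; first by case: a a9 => [|[|[|a]]].
  by do 10 (case: a a9 => // a a9).
move=> s2 fr2 [a10 a11 [yI [yJ [pl tg]]]]; have [fv2 fa2 fo2] := fr2.
have L2 : layout b par pos leg q s2 by apply: layout_frame L1 fr2 _ _.
apply: wp_seq_call (run_plan_ok HW C iI iJ cIJ L2 pl _ _ a10 a11 tg _) _.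
- by move=> v; rewrite fa2 // fa1 //= set_arrayE.
- by move=> v; rewrite fa2 // fa1 //= set_arrayE.
- by rewrite fv2 // fv1.
move=> s3 [fv3 fa3 fo3] [ms [ms' [lg v54 mv sz opt]]].
have szW : size (ms ++ ms') < W by lia.
apply: (@wp_call _ _ _ 0 _ _ _ _ (emit_log_ok (b, b) szW lg v54 _ _)).
- by rewrite fv3 // (lay_one L2).
- by rewrite fo3 // fo2 // fo1.
- by lia.
move=> s4 _ out4; have [S [TS sl]] := moves_TS iI mv.
exists S, (ms ++ rev (map (@swap _) ms')); split=> //; split=> // S' TS'.
have [<- _] := sl; apply: leq_trans (opt S' TS').
by rewrite !size_cat size_rev size_map.
Qed.
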